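(* Let $\sigma\ge 0$, $\rho^+,\rho^->0$, $g\neq 0$ be fixed real constants and let $A=\frac{\rho^+-\rho^-}{\rho^++\rho^-}$. Consider, for a real function $h(\alpha,t)$ that is $2\pi$-periodic in $\alpha$ (i.e. $\alpha\in\mathbb{T}$), the $h$-model equation $$h_{tt} = A g\,\Lambda h - \frac{\sigma}{\rho^++\rho^-}\Lambda^3 h - A\,\partial_\alpha\big(h_t\, H h_t\big),\qquad h(\cdot,0)=h_0,\quad h_t(\cdot,0)=h_1 .$$ Suppose that $(h_0,h_1)\in H^{2.5+\mathrm{sgn}(\sigma)}(\mathbb{T})\times H^2(\mathbb{T})$ and let $$\lambda:=\min_{\alpha\in\mathbb{T}} A\,h_1(\alpha).$$ If $\lambda>0$, then there exist a time $0<T^*=T^*(h_0,h_1)\le\infty$ and a unique classical solution $h$ of the initial value problem $h_{tt} = A g\,\Lambda h - \frac{\sigma}{\rho^++\rho^-}\Lambda^3 h - A\,\partial_\alpha(h_t\, H h_t)$, $h(\cdot,0)=h_0$, $h_t(\cdot,0)=h_1$, satisfying $$h\in C^0\big([0,T^*];H^{2.5+\mathrm{sgn}(\sigma)}(\mathbb{T})\big),\qquad h_t\in C^0\big([0,T^*];H^2(\mathbb{T})\big)\cap L^2\big(0,T^*;H^{2.5}(\mathbb{T})\big).$$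
   Context: $\mathbb{T}=[-\pi,\pi]$ with endpoints identified. $H$ is the periodic Hilbert transform, $\widehat{Hf}(k)=-i\,\mathrm{sgn}(k)\hat f(k)$, and $\Lambda=H\partial_\alpha$, i.e. $\widehat{\Lambda f}(k)=|k|\hat f(k)$. $\mathrm{sgn}(0)=0$ and $\mathrm{sgn}(\sigma)=1$ for $\sigma>0$. $H^s(\mathbb{T})$ is the usual $L^2$-based Sobolev space. $A$ is the Atwood number, $\sigma$ the surface tension, $g$ the acceleration, $\rho^\pm$ the fluid densities. A solution in the stated class is understood to satisfy the equation as an identity of functions in $L^2(\mathbb{T})$ for (a.e.) $t$. *)

(* Defs.v *)
From HB Require Import structures.
From mathcomp Require Import all_boot all_order all_algebra.
From mathcomp Require Import all_classical all_reals all_analysis.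
From mathcomp Require Import complex.

Set Implicit Arguments.
Unset Strict Implicit.
Unset Printing Implicit Defensive.

Import Order.TTheory GRing.Theory Num.Theory numFieldNormedType.Exports.

Local Open Scope classical_set_scope.
Local Open Scope ring_scope.

Section Torus.
Context {R : realType}.
Implicit Types f F : R -> R.

(* The torus is [-pi, pi] with endpoints identified, so a function on it is a
   2pi-periodic function on R; elements of L^2 are not quotiented, and equality
   in L^2 is [eq_torus]. *)
Definition torus : set R := `[- pi, pi].

Definition eq_torus f F : Prop := ae_eq lebesgue_measure torus f F.

Definition l2_sqnorm f : \bar R :=
  (\int[lebesgue_measure]_(x in torus) ((f x) ^+ 2)%:E)%E.

Definition L2_torus f : Prop :=
  [/\ periodic f (pi *+ 2), measurable_fun setT f & (l2_sqnorm f < +oo)%E].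

(* (2 pi)^-1 \int_{-pi}^{pi} f(x) e^{-ikx} dx, by real and imaginary part. *)
Definition fourier f (k : int) : R[i] :=
  Complex
    ((pi *+ 2)^-1 * \int[lebesgue_measure]_(x in torus) (f x * cos (k%:~R * x)))
    (- ((pi *+ 2)^-1 *
        \int[lebesgue_measure]_(x in torus) (f x * sin (k%:~R * x)))).

Definition sobolev_sqnorm (s : R) f : \bar R :=
  \esum_(k in [set: int])
    ((1 + k%:~R ^+ 2) `^ s *
     (complex.Re (fourier f k) ^+ 2 + complex.Im (fourier f k) ^+ 2))%:E.

Definition sobolev (s : R) f : Prop :=
  L2_torus f /\ (sobolev_sqnorm s f < +oo)%E.

(* The operator with Fourier symbol [m], as a function in L^2, unique up to
   [eq_torus].  When the image of [f] is not a function in L^2 the value is the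
   junk 0. *)
Definition fourier_mult (m : int -> R[i]) f : R -> R :=
  xget (fun=> 0)
    [set F | L2_torus F /\ forall k, fourier F k = m k * fourier f k].

Definition hilbert : (R -> R) -> R -> R :=
  fourier_mult (fun k => - Complex 0 1 * (sgz k)%:~R).

Definition Lambda : (R -> R) -> R -> R :=
  fourier_mult (fun k => `|k|%:~R).

Definition d_alpha : (R -> R) -> R -> R :=
  fourier_mult (fun k => Complex 0 1 * k%:~R).

End Torus.

Section Evolution.
Context {R : realType}.
(* Time-dependent functions are written with time as first argument. *)
Implicit Types (T : \bar R) (u v : R -> R -> R).

(* [0, T], read as [0, +oo) when T = +oo. *)
Definition time_interval T : set R := [set t | 0 <= t /\ (t%:E <= T)%E].

(* v = u_t strongly in L^2 at every time of [0, T] (one-sided at endpoints). *)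
Definition is_time_derivative T u v : Prop :=
  forall t, time_interval T t ->
    [/\ L2_torus (u t), L2_torus (v t) &
        l2_sqnorm (fun x => (u r x - u t x) / (r - t) - v t x)
          @[r --> within (time_interval T) t^'] --> 0%E].

(* C^0([0, T]; H^s) *)
Definition continuous_sobolev T (s : R) u : Prop :=
  forall t, time_interval T t ->
    sobolev s (u t) /\
    sobolev_sqnorm s (fun x => u r x - u t x)
      @[r --> within (time_interval T) (nbhs t)] --> 0%E.

(* L^2(0, T; H^s).  As H^s is separable, strong measurability in time amounts to
   measurability of each Fourier coefficient. *)
Definition square_integrable_sobolev T (s : R) u : Prop :=
  [/\ forall k,
        measurable_fun (time_interval T)
          (fun t => complex.Re (fourier (u t) k)) /\
        measurable_fun (time_interval T)
          (fun t => complex.Im (fourier (u t) k)),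
      {ae lebesgue_measure, forall t, time_interval T t -> sobolev s (u t)} &
      (\int[lebesgue_measure]_(t in time_interval T) sobolev_sqnorm s (u t)
        < +oo)%E].

Definition atwood (rhop rhom : R) : R := (rhop - rhom) / (rhop + rhom).

Definition h_model_rhs (sigma rhop rhom g : R) (h ht : R -> R) : R -> R :=
  fun x =>
    atwood rhop rhom * g * Lambda h x
    - sigma / (rhop + rhom) * Lambda (Lambda (Lambda h)) x
    - atwood rhop rhom * d_alpha (fun y => ht y * hilbert ht y) x.

(* Each h(., t) and h_t(., t), being in H^s with s > 1/2, is identified with its
   continuous representative. *)
Definition h_model_solution (sigma rhop rhom g : R) (h0 h1 : R -> R)
    T (h : R -> R -> R) : Prop :=
  exists ht htt : R -> R -> R,
    [/\ is_time_derivative T h ht /\ is_time_derivative T ht htt,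
        forall t, time_interval T t -> continuous (h t) /\ continuous (ht t),
        forall t, time_interval T t ->
          eq_torus (htt t) (h_model_rhs sigma rhop rhom g (h t) (ht t)),
        h 0 = h0 /\ ht 0 = h1 &
        [/\ continuous_sobolev T (5 / 2 + Num.sg sigma) h,
            continuous_sobolev T 2 ht &
            square_integrable_sobolev T (5 / 2) ht]].

End Evolution.

Definition is_minimum {R : realType} (D : set R) (f : R -> R) (m : R) : Prop :=
  (exists2 x, D x & f x = m) /\ (forall x, D x -> m <= f x).

(* Main.v *)
(* The product u Hu of a function with its Hilbert transform has at frequency k > 0
   the coefficient of -(i/2) W^2, where W is the analytic part of u.  Hence, in
   terms of the coefficients w_k of h_t and eta_k of h with k >= 0, the equation is
   triangular: eta_k' = w_k and
     w_k' = - (A/2) k \sum_(j <= k) w_j w_(k-j) + (A g k - s k^3) eta_k,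
   with s = sigma / (rhop + rhom).  For each k this is a linear second-order
   equation forced by the modes below k, so that the modes exist for all time and
   are determined by the initial data.

   It remains to bound the energy \sum_k k^4 |w_k|^2 + (s k^7 + k^5) |eta_k|^2 on a
   time interval independent of the truncation.  The leading term of its rate is
   - 2 A Re \sum_k conj(v_k) \sum_(j <= k) w_(k-j) j v_j with v_k = k^2 w_k.
   Writing j as the number of m < j turns it into a sum over m of Toeplitz forms
   of A w at the truncations v 1_(k > m), without commutators.  At time 0 the form
   is the mean of A h_1 |V|^2 for the trigonometric polynomial V = \sum_k v_k e^(ikx),
   so that it is at least lambda |v|^2 and the rate contains
   - 2 lambda \sum_k k^5 |w_k|^2, which also gives the L^2(H^(5/2)) bound.  For
   small times the form stays above lambda |v|^2 / 2, because \sum_k |w_k(t) - w_k(0)|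
   is small: the energy controls the high modes and the low ones are continuous. *)

From HB Require Import structures.
Require Import Defs.
From mathcomp Require Import all_boot all_order all_algebra.
From mathcomp Require Import all_classical all_reals all_analysis.
From mathcomp Require Import measurable_realfun complex ring lra zify.
Set Implicit Arguments.
Unset Strict Implicit.
Unset Printing Implicit Defensive.
Import Order.TTheory GRing.Theory Num.Theory numFieldNormedType.Exports.
Local Open Scope classical_set_scope.
Local Open Scope ring_scope.

(** * Complex numbers and convolution *)

Section ComplexPlane.
Context {R : realType}.
Implicit Types (z y b : R[i]).

(** Since mode k never sees a mode above it, the modes below n form a closed system: the estimates
    on partial sums concern the actual modes, and no limit of approximate solutions is taken. A
    bound on the energy alone would leave strong continuity in time open. It comes from the absolute
    values of the energy rates of single modes: their sum is at most a multiple of the damping plus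
    a constant, hence integrable in time. So the modal energies have a summable majorant that does
    not depend on time, and dominated convergence yields the continuity and the time derivatives.
    Uniqueness needs no estimate uniform in k. The Fourier coefficients of any solution in the class
    satisfy the same triangular system, so two solutions are compared mode by mode, by induction on
    k, through a homogeneous linear equation with zero data. The coefficients at k > 0 are taken
    twice as large as the Fourier coefficients. A real function is then the real part of its power
    series in e^(ix), and the triangular form below becomes the full Hermitian Toeplitz form of its
    symbol. *)

Definition csq z : R := complex.Re z ^+ 2 + complex.Im z ^+ 2.
(** The real inner product Re (conj z * y) of the plane; derivatives of squared moduli are expressed
    through it. *)
Definition cdot z y : R :=
  complex.Re z * complex.Re y + complex.Im z * complex.Im y.
(** A real-valued modulus: the norm of [R[i]] takes its values in [R[i]]. *)
Definition cabs z : R := Num.sqrt (csq z).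

Lemma csq_ge0 z : 0 <= csq z.
Proof. by rewrite /csq addr_ge0 ?sqr_ge0. Qed.

Lemma cabs_ge0 z : 0 <= cabs z.
Proof. exact: sqrtr_ge0. Qed.

Lemma cabs_sq z : cabs z ^+ 2 = csq z.
Proof. by rewrite /cabs sqr_sqrtr ?csq_ge0. Qed.

Lemma csqM z y : csq (z * y) = csq z * csq y.
Proof. by case: z => a b; case: y => c d; rewrite /csq /=; ring. Qed.

Lemma cabsM z y : cabs (z * y) = cabs z * cabs y.
Proof. by rewrite /cabs csqM sqrtrM ?csq_ge0. Qed.

Lemma cReD z y : complex.Re (z + y) = complex.Re z + complex.Re y.
Proof. by case: z => a b; case: y. Qed.
Lemma cImD z y : complex.Im (z + y) = complex.Im z + complex.Im y.
Proof. by case: z => a b; case: y. Qed.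
Lemma cReN z : complex.Re (- z) = - complex.Re z.
Proof. by case: z. Qed.
Lemma cImN z : complex.Im (- z) = - complex.Im z.
Proof. by case: z. Qed.
Lemma cReM z y : complex.Re (z * y) =
  complex.Re z * complex.Re y - complex.Im z * complex.Im y.
Proof. by case: z => a b; case: y. Qed.
Lemma cImM z y : complex.Im (z * y) =
  complex.Re z * complex.Im y + complex.Im z * complex.Re y.
Proof. by case: z => a b; case: y. Qed.
Lemma cRe_nat n : complex.Re (n%:R : R[i]) = n%:R.
Proof. by elim: n => // n IH; rewrite -[n.+1]addn1 !natrD cReD IH. Qed.
Lemma cIm_nat n : complex.Im (n%:R : R[i]) = 0.
Proof. by elim: n => // n IH; rewrite -[n.+1]addn1 !natrD cImD IH /= addr0. Qed.
Lemma cRe_sum I (r : seq I) (P : pred I) (F : I -> R[i]) :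
  complex.Re (\sum_(i <- r | P i) F i) = \sum_(i <- r | P i) complex.Re (F i).
Proof. exact: (big_morph (@complex.Re R) cReD (erefl _)). Qed.
Lemma cIm_sum I (r : seq I) (P : pred I) (F : I -> R[i]) :
  complex.Im (\sum_(i <- r | P i) F i) = \sum_(i <- r | P i) complex.Im (F i).
Proof. exact: (big_morph (@complex.Im R) cImD (erefl _)). Qed.

Lemma complex_ext z y :
  complex.Re z = complex.Re y -> complex.Im z = complex.Im y -> z = y.
Proof. by case: z => a b; case: y => c d /= -> ->. Qed.

Lemma cReZ (a : R) z : complex.Re (a%:C%C * z) = a * complex.Re z.
Proof. by rewrite cReM /= mul0r subr0. Qed.
Lemma cImZ (a : R) z : complex.Im (a%:C%C * z) = a * complex.Im z.
Proof. by rewrite cImM /= mul0r addr0. Qed.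

Lemma csqZ (a : R) z : csq (a%:C%C * z) = a ^+ 2 * csq z.
Proof. by rewrite /csq cReZ cImZ; ring. Qed.
Lemma cabsZ (a : R) z : cabs (a%:C%C * z) = `|a| * cabs z.
Proof. by rewrite /cabs csqZ sqrtrM ?sqr_ge0// sqrtr_sqr. Qed.

Lemma csq0 : csq 0 = 0.
Proof. by rewrite /csq /= expr0n addr0. Qed.
Lemma cabs0 : cabs 0 = 0.
Proof. by rewrite /cabs csq0 sqrtr0. Qed.

Lemma cdotDr z y b : cdot z (y + b) = cdot z y + cdot z b.
Proof. by rewrite /cdot cReD cImD; ring. Qed.
Lemma cdotZr z (a : R) y : cdot z (a%:C%C * y) = a * cdot z y.
Proof. by rewrite /cdot cReZ cImZ; ring. Qed.
Lemma cdotZl z (a : R) y : cdot (a%:C%C * z) y = a * cdot z y.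
Proof. by rewrite /cdot cReZ cImZ; ring. Qed.
Lemma cdot0r z : cdot z 0 = 0.
Proof. by rewrite /cdot /= !mulr0 addr0. Qed.
Lemma cdotzz z : cdot z z = csq z.
Proof. by rewrite /cdot /csq !expr2. Qed.
Lemma cdotC z y : cdot z y = cdot y z.
Proof. by rewrite /cdot mulrC [X in _ + X]mulrC. Qed.

Lemma cdot_sumr z I (r : seq I) (P : pred I) (F : I -> R[i]) :
  cdot z (\sum_(i <- r | P i) F i) = \sum_(i <- r | P i) cdot z (F i).
Proof.
exact: (big_morph (cdot z) (cdotDr z) (cdot0r z)).
Qed.

Lemma ler_cdot z y : `|cdot z y| <= (csq z + csq y) / 2.
Proof.
have h1 : 0 <= csq (z + y) by exact: csq_ge0.
have h2 : 0 <= csq (z - y) by exact: csq_ge0.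
rewrite ler_norml; case: z y h1 h2 => [a b] [c d]; rewrite /csq /cdot /=.
by move=> h1 h2; apply/andP; split; [lra|lra].
Qed.

Lemma ler_cdot_cabs z y : `|cdot z y| <= cabs z * cabs y.
Proof.
rewrite /cabs -sqrtrM ?csq_ge0// -sqrtr_sqr ler_wsqrtr//.
case: z => a b; case: y => c d; rewrite /csq /cdot /=.
rewrite -subr_ge0; set X := (X in 0 <= X).
(* Lagrange's identity. *)
have -> : X = (a * d - b * c) ^+ 2 by rewrite /X; ring.
exact: sqr_ge0.
Qed.

Lemma ler_cdotM z b y : `|cdot z (b * y)| <= cabs b * ((csq z + csq y) / 2).
Proof.
apply: (le_trans (ler_cdot_cabs _ _)); rewrite cabsM.
rewrite mulrCA ler_wpM2l ?cabs_ge0//.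
rewrite -!cabs_sq; have := sqr_ge0 (cabs z - cabs y).
by rewrite sqrrB; nra.
Qed.

Lemma cabs_ReIm z : cabs z <= `|complex.Re z| + `|complex.Im z|.
Proof.
rewrite /cabs -[leRHS]ger0_norm ?addr_ge0// -sqrtr_sqr ler_wsqrtr//.
rewrite /csq -[in leLHS](real_normK (num_real (complex.Re z))).
rewrite -[in leLHS](real_normK (num_real (complex.Im z))).
have : 0 <= `|complex.Re z| * `|complex.Im z| by rewrite mulr_ge0.
by rewrite sqrrD; lra.
Qed.

End ComplexPlane.

Section Convolution.
Context {S : comPzRingType}.
Implicit Types (a b v w : nat -> S).

(** Coefficient k of the product of two power series. The ring is left general because complex modes
    and their real majorants are both convolved. *)
Definition cprod a b k : S := \sum_(j < k.+1) a (k - j)%N * b j.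

Lemma cprodC a b k : cprod a b k = cprod b a k.
Proof.
rewrite /cprod (reindex_inj rev_ord_inj) /=; apply: eq_bigr => j _.
by rewrite subSS mulrC subKn// -ltnS.
Qed.

(* Multiplication by the frequency is a derivation D of the convolution product,
   so that D^3 (w w) / 2 = D^2 (w Dw) = w D^3 w + 3 Dw D^2 w. *)
Lemma cprod_cube w k : k%:R ^+ 3 * cprod w w k =
  2%:R * (cprod w (fun j => j%:R ^+ 3 * w j) k +
     3%:R * cprod (fun j => j%:R * w j) (fun j => j%:R ^+ 2 * w j) k).
Proof.
have sym (F : nat -> nat -> S) :
    \sum_(j < k.+1) F (k - j)%N j = \sum_(j < k.+1) F j (k - j)%N.
  rewrite (reindex_inj rev_ord_inj) /=; apply: eq_bigr => j _.
  by rewrite subSS subKn// -ltnS.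
rewrite /cprod mulr_sumr.
(* The cube of k = (k - j) + j is split into two halves that the reflection j -> k - j exchanges. *)
transitivity (\sum_(j < k.+1) (j%:R ^+ 3 + 3%:R * ((k - j)%N%:R * j%:R ^+ 2)) *
                                (w (k - j)%N * w j)
            + \sum_(j < k.+1) ((k - j)%N%:R ^+ 3 + 3%:R * (j%:R * (k - j)%N%:R ^+ 2)) *
                                (w j * w (k - j)%N)).
  rewrite -big_split; apply: eq_bigr => j _ /=.
  have -> : (k%:R : S) = (k - j)%N%:R + j%:R by rewrite -natrD subnK// -ltnS.
  by ring.
rewrite -(sym (fun i j => (j%:R ^+ 3 + 3%:R * (i%:R * j%:R ^+ 2)) * (w i * w j))).
rewrite -[LHS]mulr2n -[LHS]mulr_natl; congr (_ * _).
rewrite mulr_sumr -big_split; apply: eq_bigr => j _ /=.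
by ring.
Qed.

End Convolution.

Section TriangularSums.
Context {R : realType}.
Implicit Types (b X : nat -> R) (n : nat).

(** The triangle j <= k < n is summed by columns, with k = j + m. *)
Lemma tri_sum (V : nmodType) (F : nat -> nat -> V) n :
  \sum_(k < n) \sum_(j < k.+1) F k j =
  \sum_(j < n) \sum_(m < n - j) F (j + m)%N j.
Proof.
elim: n => [|n IH]; first by rewrite !big_ord0.
rewrite big_ord_recr /= IH.
have -> : \sum_(j < n.+1) \sum_(m < n.+1 - j) F (j + m)%N j =
   \sum_(j < n.+1) (\sum_(m < n - j) F (j + m)%N j + F n j).
  apply: eq_bigr => j _; have jn : (j <= n)%N by rewrite -ltnS.
  by rewrite subSn// big_ord_recr /= subnKC.
rewrite big_split /= [in RHS]big_ord_recr /= subnn big_ord0.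
by rewrite addr0.
Qed.

Lemma ler_sum_ord_prefix (m n : nat) b : (forall k, 0 <= b k) -> (m <= n)%N ->
  \sum_(k < m) b k <= \sum_(k < n) b k.
Proof.
move=> b0 mn; rewrite -!(big_mkord xpredT) (@big_cat_nat _ _ _ m 0 n)//=.
by rewrite lerDl; apply: sumr_ge0.
Qed.

(** Schur's test: the row sums and the column sums of the kernel b (k - j) on the triangle are both
    at most the sum of b. *)
Lemma young_tri n b X : (forall k, 0 <= b k) -> (forall k, 0 <= X k) ->
  \sum_(k < n) \sum_(j < k.+1) b (k - j)%N * ((X k + X j) / 2) <=
  (\sum_(k < n) b k) * \sum_(k < n) X k.
Proof.
move=> b0 X0.
have h1 : \sum_(k < n) \sum_(j < k.+1) b (k - j)%N * X k <=
    (\sum_(k < n) b k) * \sum_(k < n) X k.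
  rewrite mulr_sumr; apply: ler_sum => k _; rewrite -mulr_suml.
  rewrite ler_wpM2r// (reindex_inj rev_ord_inj) /=.
  under eq_bigr => j _ do rewrite subSS subKn -1?ltnS//.
  by apply: ler_sum_ord_prefix.
have h2 : \sum_(k < n) \sum_(j < k.+1) b (k - j)%N * X j <=
    (\sum_(k < n) b k) * \sum_(k < n) X k.
  rewrite (tri_sum (fun k j => b (k - j)%N * X j)) mulr_sumr.
  apply: ler_sum => j _; rewrite -mulr_suml.
  rewrite ler_wpM2r//.
  under eq_bigr => m _ do rewrite addKn.
  by apply: ler_sum_ord_prefix => //; rewrite leq_subr.
rewrite [leLHS](_ : _ =
  (\sum_(k < n) \sum_(j < k.+1) b (k - j)%N * X k +
   \sum_(k < n) \sum_(j < k.+1) b (k - j)%N * X j) / 2); first by lra.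
rewrite -big_split mulr_suml; apply: eq_bigr => k _ /=.
rewrite -big_split mulr_suml; apply: eq_bigr => j _ /=.
by rewrite mulrA mulrDr.
Qed.

Lemma sum_invsq n : \sum_(k < n) (k%:R ^- 2 : R) <= 2.
Proof.
(* Telescoping; the term k = 0 is zero because the inverse of 0 is 0. *)
suff h m : \sum_(k < m.+2) (k%:R ^- 2 : R) <= 2 - m.+1%:R^-1.
  case: n => [|[|n]]; first by rewrite big_ord0.
    by rewrite big_ord1 expr0n invr0.
  by apply: (le_trans (h n)); rewrite gerBl invr_ge0.
elim: m => [|m IH].
  by rewrite !big_ord_recr big_ord0 /= expr0n invr0 !expr1n invr1 !add0r; lra.
rewrite big_ord_recr /=; apply: (le_trans (lerD IH (lexx _))).
have m0 : (0 : R) < m.+1%:R by rewrite ltr0n.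
have -> : (m.+2%:R : R) = m.+1%:R + 1 by rewrite -natr1.
set x := (m.+1%:R : R) in m0 *.
rewrite -subr_ge0.
have -> : 2 - (x + 1)^-1 - (2 - x^-1 + (x + 1) ^- 2) = x^-1 * (x + 1) ^- 2.
  by field; apply/andP; split; lra.
by rewrite mulr_ge0// ?invr_ge0 ?exprn_ge0//; lra.
Qed.

End TriangularSums.

(** * Energy estimates for truncated mode systems *)

Section EnergyEstimates.
Context {R : realType}.
Implicit Types (a b v w eta : nat -> R[i]) (n : nat).

Lemma natC n : (n%:R : R[i]) = (n%:R : R)%:C%C.
Proof. by apply: complex_ext; rewrite ?cRe_nat ?cIm_nat. Qed.

Lemma natXC n m : (n%:R ^+ m : R[i]) = (n%:R ^+ m : R)%:C%C.
Proof. by rewrite -natrX natC natrX. Qed.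

(** Real part of the quadratic form of the lower triangular Toeplitz matrix with entries a (k - j).
    When a consists of the coefficients of a real function u, it is the mean of u |V|^2, as
    [toeplitz_integral] shows. *)
Definition toeplitz a v n : R := \sum_(k < n) cdot (v k) (cprod a v k).

Definition high m v k : R[i] := if (m < k)%N then v k else 0.

Lemma sum_ltn_count j n (x : R) : (j < n)%N ->
  \sum_(m < n) (if (m < j)%N then x else 0) = j%:R * x.
Proof.
move=> jn; rewrite -big_mkcond /= -(big_ord_widen n (fun=> x) (ltnW jn)).
by rewrite sumr_const card_ord mulr_natl.
Qed.

(* j = #{m | m < j} splits D into truncations, each of which enters the Toeplitz
   form without a commutator. *)
Lemma toeplitz_half_derivative a v n :
  \sum_(k < n) cdot (v k) (cprod a (fun j => j%:R * v j) k) =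
  \sum_(m < n) toeplitz a (high m v) n.
Proof.
rewrite /toeplitz exchange_big /=; apply: eq_bigr => k _.
transitivity (\sum_(m < n) \sum_(j < k.+1)
    (if (m < j)%N then cdot (v k) (a (k - j)%N * v j) else 0)); last first.
  apply: eq_bigr => m _; rewrite /cprod cdot_sumr; apply: eq_bigr => j _.
  rewrite /high; case: ifPn => mj; last by rewrite mulr0 cdot0r.
  by rewrite (leq_trans mj)// -ltnS.
rewrite exchange_big /cprod cdot_sumr; apply: eq_bigr => j _ /=.
rewrite sum_ltn_count; last by rewrite (leq_ltn_trans _ (ltn_ord k))// -ltnS.
by rewrite natC mulrCA cdotZr.
Qed.

(** The hypothesis is applied to every truncation [high m v]. Mode k survives in exactly the k
    truncations with m < k, so the weight k appears and the constant is not lost. *)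
Lemma garding a v n (mu : R) :
  (forall v, mu * \sum_(k < n) csq (v k) <= toeplitz a v n) ->
  mu * \sum_(k < n) k%:R * csq (v k) <=
  \sum_(k < n) cdot (v k) (cprod a (fun j => j%:R * v j) k).
Proof.
move=> H; rewrite toeplitz_half_derivative.
apply: (@le_trans _ _ (\sum_(m < n) mu * \sum_(k < n) csq (high m v k))); last first.
  by apply: ler_sum => m _; exact: H.
rewrite -mulr_sumr exchange_big /=.
rewrite le_eqVlt; apply/orP; left; apply/eqP; congr (_ * _).
apply: eq_bigr => k _; rewrite -(@sum_ltn_count _ n)//; apply: eq_bigr => m _.
by rewrite /high; case: ifP => // _; rewrite csq0.
Qed.

Lemma cprod_form_le n a v (f : nat -> R) : (forall k, 0 <= f k) ->
  (forall k, cabs (a k) <= f k) ->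
  \sum_(k < n) `|cdot (v k) (cprod a v k)| <=
  (\sum_(k < n) f k) * \sum_(k < n) csq (v k).
Proof.
move=> f0 af.
apply: (le_trans _ (young_tri n f0 (fun k => csq_ge0 (v k)))).
apply: ler_sum => k _; rewrite /cprod cdot_sumr.
apply: (le_trans (ler_norm_sum _ _ _)); apply: ler_sum => j _.
apply: (le_trans (ler_cdotM _ _ _)).
by rewrite ler_wpM2r// divr_ge0// addr_ge0// csq_ge0.
Qed.

(** On the triangle j <= k the factor j may be raised to k in front of |v_k|^2, so that effectively
    half a derivative falls on each factor. *)
Lemma cprod_Dform_le n a v :
  \sum_(k < n) `|cdot (v k) (cprod a (fun j => j%:R * v j) k)| <=
  (\sum_(k < n) cabs (a k)) * \sum_(k < n) k%:R * csq (v k).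
Proof.
have X0 k : 0 <= k%:R * csq (v k) by rewrite mulr_ge0// csq_ge0.
apply: (le_trans _ (young_tri n (fun k => cabs_ge0 (a k)) X0)).
apply: ler_sum => k _; rewrite /cprod cdot_sumr.
apply: (le_trans (ler_norm_sum _ _ _)); apply: ler_sum => j _.
rewrite natC mulrCA cdotZr normrM ger0_norm//.
apply: (le_trans (ler_wpM2l _ (ler_cdotM _ _ _))) => //.
rewrite mulrCA ler_wpM2l ?cabs_ge0// mulrA ler_wpM2r// mulrDr lerD2r.
by rewrite ler_wpM2r ?csq_ge0// ler_nat -ltnS.
Qed.

(** The form is linear in its symbol, and the form of b - a is bounded by the l^1 norm of b - a. *)
Lemma toeplitz_perturb n a b v (mu e : R) :
  mu * \sum_(k < n) csq (v k) <= toeplitz a v n ->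
  \sum_(k < n) cabs (b k - a k) <= e ->
  (mu - e) * \sum_(k < n) csq (v k) <= toeplitz b v n.
Proof.
move=> H He.
have -> : toeplitz b v n = toeplitz a v n + toeplitz (fun k => b k - a k) v n.
  rewrite /toeplitz -big_split; apply: eq_bigr => k _ /=.
  rewrite -cdotDr; congr cdot; rewrite /cprod -big_split; apply: eq_bigr => j _ /=.
  by ring.
have S0 : 0 <= \sum_(k < n) csq (v k) by apply: sumr_ge0 => k _; exact: csq_ge0.
have := @cprod_form_le n (fun k => b k - a k) v _ (fun k => cabs_ge0 _) (fun k => lexx _).
move=> /(le_trans (ler_norm_sum _ _ _)); rewrite ler_norml => /andP[+ _].
rewrite -/(toeplitz _ _ _) => h.
have := ler_wpM2r S0 He; lra.
Qed.

Context (A g s : R) (s0 : 0 <= s).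

Definition dispersion k : R := A * g * k%:R - s * k%:R ^+ 3.
Definition mode_rhs w eta k : R[i] :=
  (- (A / 2 * k%:R))%:C%C * cprod w w k + (dispersion k)%:C%C * eta k.
(** The weight of eta is tuned to the dispersion: k^4 (A g k - s k^3) + s k^7 + k^5 = (A g + 1) k^5.
    The top-order terms cancel and a cross term of order k^5 is left, whatever the sign of A g. The
    summand k^5 controls that cross term also when s = 0. *)
Definition energy w eta k : R :=
  k%:R ^+ 4 * csq (w k) + (s * k%:R ^+ 7 + k%:R ^+ 5) * csq (eta k).
Definition energy_rate w eta k : R :=
  2 * (k%:R ^+ 4 * cdot (w k) (mode_rhs w eta k) +
       (s * k%:R ^+ 7 + k%:R ^+ 5) * cdot (eta k) (w k)).

Lemma energy_ge w eta k : 0 <= k%:R ^+ 4 * csq (w k) <= energy w eta k.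
Proof.
rewrite mulr_ge0 ?csq_ge0 ?exprn_ge0//= lerDl mulr_ge0 ?csq_ge0//.
by rewrite addr_ge0 ?mulr_ge0 ?exprn_ge0.
Qed.

Lemma energy_ge0 w eta k : 0 <= energy w eta k.
Proof. by have /andP[/le_trans] := energy_ge w eta k; apply. Qed.

Lemma energy_ge_eta w eta k :
  (s * k%:R ^+ 7 + k%:R ^+ 5) * csq (eta k) <= energy w eta k.
Proof. by rewrite lerDr mulr_ge0 ?csq_ge0 ?exprn_ge0. Qed.

Let D2 w j : R[i] := j%:R ^+ 2 * w j.

Lemma csq_D2 w k : csq (D2 w k) = k%:R ^+ 4 * csq (w k).
Proof. by rewrite /D2 natXC csqZ -exprM. Qed.

(** Of the five derivatives on w w, two go to the test factor and three are distributed by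
    [cprod_cube]. The first term is the leading one; in the second no factor carries more than two
    derivatives; the third is what the cancellation in the weights leaves. *)
Lemma energy_rateE w eta k : energy_rate w eta k =
  - (2 * A * cdot (D2 w k) (cprod w (fun j => j%:R * D2 w j) k))
  - 6 * A * cdot (D2 w k) (cprod (fun j => j%:R * w j) (D2 w) k)
  + 2 * (A * g + 1) * (k%:R ^+ 5 * cdot (w k) (eta k)).
Proof.
have E : k%:R ^+ 5 * cdot (w k) (cprod w w k) =
   2 * (cdot (D2 w k) (cprod w (fun j => j%:R * D2 w j) k) +
        3 * cdot (D2 w k) (cprod (fun j => j%:R * w j) (D2 w) k)).
  have -> : k%:R ^+ 5 * cdot (w k) (cprod w w k) =
      cdot (D2 w k) (k%:R ^+ 3 * cprod w w k).
    by rewrite /D2 !natXC cdotZl cdotZr; ring.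
  rewrite cprod_cube !natC cdotZr cdotDr cdotZr; congr (_ * (cdot _ _ + _)).
  by apply: eq_bigr => j _; congr (_ * _); rewrite /D2 mulrA -exprS.
rewrite /energy_rate /mode_rhs cdotDr !cdotZr (cdotC (eta k)) /dispersion.
transitivity (- A * (k%:R ^+ 5 * cdot (w k) (cprod w w k)) +
   2 * (A * g + 1) * (k%:R ^+ 5 * cdot (w k) (eta k))); first by field.
by rewrite E; ring.
Qed.

(** Young's inequality, weighted so that only half of the damping lam k^5 |w_k|^2 is spent on the
    cross term. *)
Lemma cross_le (k : nat) (x y : R[i]) (c lam : R) : 0 < lam ->
  `|2 * c * (k%:R ^+ 5 * cdot x y)| <=
  lam / 2 * (k%:R ^+ 5 * csq x) + 2 * c ^+ 2 / lam * (k%:R ^+ 5 * csq y).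
Proof.
move=> l0; rewrite normrM [X in _ * X]normrM (ger0_norm (exprn_ge0 _ _))//.
have K0 : (0 : R) <= k%:R ^+ 5 by rewrite exprn_ge0.
rewrite [leRHS](_ : _ = k%:R ^+ 5 * (lam / 2 * csq x + 2 * c ^+ 2 / lam * csq y));
  last by field; lra.
rewrite [leLHS]mulrCA ler_wpM2l//.
have -> : `|2 * c| * `|cdot x y| = `|cdot (lam%:C%C * x) ((2 * c / lam)%:C%C * y)|.
  by rewrite cdotZl cdotZr -normrM; congr `|_|; field; lra.
have -> : lam / 2 * csq x + 2 * c ^+ 2 / lam * csq y =
   lam ^-1 * ((csq (lam%:C%C * x) + csq ((2 * c)%:C%C * y)) / 2).
  by rewrite !csqZ; field; lra.
rewrite -(ler_pM2l l0) mulrA divff ?mul1r; last lra.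
apply: (le_trans _ (ler_cdot _ _)).
by rewrite !cdotZl !cdotZr -{1}(gtr0_norm l0) -normrM le_eqVlt; apply/orP; left;
  apply/eqP; congr `|_|; field; lra.
Qed.

(** Write k |w_k| as the product of k^-1 and k^2 |w_k|; the inverse squares sum to at most 2. *)
Lemma sum_k_cabs w n (B : R) :
  \sum_(k < n) k%:R ^+ 4 * csq (w k) <= B ->
  \sum_(k < n) k%:R * cabs (w k) <= 1 + B / 2.
Proof.
move=> HB; have H k : k%:R * cabs (w k) <= (k%:R ^- 2 + k%:R ^+ 4 * csq (w k)) / 2.
  case: k => [|k].
    by rewrite mul0r divr_ge0// addr_ge0 ?invr_ge0 ?exprn_ge0// mulr_ge0 ?csq_ge0// exprn_ge0.
  have k0 : (0 : R) < k.+1%:R by rewrite ltr0n.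
  rewrite -cabs_sq; set x := cabs _; set K := (k.+1%:R : R) in k0 *.
  have := sqr_ge0 (K^-1 - K ^+ 2 * x).
  have -> : (K^-1 - K ^+ 2 * x) ^+ 2 = K ^- 2 + K ^+ 4 * x ^+ 2 - 2 * (K * x).
    by field; lra.
  by set P := K ^- 2; set Q := K ^+ 4 * _; lra.
apply: le_trans; first by apply: ler_sum => k _; exact: H.
by rewrite -mulr_suml big_split /=; have := @sum_invsq R n; lra.
Qed.

Section Bounds.
Context (lam B : R) (w eta : nat -> R[i]) (n : nat) (lam0 : 0 < lam).
Context (EB : \sum_(k < n) energy w eta k <= B).

(** The damping: up to normalisation the square of the H^(5/2) seminorm of the velocity. [lower]
    collects what the energy controls. *)
Let G := \sum_(k < n) k%:R ^+ 5 * csq (w k).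
Let lower := 6 * `|A| * (1 + B / 2) * B + 2 * (A * g + 1) ^+ 2 / lam * B.

Let wB : \sum_(k < n) k%:R ^+ 4 * csq (w k) <= B.
Proof.
apply: (le_trans _ EB); apply: ler_sum => k _.
by have /andP[] := energy_ge w eta k.
Qed.

Let etaB : \sum_(k < n) k%:R ^+ 5 * csq (eta k) <= B.
Proof.
apply: (le_trans _ EB); apply: ler_sum => k _.
apply: (le_trans _ (energy_ge_eta w eta k)).
by rewrite ler_wpM2r ?csq_ge0// lerDr mulr_ge0 ?exprn_ge0.
Qed.

Let second_le : \sum_(k < n) `|6 * A *
   cdot (D2 w k) (cprod (fun j => j%:R * w j) (D2 w) k)| <=
   6 * `|A| * (1 + B / 2) * B.
Proof.
under eq_bigr => k _ do rewrite normrM.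
rewrite -mulr_sumr normrM (ger0_norm (_ : 0 <= 6))// -!mulrA.
rewrite !ler_wpM2l//.
have f0 k : 0 <= k%:R * cabs (w k) by rewrite mulr_ge0 ?cabs_ge0.
have h k : cabs (k%:R * w k) <= k%:R * cabs (w k).
  by rewrite natC cabsZ ger0_norm.
apply: (le_trans (cprod_form_le n (D2 w) f0 h)).
have DB : \sum_(k < n) csq (D2 w k) <= B.
  by under eq_bigr => k _ do rewrite csq_D2.
apply: ler_pM => //; last exact: sum_k_cabs.
- by apply: sumr_ge0 => k _; exact: f0.
- by apply: sumr_ge0 => k _; exact: csq_ge0.
Qed.

Let third_le : \sum_(k < n) `|2 * (A * g + 1) * (k%:R ^+ 5 * cdot (w k) (eta k))|
  <= lam / 2 * G + 2 * (A * g + 1) ^+ 2 / lam * B.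
Proof.
apply: le_trans; first by apply: ler_sum => k _; exact: (cross_le _ _ _ _ lam0).
rewrite big_split /= -!mulr_sumr lerD2l ler_wpM2l//.
by apply: divr_ge0; [apply: mulr_ge0 => //; exact: sqr_ge0|exact: ltW].
Qed.

(** Positivity with constant lam / 2 makes the leading term at most - lam G, and the cross term
    gives back lam / 2 of it. *)
Lemma energy_rate_sum_le :
  (forall v, lam / 2 * \sum_(k < n) csq (v k) <=
             toeplitz (fun k => A%:C%C * w k) v n) ->
  \sum_(k < n) energy_rate w eta k <= - (lam / 2) * G + lower.
Proof.
move=> /(@garding _ (D2 w)) H.
have {}H : lam / 2 * G <=
    A * \sum_(k < n) cdot (D2 w k) (cprod w (fun j => j%:R * D2 w j) k).
  rewrite [leRHS]mulr_sumr; apply: (le_trans _ (le_trans H _)).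
    rewrite le_eqVlt; apply/orP; left; apply/eqP; congr (_ * _).
    by apply: eq_bigr => k _; rewrite csq_D2 mulrA -exprS.
  rewrite le_eqVlt; apply/orP; left; apply/eqP; apply: eq_bigr => k _.
  rewrite -cdotZr /cprod mulr_sumr; congr cdot; apply: eq_bigr => j _.
  by rewrite -mulrA.
under eq_bigr => k _ do rewrite energy_rateE.
rewrite !big_split /= !sumrN -mulr_sumr -!mulrA -/(D2 w).
have := le_trans (ler_norm_sum _ _ _) second_le.
have := le_trans (ler_norm_sum _ _ _) third_le.
rewrite !ler_norml => /andP[_ h3] /andP[h2 _].
move: h2 h3 H; rewrite /lower -!mulr_sumr; lra.
Qed.

(** Absolute values mode by mode destroy the sign of the leading term, which now costs a multiple of
    G. This is affordable because G is integrable in time by the signed estimate, and it bounds the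
    total variation of all modal energies. *)
Lemma energy_rate_abs_le :
  \sum_(k < n) `|energy_rate w eta k| <=
  (2 * `|A| * (cabs (w 0%N) + 1 + B / 2) + lam / 2) * G + lower.
Proof.
have first_le : \sum_(k < n) `|2 * A *
     cdot (D2 w k) (cprod w (fun j => j%:R * D2 w j) k)| <=
     2 * `|A| * (cabs (w 0%N) + 1 + B / 2) * G.
  under eq_bigr => k _ do rewrite normrM.
  rewrite -mulr_sumr normrM (ger0_norm (_ : 0 <= 2))// -!mulrA.
  rewrite !ler_wpM2l//; apply: (le_trans (cprod_Dform_le _ _ _)).
  under [X in _ * X]eq_bigr => k _ do rewrite csq_D2 mulrA -exprS.
  rewrite ler_wpM2r ?sumr_ge0// => [k _|]; first by rewrite mulr_ge0 ?csq_ge0 ?exprn_ge0.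
  (* The mean is set apart, since |w_k| <= k |w_k| holds from k = 1 on. *)
  have wB' := sum_k_cabs wB; case: n wB' => [|m] wB'.
    rewrite big_ord0; move: wB'; rewrite big_ord0 => wB'.
    by rewrite -addrA addr_ge0 ?cabs_ge0.
  rewrite big_ord_recl /= -addrA lerD2l; apply: (le_trans _ wB').
  rewrite [leRHS]big_ord_recl mul0r add0r; apply: ler_sum => k _.
  by rewrite ler_peMl ?cabs_ge0// ler1n.
under eq_bigr => k _ do rewrite energy_rateE.
apply: (@le_trans _ _ (\sum_(k < n) (
   `|2 * A * cdot (D2 w k) (cprod w (fun j => j%:R * D2 w j) k)| +
   `|6 * A * cdot (D2 w k) (cprod (fun j => j%:R * w j) (D2 w) k)| +
   `|2 * (A * g + 1) * (k%:R ^+ 5 * cdot (w k) (eta k))|))).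
  apply: ler_sum => k _; apply: (le_trans (ler_normD _ _)).
  rewrite lerD2r; apply: (le_trans (ler_normB _ _)).
  by rewrite normrN.
rewrite !big_split /=; move: first_le second_le third_le; rewrite /lower; lra.
Qed.

End Bounds.

End EnergyEstimates.

(** * Linear differential equations *)

Section RealDerivatives.
Context {R : realType}.
Implicit Types (f g F : R -> R) (t : R).

Definition has_deriv f t (a : R) : Prop := is_derive t 1 f a.

Lemma deriv_eq f t (a b : R) : has_deriv f t a -> a = b -> has_deriv f t b.
Proof. by move=> h <-. Qed.

Lemma deriv_id t : has_deriv id t 1.
Proof. exact: is_derive_id. Qed.
Lemma deriv_cos t : has_deriv cos t (- sin t).
Proof. exact: is_derive_cos. Qed.
Lemma deriv_sin t : has_deriv sin t (cos t).
Proof. exact: is_derive_sin. Qed.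
Lemma deriv_expR t : has_deriv expR t (expR t).
Proof. exact: is_derive_expR. Qed.
Lemma deriv_comp f g t (a b : R) : has_deriv f (g t) a -> has_deriv g t b ->
  has_deriv (f \o g) t (a * b).
Proof. exact: is_derive1_comp. Qed.
Lemma deriv_opp f t (a : R) : has_deriv f t a -> has_deriv (fun x => - f x) t (- a).
Proof. exact: is_deriveN. Qed.

Lemma deriv_near f g t (a : R) :
  (\near t, f t = g t) -> has_deriv f t a -> has_deriv g t a.
Proof. exact: near_eq_is_derive. Qed.

Lemma deriv_add f g t a b : has_deriv f t a -> has_deriv g t b ->
  has_deriv (fun x => f x + g x) t (a + b).
Proof. by move=> *; exact: is_deriveD. Qed.

Lemma deriv_sub f g t a b : has_deriv f t a -> has_deriv g t b ->
  has_deriv (fun x => f x - g x) t (a - b).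
Proof. by move=> *; exact: is_deriveB. Qed.

Lemma deriv_mul f g t a b : has_deriv f t a -> has_deriv g t b ->
  has_deriv (fun x => f x * g x) t (f t * b + g t * a).
Proof. by move=> *; exact: is_deriveM. Qed.

Lemma deriv_cst (a : R) t : has_deriv (fun=> a : R) t 0.
Proof. exact: is_derive_cst. Qed.

Lemma deriv_scale (k : R) f t a : has_deriv f t a ->
  has_deriv (fun x => k * f x) t (k * a).
Proof.
move=> h; apply: deriv_eq; first exact: (deriv_mul (deriv_cst k t) h).
by rewrite mulr0 addr0.
Qed.

Lemma deriv_sum n (F : nat -> R -> R) (dF : nat -> R) t :
  (forall k, (k < n)%N -> has_deriv (F k) t (dF k)) ->
  has_deriv (fun x => \sum_(k < n) F k x) t (\sum_(k < n) dF k).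
Proof.
elim: n => [|n IH] H.
  under eq_fun do rewrite big_ord0; rewrite big_ord0; exact: deriv_cst.
under eq_fun do rewrite big_ord_recr; rewrite big_ord_recr /=.
by apply: deriv_add; [apply: IH => k kn; apply: H; rewrite ltnW|apply: H].
Qed.

Lemma deriv_continuous f t a : has_deriv f t a -> {for t, continuous f}.
Proof.
rewrite /has_deriv => h; apply: differentiable_continuous.
by apply/derivable1_diffP; exact: ex_derive.
Qed.

(** By the mean value theorem for g - f. Differential inequalities are integrated in this form,
    without integrals. *)
Lemma deriv_mono f g (f' g' : R -> R) (a b : R) :
  a <= b ->
  (forall t, a <= t <= b -> has_deriv f t (f' t)) ->
  (forall t, a <= t <= b -> has_deriv g t (g' t)) ->
  (forall t, a <= t <= b -> f' t <= g' t) ->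
  f b - f a <= g b - g a.
Proof.
move=> ab df dg fg.
have dh t : a <= t <= b -> has_deriv (fun x => g x - f x) t (g' t - f' t).
  by move=> tab; apply: deriv_sub; [exact: dg|exact: df].
have [||c cab] := @MVT_segment R (fun x => g x - f x) (fun t => g' t - f' t) a b ab.
- by move=> x; rewrite in_itv/= => /andP[? ?]; apply: dh; rewrite !ltW.
- apply: derivable_within_continuous => x; rewrite in_itv /= => xab.
  by have := dh x xab; rewrite /has_deriv => dhx; exact: ex_derive.
have : 0 <= (g' c - f' c) * (b - a).
  by rewrite mulr_ge0 ?subr_ge0// fg// -in_itv.
by move=> + E; rewrite -E; lra.
Qed.

Lemma deriv_unique_cst f (c : R) :
  (forall t, has_deriv f t 0) -> f 0 = c -> forall t, f t = c.
Proof. by move=> df <- t; exact: is_derive_0_is_cst. Qed.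

(** The integral from the base point -1 is differentiable to the right of that point only; the
    half-line still contains a neighbourhood of 0, where the gluing takes place. *)
Lemma half_primitive f : continuous f ->
  {F : R -> R | forall t, -1 < t -> has_deriv F t (f t)}.
Proof.
move=> cf; exists (fun x => \int[lebesgue_measure]_(s in `[-1, x]) f s).
move=> t t1; have int : lebesgue_measure.-integrable `[-1, t + 1] (EFin \o f).
  apply: continuous_compact_integrable; first exact: segment_compact.
  by apply: continuous_subspaceT => x; exact: cf.
have tt : t < t + 1 by lra.
have [d e] := continuous_FTC1_closed tt int t1 (cf t).
by rewrite -e derive1E; exact/derivableP.
Qed.

(** Reflection gives a second primitive on x < 1. Normalised to vanish at 0, the two agree on the
    overlap ]-1, 1[ and are glued there. *)
Lemma primitive_exists f : continuous f ->
  exists F : R -> R, F 0 = 0 /\ forall t, has_deriv F t (f t).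
Proof.
move=> cf; have [P dP] := half_primitive cf.
have cf' : continuous (fun x => f (- x)).
  by move=> x; apply: continuous_comp; [exact: oppr_continuous|exact: cf].
have [Q dQ] := half_primitive cf'.
have dQ' t : t < 1 -> has_deriv (fun x => - Q (- x)) t (f t).
  move=> t1; have h : has_deriv Q (- t) (f t).
    by rewrite -{2}[t]opprK; apply: dQ; lra.
  have := deriv_comp h (is_deriveNid t 1).
  move=> /deriv_opp h'; apply: deriv_eq; first exact: h'.
  by rewrite mulrN1 opprK.
pose A x := P x - P 0; pose B x := Q 0 - Q (- x).
have dA t : -1 < t -> has_deriv A t (f t).
  move=> h; rewrite -[f t]subr0.
  by apply: deriv_sub; [exact: dP|exact: deriv_cst].
have dB t : t < 1 -> has_deriv B t (f t).
  move=> h; rewrite -[f t]add0r.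
  by apply: deriv_add; [exact: deriv_cst|exact: dQ'].
have A0 : A 0 = 0 by rewrite /A subrr.
have B0 : B 0 = 0 by rewrite /B oppr0 subrr.
have AB x : -1 < x < 1 -> A x = B x.
  move=> /andP[x1 x2]; have [x0|x0] := leP 0 x.
    have H t : 0 <= t <= x -> has_deriv A t (f t) /\ has_deriv B t (f t).
      by move=> /andP[t0 tx]; split; [apply: dA; lra|apply: dB; lra].
    have := deriv_mono x0 (fun t h => (H t h).1) (fun t h => (H t h).2) (fun t _ => lexx _).
    have := deriv_mono x0 (fun t h => (H t h).2) (fun t h => (H t h).1) (fun t _ => lexx _).
    by rewrite A0 B0 !subr0 => h1 h2; apply/eqP; rewrite eq_le h1 h2.
  have H t : x <= t <= 0 -> has_deriv A t (f t) /\ has_deriv B t (f t).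
    by move=> /andP[t0 tx]; split; [apply: dA; lra|apply: dB; lra].
  have := deriv_mono (ltW x0) (fun t h => (H t h).1) (fun t h => (H t h).2) (fun t _ => lexx _).
  have := deriv_mono (ltW x0) (fun t h => (H t h).2) (fun t h => (H t h).1) (fun t _ => lexx _).
  by rewrite A0 B0 !sub0r !lerN2 => h1 h2; apply/eqP; rewrite eq_le h1 h2.
exists (fun x => if 0 <= x then A x else B x); split; first by rewrite lexx A0.
move=> t; have [t0|t0] := ltP (-1) t.
  apply: (deriv_near _ (dA t t0)).
  near=> y; have y1 : -1 < y by near: y; exact: lt_nbhsr.
  by case: leP => // y0; apply: AB; rewrite y1/=; lra.
have t1 : t < 1 by lra.
apply: (deriv_near _ (dB t t1)).
near=> y; have y1 : y < 0 by near: y; apply: lt_nbhsl; lra.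
by rewrite leNgt y1.
Unshelve. all: by end_near. Qed.

Lemma continuous_mul f g : continuous f -> continuous g ->
  continuous (fun x => f x * g x).
Proof. by move=> cf cg x; apply: continuousM; [exact: cf|exact: cg]. Qed.

Lemma continuous_add f g : continuous f -> continuous g ->
  continuous (fun x => f x + g x).
Proof. by move=> cf cg x; apply: continuousD; [exact: cf|exact: cg]. Qed.

Lemma continuous_sum n (F : nat -> R -> R) : (forall k, continuous (F k)) ->
  continuous (fun x => \sum_(k < n) F k x).
Proof.
move=> cF; elim: n => [|n IH].
  by under eq_fun do rewrite big_ord0; exact: cst_continuous.
under eq_fun do rewrite big_ord_recr /=.
exact: continuous_add.
Qed.

(** Fundamental solutions of Y'' = mu Y: trigonometric, hyperbolic or affine according to the sign
    of mu. *)
Lemma harmonic_pair (mu : R) : exists C S : R -> R,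
  [/\ C 0 = 1, S 0 = 0, forall t, has_deriv C t (mu * S t) &
      forall t, has_deriv S t (C t)].
Proof.
have dlin (k t : R) : has_deriv (fun x => k * x) t k.
  by apply: deriv_eq; first exact: (deriv_scale k (deriv_id t)); rewrite mulr1.
have [mu0|mu0|->] := ltgtP mu 0.
- pose k := Num.sqrt (- mu).
  have k0 : 0 < k by rewrite sqrtr_gt0 oppr_gt0.
  have k2 : k * k = - mu by rewrite -expr2 sqr_sqrtr// oppr_ge0 ltW.
  exists (fun t => cos (k * t)), (fun t => k^-1 * sin (k * t)); split.
  + by rewrite mulr0 cos0.
  + by rewrite mulr0 sin0 mulr0.
  + move=> t; apply: deriv_eq.
      exact: (@deriv_comp cos (fun x => k * x) t _ _ (deriv_cos _) (dlin k t)).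
    have -> : mu = - (k * k) by rewrite k2 opprK.
    by field; lra.
  + move=> t; apply: deriv_eq.
      by apply: deriv_scale;
         exact: (@deriv_comp sin (fun x => k * x) t _ _ (deriv_sin _) (dlin k t)).
    by field; lra.
- pose k := Num.sqrt mu.
  have k0 : 0 < k by rewrite sqrtr_gt0.
  have k2 : k * k = mu by rewrite -expr2 sqr_sqrtr// ltW.
  have dE (c t : R) : has_deriv (fun x => expR (c * x)) t (expR (c * t) * c).
    exact: (@deriv_comp expR (fun x => c * x) t _ _ (deriv_expR _) (dlin c t)).
  exists (fun t => 2^-1 * (expR (k * t) + expR (- k * t))),
    (fun t => (2 * k)^-1 * (expR (k * t) - expR (- k * t))); split.
  + by rewrite !mulr0 expR0; field.
  + by rewrite !mulr0 expR0 subrr mulr0.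
  + move=> t; apply: deriv_eq.
      by apply: deriv_scale; apply: deriv_add; exact: dE.
    by rewrite -k2; field; lra.
  + move=> t; apply: deriv_eq.
      by apply: deriv_scale; apply: deriv_sub; exact: dE.
    by field; lra.
- exists (fun=> 1), id; split => // t; last exact: deriv_id.
  by rewrite mul0r; exact: deriv_cst.
Qed.

(** The substitution y = e^(-bt/2) Y removes the first-order term and gives Y'' = mu Y + F with mu =
    b^2/4 + c. This is solved by variation of constants, the Wronskian C^2 - mu S^2 being 1. *)
Lemma linear_ode (b c y0 y1 : R) f : continuous f ->
  exists y z : R -> R, [/\ y 0 = y0, z 0 = y1,
    forall t, has_deriv y t (z t) &
    forall t, has_deriv z t (- b * z t + c * y t + f t)].
Proof.
move=> cf; pose mu := b ^+ 2 / 4 + c.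
have [C [S [C0 S0 dC dS]]] := harmonic_pair mu.
have dE (k t : R) : has_deriv (fun x => expR (k * x)) t (k * expR (k * t)).
  apply: deriv_eq.
    apply: (@deriv_comp expR (fun x => k * x) t _ k (deriv_expR _)).
    by apply: deriv_eq; first exact: (deriv_scale k (deriv_id t)); rewrite mulr1.
  by rewrite mulrC.
have cont h h' : (forall t, has_deriv h t (h' t)) -> continuous h.
  by move=> dh t; exact: deriv_continuous (dh t).
have det t : C t ^+ 2 - mu * S t ^+ 2 = 1.
  move: t; apply: deriv_unique_cst => [t|]; last by rewrite C0 S0; ring.
  apply: deriv_eq.
    apply: deriv_sub; first exact: (deriv_mul (dC t) (dC t)).
    by apply: deriv_scale; exact: (deriv_mul (dS t) (dS t)).
  by ring.
pose F t := expR (b / 2 * t) * f t.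
have cF : continuous F by apply: continuous_mul cf; exact: cont (dE _).
have cSF : continuous (fun t => S t * F t) by apply: continuous_mul cF; exact: cont dS.
have cCF : continuous (fun t => C t * F t) by apply: continuous_mul cF; exact: cont dC.
have [P [P0 dP]] := primitive_exists cSF.
have [Q [Q0 dQ]] := primitive_exists cCF.
pose Y t := C t * (y0 - P t) + S t * (y1 + b / 2 * y0 + Q t).
pose Z t := mu * (S t * (y0 - P t)) + C t * (y1 + b / 2 * y0 + Q t).
have dY t : has_deriv Y t (Z t).
  apply: deriv_eq.
    apply: deriv_add; apply: deriv_mul; [exact: dC| |exact: dS|].
      by apply: deriv_sub; [exact: deriv_cst|exact: dP].
    by apply: deriv_add; [exact: deriv_cst|exact: dQ].
  by rewrite /Z; ring.
have dZ t : has_deriv Z t (mu * Y t + F t).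
  apply: deriv_eq.
    apply: deriv_add; first (apply: deriv_scale); apply: deriv_mul; [exact: dS| |exact: dC|].
      by apply: deriv_sub; [exact: deriv_cst|exact: dP].
    by apply: deriv_add; [exact: deriv_cst|exact: dQ].
  by rewrite /Y -{3}[F t]mul1r -(det t); ring.
exists (fun t => expR (- (b / 2) * t) * Y t),
  (fun t => expR (- (b / 2) * t) * (- (b / 2) * Y t + Z t)); split.
- by rewrite mulr0 expR0 /Y C0 S0 P0; ring.
- by rewrite mulr0 expR0 /Y /Z C0 S0 P0 Q0; ring.
- move=> t; apply: deriv_eq.
    by apply: deriv_mul; [exact: dE|exact: dY].
  by rewrite /=; ring.
- move=> t; apply: deriv_eq.
    apply: deriv_mul; first exact: dE.
    by apply: deriv_add; [apply: deriv_scale; exact: dY|exact: dZ].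
  have -> : f t = expR (- (b / 2) * t) * F t.
    by rewrite /F mulrA -expRD mulNr addNr expR0 mul1r.
  by rewrite /mu /=; field.
Qed.

End RealDerivatives.

(** * The mode system *)

Section Modes.
Context {R : realType}.

Lemma ler_cabsB (x y : R[i]) : cabs (x - y) <= cabs x + cabs y.
Proof.
rewrite -(ger0_norm (addr_ge0 (cabs_ge0 x) (cabs_ge0 y))) -sqrtr_sqr.
rewrite {1}/cabs ler_wsqrtr// sqrrD !cabs_sq.
have := ler_cdot_cabs x y; rewrite ler_norml => /andP[+ _].
by case: x y => [a b] [c d]; rewrite /cdot /csq /=; lra.
Qed.

Definition has_cderiv (f : R -> R[i]) (t : R) (z : R[i]) : Prop :=
  has_deriv (fun x => complex.Re (f x)) t (complex.Re z) /\
  has_deriv (fun x => complex.Im (f x)) t (complex.Im z).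

Definition ccontinuous (f : R -> R[i]) : Prop :=
  continuous (fun x => complex.Re (f x)) /\ continuous (fun x => complex.Im (f x)).

Lemma cderiv_ccontinuous f f' : (forall t, has_cderiv f t (f' t)) -> ccontinuous f.
Proof. by move=> df; split=> t; apply: deriv_continuous; apply df. Qed.

Lemma ccontinuousM f h : ccontinuous f -> ccontinuous h ->
  ccontinuous (fun x => f x * h x).
Proof.
move=> [f1 f2] [h1 h2]; split.
  under eq_fun do rewrite cReM -mulNr.
  apply: continuous_add; apply: continuous_mul => // x.
  by apply: continuousN; exact: f2.
by under eq_fun do rewrite cImM; apply: continuous_add; exact: continuous_mul.
Qed.

Lemma ccontinuous_cst z : ccontinuous (fun=> z).
Proof. by split; exact: cst_continuous. Qed.

Lemma ccontinuous_sum n (F : nat -> R -> R[i]) (P : pred nat) :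
  (forall k, (k < n)%N -> P k -> ccontinuous (F k)) ->
  ccontinuous (fun x => \sum_(k < n | P k) F k x).
Proof.
move=> cF; have cF' k : ccontinuous
    (fun x => if (k < n)%N && P k then F k x else 0).
  by case E : (_ && _); [have /andP[? ?] := E; exact: cF|exact: ccontinuous_cst].
have E x : \sum_(k < n | P k) F k x =
   \sum_(k < n) (if (k < n)%N && P k then F k x else 0).
  by rewrite big_mkcond; apply: eq_bigr => k _; rewrite ltn_ord.
split.
  rewrite (_ : (fun _ => _) = fun x => \sum_(k < n)
      complex.Re (if (k < n)%N && P k then F k x else 0)).
    by apply: (@continuous_sum R n (fun k x => complex.Re
      (if (k < n)%N && P k then F k x else 0))) => k; case: (cF' k).
  by apply/funext => x; rewrite E cRe_sum.
rewrite (_ : (fun _ => _) = fun x => \sum_(k < n)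
    complex.Im (if (k < n)%N && P k then F k x else 0)).
  by apply: (@continuous_sum R n (fun k x => complex.Im
    (if (k < n)%N && P k then F k x else 0))) => k; case: (cF' k).
by apply/funext => x; rewrite E cIm_sum.
Qed.

Lemma complex_linear_ode (b c : R) (y0 y1 : R[i]) (F : R -> R[i]) :
  ccontinuous F ->
  exists p : (R -> R[i]) * (R -> R[i]), [/\ p.1 0 = y0, p.2 0 = y1,
    forall t, has_cderiv p.1 t (p.2 t) &
    forall t, has_cderiv p.2 t ((- b)%:C%C * p.2 t + c%:C%C * p.1 t + F t)].
Proof.
move=> [cF1 cF2].
have [y [z [yE zE dy dz]]] := linear_ode b c (complex.Re y0) (complex.Re y1) cF1.
have [y' [z' [yE' zE' dy' dz']]] := linear_ode b c (complex.Im y0) (complex.Im y1) cF2.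
exists (fun t => Complex (y t) (y' t), fun t => Complex (z t) (z' t)); split.
- by apply: complex_ext.
- by apply: complex_ext.
- by move=> t; split; [exact: dy|exact: dy'].
- move=> t; split; rewrite ?cReD ?cImD ?cReZ ?cImZ; [exact: dz|exact: dz'].
Qed.

Definition lower_forcing (A : R) k (w : nat -> R[i]) : R[i] :=
  (- (A / 2 * k%:R))%:C%C * \sum_(j < k.+1 | (0 < j < k)%N) w (k - j)%N * w j.

(** The two end terms are equal and are the only ones that contain w_k. Their factor w_0 is constant
    in time, so they become the damping coefficient of a linear equation for mode k. *)
Lemma cprod_ends (w : nat -> R[i]) k : (0 < k)%N ->
  cprod w w k = 2%:R * (w 0%N * w k) +
                \sum_(j < k.+1 | (0 < j < k)%N) w (k - j)%N * w j.
Proof.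
case: k => // k _; rewrite /cprod (bigD1 ord0)//= (bigD1 ord_max)//= subn0 subnn.
rewrite addrA mulrC -mulr2n mulr_natl; congr (_ + _).
apply: eq_bigl => j; rewrite -!val_eqE /= lt0n; congr (_ && _).
by rewrite ltn_neqAle -[in RHS]ltnS ltn_ord andbT.
Qed.

Lemma real_complex0 : (0 : R)%:C%C = 0 :> R[i].
Proof. by []. Qed.

(* Mode k solves a linear second-order equation forced by the modes below k only. *)
Lemma modes_exist (A g s : R) (w0 eta0 : nat -> R[i]) : complex.Im (w0 0%N) = 0 ->
  exists w eta : nat -> R -> R[i],
  [/\ forall k, w k 0 = w0 k, forall k, eta k 0 = eta0 k,
      forall t, w 0%N t = w0 0%N,
      forall k t, has_cderiv (eta k) t (w k t) &
      forall k t, has_cderiv (w k) t (mode_rhs A g s (w^~ t) (eta^~ t) k)].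
Proof.
move=> w0r.
pose spec k (h : nat -> R -> R[i]) (p : (R -> R[i]) * (R -> R[i])) :=
  [/\ p.1 0 = eta0 k, p.2 0 = w0 k,
    forall t, has_cderiv p.1 t (p.2 t) &
    forall t, has_cderiv p.2 t ((- (A * k%:R * complex.Re (w0 0%N)))%:C%C * p.2 t +
       (dispersion A g s k)%:C%C * p.1 t + lower_forcing A k (h^~ t))].
(* [choice] asks for a solution for every history, so the specification is made conditional on a
   continuous forcing and zero serves otherwise. *)
have step (kh : nat * (nat -> R -> R[i])) :
    exists p, ccontinuous (fun t => lower_forcing A kh.1 (kh.2^~ t)) -> spec kh.1 kh.2 p.
  have [cF|ncF] := pselect (ccontinuous (fun t => lower_forcing A kh.1 (kh.2^~ t))).
    have [p ps] := complex_linear_ode (A * kh.1%:R * complex.Re (w0 0%N))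
      (dispersion A g s kh.1) (eta0 kh.1) (w0 kh.1) cF.
    by exists p.
  by exists (fun=> 0, fun=> 0).
have [sol Hsol] := choice step.
(* Course-of-values recursion: [hist n] holds the modes below n and zeros from n on. *)
pose hist := fix hist n : nat -> (R -> R[i]) * (R -> R[i]) :=
  if n is m.+1 then fun j => if j == m then sol (m, fun i => (hist m i).2) else hist m j
  else fun=> (fun=> 0, fun=> 0).
pose w k := (hist k.+1 k).2; pose eta k := (hist k.+1 k).1.
have histS n j : (j < n)%N -> hist n j = hist j.+1 j.
  elim: n => // n IH; rewrite ltnS leq_eqVlt => /predU1P[->//|jn].
  by rewrite -(IH jn) /= ltn_eqF.
have sumE k t : lower_forcing A k (fun i => (hist k i).2 t) = lower_forcing A k (w^~ t).
  congr (_ * _); apply: eq_bigr => j /andP[j0 jk].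
  rewrite /w -(histS k (k - j)%N); last lia.
  by rewrite -(histS k j).
have specw k : ccontinuous (fun t => lower_forcing A k (w^~ t)) -> spec k w (eta k, w k).
  move=> cF; have := Hsol (k, fun i => (hist k i).2).
  have E : (fun t => lower_forcing A k (fun i => (hist k i).2 t)) =
     (fun t => lower_forcing A k (w^~ t)) by apply/funext => t.
  rewrite /= E => /(_ cF); rewrite /spec.
  have -> : sol (k, fun i => (hist k i).2) = (eta k, w k).
    by rewrite /eta /w /= eqxx; case: (sol _).
  move=> [H1 H2 H3 H4]; split => // t.
  by rewrite -sumE.
have cw k : ccontinuous (w k).
  elim/ltn_ind: k => k IH.
  have cF : ccontinuous (fun t => lower_forcing A k (w^~ t)).
    apply: ccontinuousM; first exact: ccontinuous_cst.
    apply: (@ccontinuous_sum k.+1 (fun j t => w (k - j)%N t * w j t)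
      (fun j => 0 < j < k)%N) => j _ /andP[j0 jk].
    by apply: ccontinuousM; apply: IH; lia.
  by have [_ _ _] := specw k cF; exact: cderiv_ccontinuous.
have cF k : ccontinuous (fun t => lower_forcing A k (w^~ t)).
  apply: ccontinuousM; first exact: ccontinuous_cst.
  by apply: (@ccontinuous_sum k.+1 (fun j t => w (k - j)%N t * w j t)
      (fun j => 0 < j < k)%N) => j _ _; apply: ccontinuousM.
(* At k = 0 the dispersion and the forcing vanish, so the mean velocity is conserved. *)
have w00 t : w 0%N t = w0 0%N.
  have [_ h0 _ dw] := specw 0%N (cF 0%N).
  have E x : (- (A * 0%:R * complex.Re (w0 0%N)))%:C%C * w 0%N x +
     (dispersion A g s 0)%:C%C * eta 0%N x + lower_forcing A 0 (w^~ x) = 0.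
    rewrite /lower_forcing big1; last by move=> j; case: (j : nat).
    by rewrite /dispersion expr0n !(mulr0, mul0r, oppr0, subrr, real_complex0, addr0).
  apply: complex_ext.
    by move: t; apply: deriv_unique_cst => [t|]; [have := dw t; rewrite /= E => -[]|rewrite -h0].
  by move: t; apply: deriv_unique_cst => [t|]; [have := dw t; rewrite /= E => -[]|rewrite -h0].
exists w, eta; split => //.
- by move=> k; have [] := specw k (cF k).
- by move=> k; have [] := specw k (cF k).
- by move=> k t; have [_ _ + _] := specw k (cF k); apply.
move=> k t; have [_ _ _ /(_ t)] := specw k (cF k).
rewrite /mode_rhs; case: (posnP k) => [->|k0]; last first.
  rewrite cprod_ends// w00 /lower_forcing.
  set S := \sum_(_ < _ | _) _; set wk := w k t; set e := eta k t.
  rewrite [X in has_cderiv _ _ X -> _](_ : _ = (- (A / 2 * k%:R))%:C%C *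
     (2%:R * (w0 0%N * wk) + S) + (dispersion A g s k)%:C%C * e)//.
  rewrite mulrDr addrAC; congr (_ + _ + _).
  apply: complex_ext; rewrite ?(cReM, cImM) /= ?w0r; by field.
by rewrite /= /lower_forcing !(mulr0, mul0r, oppr0, real_complex0, add0r, addr0).
Qed.

Lemma has_deriv_csq f t z : has_cderiv f t z ->
  has_deriv (fun x => csq (f x)) t (2 * cdot (f t) z).
Proof.
move=> [d1 d2]; rewrite /csq; under eq_fun do rewrite !expr2.
apply: deriv_eq; first by apply: deriv_add; apply: deriv_mul; [exact d1|exact d1|exact d2|exact d2].
by rewrite /cdot /=; ring.
Qed.

Lemma has_deriv_energy (A g s : R) (w eta : nat -> R -> R[i]) k t :
  has_cderiv (eta k) t (w k t) ->
  has_cderiv (w k) t (mode_rhs A g s (w^~ t) (eta^~ t) k) ->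
  has_deriv (fun x => energy s (w^~ x) (eta^~ x) k) t
            (energy_rate A g s (w^~ t) (eta^~ t) k).
Proof.
move=> d1 d2; apply: deriv_eq.
  apply: deriv_add; apply: deriv_scale; apply: has_deriv_csq; [exact: d2|exact: d1].
by rewrite /energy_rate; ring.
Qed.

(** Continuity method. Let tau be the infimum of the times at which phi exceeds B. Up to tau the
    bound B holds, so the hypothesis improves it at tau to the strictly smaller B0 + C tau; by
    continuity phi stays below B a little longer, which contradicts the choice of tau. *)
Lemma bootstrap (phi : R -> R) (B0 B C T : R) :
  continuous phi -> phi 0 <= B0 -> 0 <= C -> B0 + C * T < B ->
  (forall t, 0 <= t <= T -> (forall r, 0 <= r <= t -> phi r <= B) ->
     phi t <= B0 + C * t) ->
  forall t, 0 <= t <= T -> phi t <= B.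
Proof.
move=> cphi phi0 C0 CT H t1 /andP[t10 t1T].
rewrite leNgt; apply/negP => Bt1.
pose E := [set t | 0 <= t <= T /\ B < phi t].
have hE : has_inf E.
  split; first by exists t1; rewrite /E /= t10 t1T.
  by exists 0 => x [/andP[]].
have Elb x : E x -> inf E <= x by apply: ge_inf; case: hE.
have T0 : 0 <= T by lra.
have B0B : B0 < B by apply: le_lt_trans CT; rewrite lerDl mulr_ge0.
set tau := inf E in Elb.
have tau0 : 0 <= tau by apply: lb_le_inf; [case: hE|move=> x [/andP[]]].
have taut1 : tau <= t1 by apply: Elb; rewrite /E /= t10 t1T.
have below r : 0 <= r < tau -> phi r <= B.
  move=> /andP[r0 rtau]; rewrite leNgt; apply/negP => Br.
  have : E r by rewrite /E /= r0 Br; split => //; lra.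
  by move=> /Elb; lra.
have gtB x : B < phi x -> exists2 e, 0 < e & forall y, `|x - y| < e -> B < phi y.
  move=> Bx; have := cphi x _ (open_nbhs_nbhs (conj (@open_gt R B) Bx)).
  by move=> /nbhs_ballP[e e0 he]; exists e => // y xy; apply: he.
have ltB x : phi x < B -> exists2 e, 0 < e & forall y, `|x - y| < e -> phi y < B.
  move=> Bx; have := cphi x _ (open_nbhs_nbhs (conj (@open_lt R B) Bx)).
  by move=> /nbhs_ballP[e e0 he]; exists e => // y xy; apply: he.
have phitau : phi tau <= B.
  rewrite leNgt; apply/negP => Btau.
  have [tz|tz] := eqVneq tau 0; first by move: Btau; rewrite tz; lra.
  have tp : 0 < tau by rewrite lt_def tz.
  have [e e0 he] := gtB _ Btau.
  pose r := Num.max 0 (tau - e / 2).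
  have r0 : 0 <= r by rewrite /r le_max lexx.
  have rt : r < tau by rewrite /r gt_max tp/=; lra.
  have er : tau - e / 2 <= r by rewrite /r le_max lexx orbT.
  have : B < phi r by apply: he; rewrite ger0_norm; lra.
  have : phi r <= B by apply: below; rewrite r0.
  by lra.
have lt_tau : phi tau < B.
  have h : phi tau <= B0 + C * tau.
    apply: H; first by rewrite tau0; lra.
    move=> r /andP[r0]; rewrite le_eqVlt => /predU1P[->//|rt].
    by apply: below; rewrite r0.
  apply: (le_lt_trans h); apply: le_lt_trans CT.
  by rewrite lerD2l ler_wpM2l//; lra.
have [e e0 he] := ltB _ lt_tau.
have [x [xT Bx] xe] := inf_adherent e0 hE.
have := Elb x (conj xT Bx) => tx.
have : phi x < B by apply: he; rewrite distrC ger0_norm ?subr_ge0// ltrBlDl.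
by lra.
Qed.

End Modes.

(** * Existence time and uniform bounds for the mode system *)

Section LocalExistence.
Context {R : realType}.

Lemma energy_lower_ge0 (A g lam B : R) : 0 < lam -> 0 <= B ->
  0 <= 6 * `|A| * (1 + B / 2) * B + 2 * (A * g + 1) ^+ 2 / lam * B.
Proof.
move=> l0 B0; apply: addr_ge0; first by rewrite !mulr_ge0//; lra.
by rewrite mulr_ge0// divr_ge0 ?(ltW l0)// mulr_ge0// sqr_ge0.
Qed.

(** Modes below M are bounded by l. From M on, 1 <= k / M, and the sums of k |x_k| and k |y_k| are
    controlled by the energy. *)
Lemma cabs_perturb_le (A B : R) (M n : nat) (x y : nat -> R[i]) (l : nat -> R) :
  (0 < M)%N -> (forall k, cabs (A%:C%C * x k - A%:C%C * y k) <= l k) ->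
  \sum_(k < n) k%:R ^+ 4 * csq (x k) <= B ->
  \sum_(k < n) k%:R ^+ 4 * csq (y k) <= B ->
  \sum_(k < n) cabs (A%:C%C * x k - A%:C%C * y k) <=
  \sum_(k < M) l k + 2 * `|A| * (1 + B / 2) / M%:R.
Proof.
move=> M0 xyl xB yB.
have l0 k : 0 <= l k by exact: le_trans (cabs_ge0 _) (xyl k).
have MR : (0 : R) < M%:R by rewrite ltr0n.
pose H k : R := `|A| / M%:R * (k%:R * cabs (x k) + k%:R * cabs (y k)).
have H0 k : 0 <= H k by rewrite mulr_ge0// ?divr_ge0// addr_ge0// mulr_ge0// cabs_ge0.
have step k : cabs (A%:C%C * x k - A%:C%C * y k) <= (if (k < M)%N then l k else 0) + H k.
  case: ltnP => kM; first by apply: (le_trans (xyl k)); rewrite lerDl.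
  rewrite add0r -mulrBr cabsZ /H -mulrA ler_wpM2l//.
  apply: (le_trans (ler_cabsB _ _)); rewrite -mulrDr mulrA ler_peMl//.
    by rewrite addr_ge0 ?cabs_ge0.
  by rewrite mulrC ler_pdivlMr// mul1r ler_nat.
apply: (@le_trans _ _ (\sum_(k < n) ((if (k < M)%N then l k else 0) + H k))).
  by apply: ler_sum => k _; exact: step.
rewrite big_split /= lerD//.
  rewrite -big_mkcond /=.
  have [nM|Mn] := leqP n M.
    apply: (@le_trans _ _ (\sum_(k < n) l k)); last exact: ler_sum_ord_prefix.
    by rewrite big_mkcond; apply: ler_sum => k _; case: ifP.
  by rewrite (big_ord_widen n l (ltnW Mn)).
rewrite -mulr_sumr big_split /=.
have := sum_k_cabs xB; have := sum_k_cabs yB => h1 h2.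
rewrite [leRHS](_ : _ = `|A| / M%:R * (2 * (1 + B / 2))); last by field; lra.
by rewrite ler_wpM2l ?divr_ge0//; lra.
Qed.

(** The majorant m serves dominated convergence in time. The functions Gam are primitives of k^5
    |w_k|^2, whose summable increments encode the L^2 bound in time of the H^(5/2) norm. *)
Theorem modes_local_existence (A g s lam B0 : R) (w0 eta0 : nat -> R[i]) :
  0 <= s -> 0 < lam -> complex.Im (w0 0%N) = 0 ->
  (forall n (v : nat -> R[i]), lam * \sum_(k < n) csq (v k) <=
               toeplitz (fun k => A%:C%C * w0 k) v n) ->
  (forall n, \sum_(k < n) energy s w0 eta0 k <= B0) ->
  exists (T : R) (w eta : nat -> R -> R[i]), 0 < T /\
  [/\ (forall k, w k 0 = w0 k) /\ (forall k, eta k 0 = eta0 k),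
      forall t, w 0%N t = w0 0%N,
      forall k t, has_cderiv (eta k) t (w k t) /\
                  has_cderiv (w k) t (mode_rhs A g s (w^~ t) (eta^~ t) k),
      exists m : nat -> R, (exists C, forall n, \sum_(k < n) m k <= C) /\
        forall k t, 0 <= t <= T -> energy s (w^~ t) (eta^~ t) k <= m k &
      exists Gam : nat -> R -> R,
        (forall k t, has_deriv (Gam k) t (k%:R ^+ 5 * csq (w k t))) /\
        exists C, forall n, \sum_(k < n) (Gam k T - Gam k 0) <= C].
Proof.
move=> s0 lam0 w0r pos EB0.
have [w [eta [wi etai w00 deta dw]]] := modes_exist A g s eta0 w0r.
have B00 : 0 <= B0 by have := EB0 0%N; rewrite big_ord0.
pose B := B0 + 1; have Bge0 : 0 <= B by rewrite /B; lra.
pose C := 6 * `|A| * (1 + B / 2) * B + 2 * (A * g + 1) ^+ 2 / lam * B.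
have Cge0 : 0 <= C by exact: energy_lower_ge0.
have cw k : ccontinuous (w k) by exact: cderiv_ccontinuous (dw k).
have dE k t := has_deriv_energy (deta k t) (dw k t).
have E0 n : \sum_(k < n) energy s (w^~ 0) (eta^~ 0) k <= B0.
  apply: le_trans (EB0 n); apply: ler_sum => k _.
  by rewrite /energy wi etai.
(* The loss lam / 2 in the positivity is shared equally: M makes the modes from M on cost at most
   lam / 4, and a short time does the same for the finitely many others. *)
pose M := (Num.truncn (8 * `|A| * (1 + B / 2) / lam)).+1.
have M0 : (0 < M)%N by [].
have MR : (0 : R) < M%:R by rewrite ltr0n.
have Mlarge : 2 * `|A| * (1 + B / 2) / M%:R <= lam / 4.
  rewrite ler_pdivrMr//.
  have : 8 * `|A| * (1 + B / 2) / lam < M%:R by exact: truncnS_gt.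
  by rewrite ltr_pdivrMr//; lra.
pose l k t := `|A| * (`|complex.Re (w k t - w0 k)| + `|complex.Im (w k t - w0 k)|).
have cl : continuous (fun t => \sum_(k < M) l k t).
  apply: continuous_sum => k; rewrite /l.
  apply: continuous_mul; first exact: cst_continuous.
  have h (f : R -> R) (c : R) : continuous f -> continuous (fun t => `|f t - c|).
    move=> cf t; apply: (@continuous_comp _ _ _ (fun t => f t - c) (fun x : R => `|x|)).
      by apply: continuousB; [exact: cf|exact: cst_continuous].
    exact: norm_continuous.
  apply: continuous_add.
    under eq_fun do rewrite cReD cReN.
    by apply: h; have [] := cw k.
  under eq_fun do rewrite cImD cImN.
  by apply: h; have [] := cw k.
have l00 : \sum_(k < M) l k 0 = 0.
  by apply: big1 => k _; rewrite /l wi subrr /= normr0 addr0 mulr0.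
have [del del0 small] : exists2 del, 0 < del & forall t, `|t| < del -> \sum_(k < M) l k t < lam / 4.
  have lt4 : \sum_(k < M) l k 0 < lam / 4 by rewrite l00; lra.
  have := cl 0 _ (open_nbhs_nbhs (conj (@open_lt R (lam / 4)) lt4)).
  move=> /nbhs_ballP[e e0 he]; exists e => // t te; apply: he.
  by rewrite /ball /= sub0r normrN.
(* The first bound keeps the low modes close to their initial values; the second gives C T < 1 = B -
   B0, the gap required by [bootstrap]. *)
pose T := Num.min (del / 2) (C + 1)^-1.
have T0 : 0 < T by rewrite lt_min invr_gt0; apply/andP; split; lra.
have Tdel : T < del by apply: (@le_lt_trans _ _ (del / 2)); [rewrite ge_min lexx|lra].
have CT : B0 + C * T < B.
  rewrite ltrD2l; have : T <= (C + 1)^-1 by rewrite ge_min lexx orbT.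
  rewrite -(ler_pM2l (_ : 0 < C + 1)) ?divff; [|lra..]; lra.
have w4 n t : \sum_(k < n) energy s (w^~ t) (eta^~ t) k <= B ->
    \sum_(k < n) k%:R ^+ 4 * csq (w k t) <= B.
  apply: le_trans; apply: ler_sum => k _.
  by have /andP[] := energy_ge s0 (w^~ t) (eta^~ t) k.
have w04 n : \sum_(k < n) k%:R ^+ 4 * csq (w0 k) <= B.
  apply: (@le_trans _ _ B0); last by rewrite /B; lra.
  apply: le_trans (EB0 n); apply: ler_sum => k _.
  by have /andP[] := energy_ge s0 w0 eta0 k.
have posT n t : 0 <= t <= T -> \sum_(k < n) energy s (w^~ t) (eta^~ t) k <= B ->
    forall v : nat -> R[i], lam / 2 * \sum_(k < n) csq (v k) <= toeplitz (fun k => A%:C%C * w k t) v n.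
  move=> /andP[t0 tT] En v.
  have -> : lam / 2 = lam - lam / 2 by field.
  apply: (toeplitz_perturb (pos n v)).
  apply: (@le_trans _ _ (\sum_(k < M) l k t + 2 * `|A| * (1 + B / 2) / M%:R)).
    apply: (@cabs_perturb_le A B M n (w^~ t) w0 (l^~ t) M0) => // [k|]; last exact: w4.
    by rewrite -mulrBr cabsZ /l ler_wpM2l// cabs_ReIm.
  have := small t; rewrite ger0_norm// => /(_ _); lra.
pose G n t := \sum_(k < n) k%:R ^+ 5 * csq (w k t).
have G0 n t : 0 <= G n t.
  by apply: sumr_ge0 => k _; rewrite mulr_ge0 ?csq_ge0 ?exprn_ge0.
have dEn n t : has_deriv (fun x => \sum_(k < n) energy s (w^~ x) (eta^~ x) k) t
    (\sum_(k < n) energy_rate A g s (w^~ t) (eta^~ t) k).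
  by apply: (deriv_sum (F := fun k x => energy s (w^~ x) (eta^~ x) k)
    (dF := fun k => energy_rate A g s (w^~ t) (eta^~ t) k)).
have rate_le n t : 0 <= t <= T -> \sum_(k < n) energy s (w^~ t) (eta^~ t) k <= B ->
    \sum_(k < n) energy_rate A g s (w^~ t) (eta^~ t) k <= - (lam / 2) * G n t + C.
  move=> tT En; exact: (energy_rate_sum_le g s0 lam0 En (posT n t tT En)).
have dlin (c t : R) : has_deriv (fun x => c * x) t c.
  by apply: deriv_eq; [exact: deriv_scale (deriv_id t)|rewrite mulr1].
have EB n t : 0 <= t <= T -> \sum_(k < n) energy s (w^~ t) (eta^~ t) k <= B.
  move: t; apply: (@bootstrap _ (fun t => \sum_(k < n) energy s (w^~ t) (eta^~ t) k) B0 B C T) => //.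
    by move=> t; exact: deriv_continuous (dEn n t).
  move=> t /andP[t0 tT] H.
  have : \sum_(k < n) energy s (w^~ t) (eta^~ t) k -
         \sum_(k < n) energy s (w^~ 0) (eta^~ 0) k <= C * t - C * 0.
    apply: (@deriv_mono R _ _ _ (fun=> C) 0 t t0 (fun x _ => dEn n x) (fun x _ => dlin C x)).
    move=> x /andP[x0 xt].
    have xT : 0 <= x <= T by rewrite x0; lra.
    apply: (le_trans (rate_le n x xT _)); first by apply: H; rewrite x0.
    by rewrite gerDr mulNr oppr_le0 mulr_ge0//; lra.
  by have := E0 n; lra.
have csqc k : continuous (fun t => k%:R ^+ 5 * csq (w k t)).
  apply: continuous_mul; first exact: cst_continuous.
  by move=> t; exact: deriv_continuous (has_deriv_csq (dw k t)).
have crate k : continuous (fun t => `|energy_rate A g s (w^~ t) (eta^~ t) k|).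
  have ceta j : ccontinuous (eta j) by exact: cderiv_ccontinuous (deta j).
  have crhs : ccontinuous (fun t => mode_rhs A g s (w^~ t) (eta^~ t) k).
    have cadd (f h : R -> R[i]) : ccontinuous f -> ccontinuous h -> ccontinuous (fun t => f t + h t).
      move=> [f1 f2] [h1 h2]; split; under eq_fun do rewrite ?cReD ?cImD; exact: continuous_add.
    apply: cadd; (apply: ccontinuousM; first exact: ccontinuous_cst); last exact: ceta.
    apply: (@ccontinuous_sum _ k.+1 (fun j t => w (k - j)%N t * w j t) xpredT) => j _ _.
    exact: ccontinuousM.
  have cdotc (f h : R -> R[i]) : ccontinuous f -> ccontinuous h -> continuous (fun t => cdot (f t) (h t)).
    by move=> [f1 f2] [h1 h2]; apply: continuous_add; exact: continuous_mul.
  have cc : continuous (fun t => energy_rate A g s (w^~ t) (eta^~ t) k).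
    apply: continuous_mul; first exact: cst_continuous.
    apply: continuous_add; (apply: continuous_mul; first exact: cst_continuous); exact: cdotc.
  move=> t; apply: (@continuous_comp _ _ _ (fun t => energy_rate A g s (w^~ t) (eta^~ t) k)
     (fun x : R => `|x|)); first exact: cc.
  exact: norm_continuous.
have [Gam HGam] := choice (fun k => primitive_exists (csqc k)).
have [Del HDel] := choice (fun k => primitive_exists (crate k)).
have dG n t : has_deriv (fun x => \sum_(k < n) Gam k x) t (G n t).
  by apply: (deriv_sum (F := Gam) (dF := fun k => k%:R ^+ 5 * csq (w k t))) => k _; exact: (HGam k).2.
have dD n t : has_deriv (fun x => \sum_(k < n) Del k x) t
    (\sum_(k < n) `|energy_rate A g s (w^~ t) (eta^~ t) k|).
  apply: (deriv_sum (F := Del) (dF := fun k => `|energy_rate A g s (w^~ t) (eta^~ t) k|)) => k _.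
  exact: (HDel k).2.
have T0' : 0 <= T by exact: ltW.
(* The rate inequality integrated over [0, T]; the final energy is nonnegative. *)
have GamB n : \sum_(k < n) (Gam k T - Gam k 0) <= 2 / lam * (C * T + B0).
  have h : lam / 2 * \sum_(k < n) Gam k T - lam / 2 * \sum_(k < n) Gam k 0 <=
    C * T - \sum_(k < n) energy s (w^~ T) (eta^~ T) k -
    (C * 0 - \sum_(k < n) energy s (w^~ 0) (eta^~ 0) k).
    apply: (@deriv_mono R (fun x => lam / 2 * \sum_(k < n) Gam k x)
      (fun x => C * x - \sum_(k < n) energy s (w^~ x) (eta^~ x) k) _ _ 0 T T0'
      (fun x _ => deriv_scale (lam / 2) (dG n x))
      (fun x _ => deriv_sub (dlin C x) (dEn n x))) => t tT.
    have := rate_le n t tT (EB n t tT); lra.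
  rewrite sumrB.
  have eT : 0 <= \sum_(k < n) energy s (w^~ T) (eta^~ T) k.
    by apply: sumr_ge0 => k _; exact: energy_ge0.
  rewrite -(ler_pM2l (_ : 0 < lam / 2)); last lra.
  rewrite [leRHS](_ : _ = C * T + B0); last by field; lra.
  by have := E0 n; lra.
pose K := 2 * `|A| * (cabs (w0 0%N) + 1 + B / 2) + lam / 2.
have K0 : 0 <= K.
  by apply: addr_ge0; [apply: mulr_ge0 => //; have := cabs_ge0 (w0 0%N); lra|lra].
have DelB n : \sum_(k < n) (Del k T - Del k 0) <= K * (2 / lam * (C * T + B0)) + C * T.
  have h : \sum_(k < n) Del k T - \sum_(k < n) Del k 0 <=
     K * \sum_(k < n) Gam k T + C * T - (K * \sum_(k < n) Gam k 0 + C * 0).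
    apply: (@deriv_mono R _ (fun x => K * \sum_(k < n) Gam k x + C * x) _ _ 0 T T0'
      (fun x _ => dD n x)
      (fun x _ => deriv_add (deriv_scale K (dG n x)) (dlin C x))) => t tT.
    have := energy_rate_abs_le A g s0 lam0 (EB n t tT).
    by rewrite w00.
  rewrite sumrB; apply: (le_trans h).
  have := ler_wpM2l K0 (GamB n); rewrite sumrB; lra.
exists T, w, eta; split => //; split => //.
(* Initial energy of mode k plus the integral over [0, T] of the absolute value of its rate. *)
- pose m k := energy s (w^~ 0) (eta^~ 0) k + (Del k T - Del k 0).
  exists m; split.
    exists (B0 + (K * (2 / lam * (C * T + B0)) + C * T)) => n.
    by rewrite big_split /=; exact: lerD (E0 n) (DelB n).
  move=> k t /andP[t0 tT].
  have h1 : energy s (w^~ t) (eta^~ t) k - energy s (w^~ 0) (eta^~ 0) k <= Del k t - Del k 0.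
    apply: (@deriv_mono R (fun x => energy s (w^~ x) (eta^~ x) k) _ _ _ 0 t t0
      (fun x _ => dE k x) (fun x _ => (HDel k).2 x)) => x _.
    exact: ler_norm.
  have h2 : Del k t - Del k t <= Del k T - Del k t.
    have := @deriv_mono R (fun=> 0) (Del k) (fun=> 0) _ t T tT
       (fun x _ => deriv_cst 0 x) (fun x _ => (HDel k).2 x) (fun x _ => normr_ge0 _).
    by rewrite !subrr.
  by rewrite /m; lra.
- exists Gam; split; first by move=> k; exact: (HGam k).2.
  by exists (2 / lam * (C * T + B0)).
Qed.

End LocalExistence.

(** * Integration on the torus *)

Section TorusIntegral.
Context {R : realType}.
Implicit Types (f g : R -> R).

Local Notation mu := (@lebesgue_measure R).

Definition tint f : R := \int[mu]_(x in torus) f x.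
Definition tintegrable f : Prop := mu.-integrable torus (EFin \o f).

Lemma pi2_gt0 : 0 < pi *+ 2 :> R.
Proof. by rewrite pmulrn_rgt0// pi_gt0. Qed.

Lemma measurable_torus : measurable (torus : set R).
Proof. exact: measurable_itv. Qed.
Hint Resolve measurable_torus : core.

(* The domain of [lebesgue_measure] is [measurableTypeR R], whose display differs
   from the one of [R]. *)
Lemma measurable_torusR : (@measurable _ (measurableTypeR R)) torus.
Proof. exact: measurable_itv. Qed.
Hint Resolve measurable_torusR : core.

Lemma mu_torus : mu (torus : set R) = (pi *+ 2)%:E.
Proof.
rewrite /torus lebesgue_measure_itv/= lte_fin gtrN ?pi_gt0//.
by rewrite -EFinD opprK mulr2n.
Qed.

Lemma mu_torus_lty : (mu (torus : set R) < +oo)%E.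
Proof. by rewrite mu_torus ltry. Qed.
Hint Resolve mu_torus_lty : core.

Lemma tintegrable_measurable f : tintegrable f -> measurable_fun torus f.
Proof. by move=> /integrableP[/measurable_EFinP]. Qed.

Lemma continuous_measurable_torus f : continuous f -> measurable_fun torus f.
Proof.
by move=> cf; apply: measurable_funS (continuous_measurable_fun cf).
Qed.

Lemma tintegrable_continuous f : continuous f -> tintegrable f.
Proof.
move=> cf; apply: continuous_compact_integrable; first exact: segment_compact.
exact: continuous_subspaceT.
Qed.

Lemma tintegrable_cst (c : R) : tintegrable (fun=> c).
Proof. by apply: tintegrable_continuous; exact: cst_continuous. Qed.

Lemma tintegrableD f g : tintegrable f -> tintegrable g ->
  tintegrable (fun x => f x + g x).
Proof.
move=> f1 g1; have := integrableD measurable_torusR f1 g1.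
exact.
Qed.

Lemma tintegrableB f g : tintegrable f -> tintegrable g ->
  tintegrable (fun x => f x - g x).
Proof.
move=> f1 g1; have := integrableB measurable_torusR f1 g1.
exact.
Qed.

Lemma tintegrableZ (c : R) f : tintegrable f -> tintegrable (fun x => c * f x).
Proof.
move=> f1; have := integrableZl measurable_torusR c f1.
exact.
Qed.

Lemma tintegrable_sum n (F : nat -> R -> R) : (forall k, tintegrable (F k)) ->
  tintegrable (fun x => \sum_(k < n) F k x).
Proof.
move=> H; elim: n => [|n IH].
  by under eq_fun do rewrite big_ord0; exact: tintegrable_cst.
under eq_fun do rewrite big_ord_recr /=.
exact: tintegrableD.
Qed.

Lemma tintegrable_dom f g : measurable_fun torus f -> tintegrable g ->
  (forall x, torus x -> `|f x| <= g x) -> tintegrable f.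
Proof.
move=> mf ig fg; apply: (le_integrable measurable_torusR _ _ ig).
  exact/measurable_EFinP.
by move=> x tx /=; rewrite lee_fin (le_trans (fg x tx))// ler_norm.
Qed.

Lemma tintegrableM f g (M : R) : tintegrable f -> measurable_fun torus g ->
  (forall x, torus x -> `|g x| <= M) -> tintegrable (fun x => f x * g x).
Proof.
move=> f1 mg gM; apply: (@tintegrable_dom _ (fun x => M * `|f x|)).
- by apply: measurable_funM => //; exact: tintegrable_measurable.
- apply: tintegrableZ; exact: integrable_norm.
- by move=> x tx; rewrite normrM mulrC ler_wpM2r// gM.
Qed.

Lemma tintD f g : tintegrable f -> tintegrable g ->
  tint (fun x => f x + g x) = tint f + tint g.
Proof. by move=> *; exact: RintegralD. Qed.

Lemma tintB f g : tintegrable f -> tintegrable g ->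
  tint (fun x => f x - g x) = tint f - tint g.
Proof. by move=> *; exact: RintegralB. Qed.

Lemma tintZ (c : R) f : tintegrable f -> tint (fun x => c * f x) = c * tint f.
Proof. by move=> *; exact: RintegralZl. Qed.

Lemma tint_cst (c : R) : tint (fun=> c) = c * (pi *+ 2).
Proof.
transitivity (c * fine (mu torus)); last by rewrite mu_torus.
exact: Rintegral_cst.
Qed.

Lemma tint_sum n (F : nat -> R -> R) : (forall k, tintegrable (F k)) ->
  tint (fun x => \sum_(k < n) F k x) = \sum_(k < n) tint (F k).
Proof.
move=> H; elim: n => [|n IH].
  by under eq_fun do rewrite big_ord0; rewrite tint_cst mul0r big_ord0.
under eq_fun do rewrite big_ord_recr /=.
by rewrite tintD ?IH ?big_ord_recr//; exact: tintegrable_sum.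
Qed.

Lemma le_tint f g : tintegrable f -> tintegrable g ->
  (forall x, torus x -> f x <= g x) -> tint f <= tint g.
Proof. by move=> *; exact: le_Rintegral. Qed.

Lemma tint_ge0 f : (forall x, torus x -> 0 <= f x) -> 0 <= tint f.
Proof. by move=> H; exact: Rintegral_ge0. Qed.

Lemma tint_norm f : tintegrable f -> `|tint f| <= tint (fun x => `|f x|).
Proof. by move=> *; exact: le_normr_Rintegral. Qed.

Lemma tintegrable_normr f : tintegrable f -> tintegrable (fun x => `|f x|).
Proof. by move=> *; exact: integrable_norm. Qed.

Lemma eq_tint f g : (forall x, torus x -> f x = g x) -> tint f = tint g.
Proof. by move=> H; apply: eq_Rintegral => x /[!inE]; exact: H. Qed.

Lemma tint_EFin f : tintegrable f ->
  (\int[mu]_(x in torus) (f x)%:E)%E = (tint f)%:E.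
Proof. by move=> fi; rewrite fineK//; exact: integrable_fin_num. Qed.

Lemma tint_ae_eq f g : tintegrable f -> measurable_fun torus g ->
  ae_eq mu torus f g -> tint f = tint g.
Proof.
move=> fi mg fg; congr fine; apply: ae_eq_integral => //.
- by apply/measurable_EFinP; exact: tintegrable_measurable.
- exact/measurable_EFinP.
by apply: filterS fg => x /= H tx; rewrite H.
Qed.

Definition nsq f : R := tint (fun x => f x ^+ 2).

Lemma L2_measurable f : L2_torus f -> measurable_fun torus f.
Proof. by case=> _ mf _; exact: measurable_funS mf. Qed.

Lemma L2_sq_integrable f : L2_torus f -> tintegrable (fun x => f x ^+ 2).
Proof.
move=> fL; have mf := L2_measurable fL; case: fL => _ _ h.
apply/integrableP; split.
  by apply/measurable_EFinP; exact: measurable_funX.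
move: h; rewrite /l2_sqnorm.
by under eq_integral do rewrite -[X in X%:E]ger0_norm ?sqr_ge0//.
Qed.

Lemma L2_intro f : periodic f (pi *+ 2) -> measurable_fun setT f ->
  tintegrable (fun x => f x ^+ 2) -> L2_torus f.
Proof. by move=> pf mf fi; split => //; rewrite /l2_sqnorm tint_EFin// ltry. Qed.

Lemma l2_sqnormE f : L2_torus f -> l2_sqnorm f = (nsq f)%:E.
Proof. by move=> /L2_sq_integrable; exact: tint_EFin. Qed.

Lemma L2_integrableM f g : L2_torus f -> L2_torus g ->
  tintegrable (fun x => f x * g x).
Proof.
move=> fL gL; have fi := L2_sq_integrable fL; have gi := L2_sq_integrable gL.
apply: (tintegrable_dom _ (tintegrableD fi gi)).
  by apply: measurable_funM; exact: L2_measurable.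
move=> x _; rewrite ler_norml.
have := sqr_ge0 (f x + g x); have := sqr_ge0 (f x - g x).
have := sqr_ge0 (f x); have := sqr_ge0 (g x).
by rewrite sqrrB sqrrD => h1 h2 h3 h4; apply/andP; split; lra.
Qed.

Lemma L2_continuous f : periodic f (pi *+ 2) -> continuous f -> L2_torus f.
Proof.
move=> pf cf; apply: L2_intro => //; first exact: continuous_measurable_fun.
apply: tintegrable_continuous; under eq_fun do rewrite expr2.
exact: continuous_mul.
Qed.

Lemma L2_cst (c : R) : L2_torus (fun=> c).
Proof. by apply: L2_continuous; [|exact: cst_continuous]. Qed.

Lemma L2_integrable f : L2_torus f -> tintegrable f.
Proof.
move=> fL; have := L2_integrableM fL (L2_cst 1).
by under eq_fun do rewrite mulr1.
Qed.

Lemma L2_Z (c : R) f : L2_torus f -> L2_torus (fun x => c * f x).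
Proof.
move=> fL; have fi := L2_sq_integrable fL; case: fL => pf mf _.
apply: L2_intro.
- by move=> x; rewrite pf.
- by apply: measurable_funM => //; exact: measurable_cst.
- by under eq_fun do rewrite exprMn; exact: tintegrableZ.
Qed.

Lemma L2_D f g : L2_torus f -> L2_torus g -> L2_torus (fun x => f x + g x).
Proof.
move=> fL gL; have fi := L2_sq_integrable fL; have gi := L2_sq_integrable gL.
have fgi := L2_integrableM fL gL; case: fL => pf mf _; case: gL => pg mg _.
apply: L2_intro.
- by move=> x; rewrite pf pg.
- exact: measurable_funD.
- under eq_fun do rewrite sqrrD -mulr_natl.
  by apply: tintegrableD => //; apply: tintegrableD => //; exact: tintegrableZ.
Qed.

Lemma L2_B f g : L2_torus f -> L2_torus g -> L2_torus (fun x => f x - g x).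
Proof.
move=> fL gL; have := L2_D fL (L2_Z (-1) gL).
by under eq_fun do rewrite mulN1r.
Qed.

(** The Cauchy-Schwarz inequality with a free parameter, so that no square root is needed. *)
Lemma tint_mul_abs_le f g (e : R) : L2_torus f -> L2_torus g -> 0 < e ->
  tint (fun x => `|f x * g x|) <= (e^-1 * nsq f + e * nsq g) / 2.
Proof.
move=> fL gL e0; have fi := L2_sq_integrable fL; have gi := L2_sq_integrable gL.
have fgi := L2_integrableM fL gL.
rewrite mulrDl ![_ / 2]mulrAC -!tintZ// -tintD; [|exact: tintegrableZ..].
apply: le_tint; first exact: tintegrable_normr.
  by apply: tintegrableD; exact: tintegrableZ.
move=> x _; rewrite normrM -[f x ^+ 2]real_normK ?num_real//.
rewrite -[g x ^+ 2]real_normK ?num_real//.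
set a := `|f x|; set b := `|g x|.
have := mulr_ge0 (ltW e0) (sqr_ge0 (e^-1 * a - b)).
have -> : e * (e^-1 * a - b) ^+ 2 = e^-1 * a ^+ 2 + e * b ^+ 2 - 2 * (a * b).
  by field; lra.
by set X := e^-1; lra.
Qed.

Lemma l2_sqnorm_ae f g : ae_eq mu torus f g -> measurable_fun torus f ->
  measurable_fun torus g -> l2_sqnorm f = l2_sqnorm g.
Proof.
move=> fg mf mg; apply: ae_eq_integral => //.
- by apply/measurable_EFinP; exact: measurable_funX.
- by apply/measurable_EFinP; exact: measurable_funX.
by apply: filterS fg => x /= H tx; rewrite H.
Qed.

End TorusIntegral.
#[global] Hint Resolve measurable_torus measurable_torusR mu_torus_lty : core.

(** * Injectivity of the Fourier transform *)

Section StepPolynomials.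
Context {R : realType}.

Lemma bernoulli_ge (z : R) m : 0 <= z <= 1 -> 1 - m%:R * z <= (1 - z) ^+ m.
Proof.
move=> /andP[z0 z1]; elim: m => [|m IH]; first by rewrite mul0r subr0 expr0.
have h : 0 <= (1 - z) ^+ m <= 1.
  by rewrite exprn_ge0 ?subr_ge0// exprn_ile1 ?subr_ge0// gerBl.
have hz : (1 - z) ^+ m * z <= z by case/andP: h => h0 h1; rewrite ler_piMl.
by rewrite exprSr mulrBr mulr1 -natr1; lra.
Qed.

Lemma bernoulli_le (z : R) m : 0 <= z <= 1 -> (1 - z) ^+ m * (1 + m%:R * z) <= 1.
Proof.
move=> /andP[z0 z1]; elim: m => [|m IH]; first by rewrite mul0r addr0 mulr1.
apply: le_trans IH; rewrite exprSr -mulrA ler_wpM2l ?exprn_ge0 ?subr_ge0//.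
have h : 0 <= m%:R * z * z by rewrite !mulr_ge0.
have h2 : 0 <= z * z by rewrite mulr_ge0.
by rewrite -natr1; lra.
Qed.

(** With q the square root of r, n q^n is bounded by Bernoulli's inequality, and the other factor
    q^n tends to 0. *)
Lemma cvg_nat_geometric (r : R) : 0 <= r < 1 ->
  n%:R * r ^+ n @[n --> \oo] --> (0 : R).
Proof.
move=> /andP[r0 r1]; have [->|rn0] := eqVneq r 0.
  apply: (@cvg_near_cst _ _ _ _ _ _) => //.
  by exists 1%N => // n /= n1; rewrite expr0n eqn0Ngt n1/= mulr0.
have rp : 0 < r by rewrite lt_def rn0.
pose q := Num.sqrt r.
have q0 : 0 < q by rewrite sqrtr_gt0.
have q1 : q < 1 by rewrite -sqrtr1 ltr_sqrt.
have hb n : n%:R * q ^+ n <= (1 - q)^-1 * 1.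
  have h := @bernoulli_le (1 - q) n.
  have {}h : q ^+ n * (1 + n%:R * (1 - q)) <= 1.
    by have := h; rewrite subKr; apply; apply/andP; split; lra.
  rewrite -(ler_pM2l (_ : 0 < 1 - q)); last lra.
  rewrite mulr1 mulfV; last by lra.
  have : 0 <= q ^+ n by rewrite exprn_ge0// ltW.
  by lra.
apply: (@squeeze_cvgr _ _ _ _ (fun=> 0) (fun n => (1 - q)^-1 * q ^+ n)).
- near=> n; rewrite mulr_ge0 ?exprn_ge0//=.
  have -> : r ^+ n = q ^+ n * q ^+ n by rewrite -exprMn -expr2 sqr_sqrtr.
  rewrite mulrA ler_wpM2r ?exprn_ge0 ?(ltW q0)//.
  by rewrite -[leRHS]mulr1.
- exact: cvg_cst.
- rewrite -[X in _ --> X](mulr0 (1 - q)^-1); apply: cvgMr.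
  by apply: cvg_expr; rewrite ger0_norm// ltW.
Unshelve. all: by end_near. Qed.

(** Exponent times y^n is n (K y)^n. It tends to 0 for K y < 1 and is at least n for K y >= 1, and
    the two Bernoulli inequalities convert this into the limits 1 and 0. The factor n in the
    exponent settles the threshold K y = 1. *)
Lemma cvg_step (K : nat) (y : R) : 0 <= y <= 1 ->
  (1 - y ^+ n) ^+ (n * K ^ n) @[n --> \oo] -->
    (if K%:R * y < 1 then 1 else 0 : R).
Proof.
move=> /andP[y0 y1]; have yn n : 0 <= y ^+ n <= 1.
  by rewrite exprn_ge0// exprn_ile1.
have E n : (n * K ^ n)%N%:R * y ^+ n = n%:R * (K%:R * y) ^+ n.
  by rewrite natrM natrX exprMn mulrA.
case: ltP => Ky.
  apply: (@squeeze_cvgr _ _ _ _ (fun n => 1 - n%:R * (K%:R * y) ^+ n) (fun=> 1)).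
  - near=> n; rewrite -E bernoulli_ge//=.
    by apply: exprn_ile1; rewrite ?subr_ge0 ?gerBl; case/andP: (yn n).
  - rewrite -[X in _ --> X]subr0; apply: cvgB; first exact: cvg_cst.
    by apply: cvg_nat_geometric; rewrite Ky mulr_ge0.
  - exact: cvg_cst.
apply: (@squeeze_cvgr _ _ _ _ (fun=> 0) (fun n => n.+1%:R^-1)).
- near=> n; apply/andP; split.
    by rewrite exprn_ge0// subr_ge0; case/andP: (yn n).
  have := bernoulli_le (n * K ^ n) (yn n); rewrite E => h.
  rewrite -[leRHS]mul1r ler_pdivlMr ?ltr0n//; apply: le_trans h.
  rewrite ler_wpM2l ?exprn_ge0 ?subr_ge0//; first by case/andP: (yn n).
  by rewrite -natr1 addrC lerD2l ler_peMr// exprn_ege1.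
- exact: cvg_cst.
- exact: cvg_harmonic.
Unshelve. all: by end_near. Qed.

End StepPolynomials.

Section FourierInjective.
Context {R : realType}.
Implicit Types (f g : R -> R).
Local Notation mu := (@lebesgue_measure R).

Lemma continuous_scale (a : R) : continuous (fun x : R => a * x).
Proof. by apply: continuous_mul; [exact: cst_continuous|move=> x; exact: cvg_id]. Qed.

Lemma continuous_cosM (a : R) : continuous (fun x : R => cos (a * x)).
Proof.
move=> x; apply: (@continuous_comp _ _ _ (fun x => a * x) cos).
  exact: continuous_scale.
exact: continuous_cos.
Qed.

Lemma continuous_sinM (a : R) : continuous (fun x : R => sin (a * x)).
Proof.
move=> x; apply: (@continuous_comp _ _ _ (fun x => a * x) sin).
  exact: continuous_scale.
exact: continuous_sin.
Qed.

Definition IC f (a : R) : R := tint (fun x => f x * cos (a * x)).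
Definition IS f (a : R) : R := tint (fun x => f x * sin (a * x)).

Lemma tintegrable_cos f (a : R) : tintegrable f ->
  tintegrable (fun x => f x * cos (a * x)).
Proof.
move=> fi; apply: (tintegrableM (M := 1)) => //.
  by apply: continuous_measurable_torus; exact: continuous_cosM.
by move=> x _; exact: cos_max.
Qed.

Lemma tintegrable_sin f (a : R) : tintegrable f ->
  tintegrable (fun x => f x * sin (a * x)).
Proof.
move=> fi; apply: (tintegrableM (M := 1)) => //.
  by apply: continuous_measurable_torus; exact: continuous_sinM.
by move=> x _; exact: sin_max.
Qed.

Lemma IC_cos f (a b : R) : tintegrable f ->
  IC (fun x => f x * cos (b * x)) a = (IC f (a - b) + IC f (a + b)) / 2.
Proof.
move=> fi; rewrite /IC -tintD; [|exact: tintegrable_cos..].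
rewrite mulrC -tintZ; last by apply: tintegrableD; exact: tintegrable_cos.
apply: eq_tint => x _; rewrite mulrBl mulrDl cosB cosD; by field.
Qed.

Lemma IC_sin f (a b : R) : tintegrable f ->
  IC (fun x => f x * sin (b * x)) a = (IS f (a + b) - IS f (a - b)) / 2.
Proof.
move=> fi; rewrite /IC /IS -tintB; [|exact: tintegrable_sin..].
rewrite mulrC -tintZ; last by apply: tintegrableB; exact: tintegrable_sin.
apply: eq_tint => x _; rewrite mulrBl mulrDl sinB sinD; by field.
Qed.

Lemma IS_cos f (a b : R) : tintegrable f ->
  IS (fun x => f x * cos (b * x)) a = (IS f (a - b) + IS f (a + b)) / 2.
Proof.
move=> fi; rewrite /IS -tintD; [|exact: tintegrable_sin..].
rewrite mulrC -tintZ; last by apply: tintegrableD; exact: tintegrable_sin.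
apply: eq_tint => x _; rewrite mulrBl mulrDl sinB sinD; by field.
Qed.

Lemma IS_sin f (a b : R) : tintegrable f ->
  IS (fun x => f x * sin (b * x)) a = (IC f (a - b) - IC f (a + b)) / 2.
Proof.
move=> fi; rewrite /IC /IS -tintB; [|exact: tintegrable_cos..].
rewrite mulrC -tintZ; last by apply: tintegrableB; exact: tintegrable_cos.
apply: eq_tint => x _; rewrite mulrBl mulrDl cosB cosD; by field.
Qed.

Lemma ICN f (a : R) : IC f (- a) = IC f a.
Proof. by apply: eq_tint => x _; rewrite mulNr cosN. Qed.
Lemma ISN f (a : R) : tintegrable f -> IS f (- a) = - IS f a.
Proof.
move=> fi; rewrite /IS -[RHS]mulN1r -tintZ; last exact: tintegrable_sin.
by apply: eq_tint => x _; rewrite mulNr sinN; ring.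
Qed.

Lemma ICD f g (a : R) : tintegrable f -> tintegrable g ->
  IC (fun x => f x + g x) a = IC f a + IC g a.
Proof.
move=> fi gi; rewrite /IC -tintD; [|exact: tintegrable_cos..].
by apply: eq_tint => x _; rewrite mulrDl.
Qed.
Lemma ISD f g (a : R) : tintegrable f -> tintegrable g ->
  IS (fun x => f x + g x) a = IS f a + IS g a.
Proof.
move=> fi gi; rewrite /IS -tintD; [|exact: tintegrable_sin..].
by apply: eq_tint => x _; rewrite mulrDl.
Qed.
Lemma ICZ (c : R) f (a : R) : tintegrable f ->
  IC (fun x => c * f x) a = c * IC f a.
Proof.
move=> fi; rewrite /IC -tintZ; last exact: tintegrable_cos.
by apply: eq_tint => x _; rewrite mulrA.
Qed.
Lemma ISZ (c : R) f (a : R) : tintegrable f ->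
  IS (fun x => c * f x) a = c * IS f a.
Proof.
move=> fi; rewrite /IS -tintZ; last exact: tintegrable_sin.
by apply: eq_tint => x _; rewrite mulrA.
Qed.

Let orth f := tintegrable f /\
  forall k : int, IC f k%:~R = 0 /\ IS f k%:~R = 0.

(* A quarter of the squared chord length: its small values single out an arc. *)
Definition chord (x0 x : R) : R := (1 - cos (x - x0)) / 2.

Lemma chord01 x0 x : 0 <= chord x0 x <= 1.
Proof.
by rewrite /chord; have := cos_geN1 (x - x0); have := cos_le1 (x - x0) => *;
  apply/andP; split; lra.
Qed.

Lemma continuous_chord x0 : continuous (chord x0).
Proof.
have -> : chord x0 = fun x => 2^-1 + (- (2^-1 * cos x0) * cos (1 * x) +
    - (2^-1 * sin x0) * sin (1 * x)).
  by apply/funext => x; rewrite /chord cosB !mul1r; by field.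
apply: continuous_add; first exact: cst_continuous.
apply: continuous_add; apply: continuous_mul; try exact: cst_continuous.
  exact: continuous_cosM.
exact: continuous_sinM.
Qed.

Let orthD f g : orth f -> orth g -> orth (fun x => f x + g x).
Proof.
move=> [fi fo] [gi go]; split; first exact: tintegrableD.
move=> k; rewrite ICD// ISD//; have [-> ->] := fo k; have [-> ->] := go k.
by rewrite addr0.
Qed.

Let orthZ (c : R) f : orth f -> orth (fun x => c * f x).
Proof.
move=> [fi fo]; split; first exact: tintegrableZ.
by move=> k; rewrite ICZ// ISZ//; have [-> ->] := fo k; rewrite mulr0.
Qed.

(** Multiplication by [chord x0] shifts frequencies by at most 1, so vanishing of all coefficients
    is preserved. *)
Let orth_chord f x0 : orth f -> orth (fun x => f x * chord x0 x).
Proof.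
move=> fo; have [fi H] := fo.
have oc : orth (fun x => f x * cos (1 * x)).
  split; first exact: tintegrable_cos.
  move=> k; rewrite IC_cos// IS_cos//.
  have [h1 h2] := H (k + 1); have [h3 h4] := H (k - 1).
  by move: h1 h2 h3 h4; rewrite !rmorphD rmorphN /= => -> -> -> ->; rewrite addr0 mul0r.
have os : orth (fun x => f x * sin (1 * x)).
  split; first exact: tintegrable_sin.
  move=> k; rewrite IC_sin// IS_sin//.
  have [h1 h2] := H (k + 1); have [h3 h4] := H (k - 1).
  by move: h1 h2 h3 h4; rewrite !rmorphD rmorphN /= => -> -> -> ->; rewrite subr0 mul0r.
have := orthD (orthZ 2^-1 fo) (orthD (orthZ (- (2^-1 * cos x0)) oc)
  (orthZ (- (2^-1 * sin x0)) os)).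
congr orth; apply/funext => x; rewrite /chord cosB !mul1r; by field.
Qed.

Let orth_poly f x0 (p : {poly R}) : orth f -> orth (fun x => f x * p.[chord x0 x]).
Proof.
move=> fo; have pw n : orth (fun x => f x * chord x0 x ^+ n).
  elim: n => [|n IH]; first by under eq_fun do rewrite expr0 mulr1.
  by under eq_fun do rewrite exprSr mulrA; exact: orth_chord.
elim/poly_ind: p => [|p c IH].
  have -> : (fun x => f x * (0 : {poly R}).[chord x0 x]) = fun x => 0 * f x.
    by apply/funext => x; rewrite horner0 mulr0 mul0r.
  exact: orthZ.
under eq_fun do rewrite hornerMXaddC mulrDr mulrA (mulrC _ c).
by apply: orthD; [exact: orth_chord|exact: orthZ].
Qed.

(* [f] is orthogonal to every polynomial in [chord x0]; by [cvg_step] such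
   polynomials converge boundedly to the indicator of an arc around [x0]. *)
Lemma arc_integral0 f x0 (K : nat) : orth f ->
  tint (fun x => f x * (if K%:R * chord x0 x < 1 then 1 else 0)) = 0.
Proof.
move=> fo; have [fi _] := fo.
pose q n x : R := (1 - chord x0 x ^+ n) ^+ (n * K ^ n).
have q0 n : tint (fun x => f x * q n x) = 0.
  pose p : {poly R} := (1 - 'X^n) ^+ (n * K ^ n).
  have [gi gH] := orth_poly x0 p fo; have [+ _] := gH 0.
  rewrite /IC => <-; apply: eq_tint => x _.
  by rewrite mul0r cos0 mulr1 /p /q !hornerE.
have q01 n x : 0 <= q n x <= 1.
  have /andP[c0 c1] := chord01 x0 x.
  have h0 : 0 <= chord x0 x ^+ n by exact: exprn_ge0.
  have h1 : chord x0 x ^+ n <= 1 by exact: exprn_ile1.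
  apply/andP; split; first by apply: exprn_ge0; rewrite subr_ge0.
  by apply: exprn_ile1; rewrite ?subr_ge0// gerBl.
have mq n : measurable_fun torus (q n).
  apply: continuous_measurable_torus.
  have -> : q n = fun x => ((1 - 'X^n) ^+ (n * K ^ n)).[chord x0 x].
    by apply/funext => x; rewrite /q !hornerE.
  move=> x; apply: (@continuous_comp _ _ _ (chord x0) (horner _)).
    exact: continuous_chord.
  exact: continuous_horner.
pose g x := f x * (if K%:R * chord x0 x < 1 then 1 else 0).
have cvgq x : f x * q n x @[n --> \oo] --> g x.
  by apply: cvgMr; apply: cvg_step; exact: chord01.
have mfq n : measurable_fun torus (fun x => f x * q n x).
  by apply: measurable_funM => //; exact: tintegrable_measurable.
have mg : measurable_fun torus g.
  by apply: (measurable_fun_cvg mfq) => x _; exact: cvgq.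
have gi : tintegrable g.
  apply: (tintegrable_dom mg (tintegrable_normr fi)) => x _.
  by rewrite /g; case: ifP => _; rewrite ?mulr1// mulr0 normr0.
have [] := @dominated_convergence _ _ _ mu torus measurable_torusR
  (fun n x => (f x * q n x)%:E) (fun x => (g x)%:E) (fun x => (`|f x|)%:E).
- by move=> n; apply/measurable_EFinP; exact: mfq.
- by apply/measurable_EFinP; exact: mg.
- by apply: aeW => x _; apply: cvg_EFin; [exact: nearW|exact: cvgq].
- exact: tintegrable_normr.
- apply: aeW => x n _; rewrite lee_fin normrM ler_piMr//.
  by rewrite ger0_norm; case/andP: (q01 n x).
move=> _ _ h; have E : (fun n => \int[mu]_(x in torus) (f x * q n x)%:E)%E = fun=> 0%E.
  apply/funext => n; rewrite tint_EFin ?q0//.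
  by apply: (tintegrableM (M := 1)) => // x _; rewrite ger0_norm; case/andP: (q01 n x).
move: h; rewrite E => h; have := cvg_unique (@ereal_hausdorff R) h (cvg_cst _).
by rewrite tint_EFin// => /(_ _ _) /eqP; rewrite eqe => /eqP.
Qed.

(** The relation between d and K puts the threshold 1 / K of the chord at distance d. The bound by 2
    pi - d excludes points that are close to x0 only around the circle. *)
Lemma chord_arc (x0 x d : R) (K : nat) : 0 < d <= pi -> cos d = 1 - 2 / K%:R ->
  (0 < K)%N -> `|x - x0| <= pi *+ 2 - d ->
  (K%:R * chord x0 x < 1) = (`|x - x0| < d).
Proof.
move=> /andP[d0 dpi] cosd K0 xd; have KR : (0 : R) < K%:R by rewrite ltr0n.
have -> : (K%:R * chord x0 x < 1) = (cos d < cos `|x - x0|).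
  rewrite cos_norm cosd /chord ltrBlDr -ltrBlDl ltr_pdivlMr//.
  by apply/idP/idP => h; lra.
set y := `|x - x0|; have y0 : 0 <= y by exact: normr_ge0.
have [yd|dy] := ltP y d.
  by rewrite ltr_cos// in_itv/= ?y0 ?(ltW d0)//=; lra.
apply/negbTE; rewrite -leNgt; have [ypi|piy] := leP y pi.
  by rewrite leNgt ltr_cos ?in_itv/= ?y0 ?(ltW d0)//= -leNgt.
have -> : cos y = cos (pi *+ 2 - y).
  by rewrite -cosN -[LHS]cosD2pi addrC.
by rewrite leNgt ltr_cos ?in_itv/= ?(ltW d0)//= -?leNgt; move: xd; rewrite -/y mulr2n; lra.
Qed.

(** K has to be an integer because it enters an exponent, so the admissible radii acos (1 - 2 / K)
    form a sequence; it tends to 0. *)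
Lemma small_arc (e : R) : 0 < e -> exists d K,
  [/\ 0 < d <= pi, d < e, (0 < K)%N & cos d = 1 - 2 / (K%:R : R)].
Proof.
move=> e0; pose e' := Num.min e pi.
have e'0 : 0 < e' by rewrite lt_min e0 pi_gt0.
have e'pi : e' <= pi by rewrite ge_min lexx orbT.
have ce : cos e' < 1 by rewrite -cos0 ltr_cos ?in_itv/= ?lexx ?pi_ge0 ?(ltW e'0).
pose K := (Num.truncn (2 / (1 - cos e'))).+1.
have K0 : (0 : R) < K%:R by rewrite ltr0n.
have hK : 2 / (1 - cos e') < K%:R by exact: truncnS_gt.
have c1 : cos e' < 1 - 2 / K%:R.
  have : 2 / K%:R < 1 - cos e'.
    by rewrite ltr_pdivrMr//; move: hK; rewrite ltr_pdivrMr; lra.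
  by lra.
have c2 : 1 - 2 / K%:R < 1 :> R by rewrite gtrBl divr_gt0.
have cm := cos_geN1 e'.
exists (acos (1 - 2 / K%:R)), K; split => //.
- by rewrite acos_gt0 ?acos_lepi//; apply/andP; split; lra.
- apply: (@lt_le_trans _ _ e'); last by rewrite ge_min lexx.
  rewrite -ltr_cos ?in_itv/= ?acosK ?in_itv/=//.
  + by apply/andP; split; lra.
  + by rewrite acos_ge0 ?acos_lepi//; apply/andP; split; lra.
  + by rewrite (ltW e'0).
- by rewrite acosK// in_itv/=; apply/andP; split; lra.
Qed.

(** When F has mean zero on the ball, the mean of F - F x0 is - F x0, and the mean of its absolute
    value is at least |F x0|. *)
Lemma davg_ge (F : R -> R) x0 (r : R) : 0 < r ->
  mu.-integrable (ball x0 r) (EFin \o F) ->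
  \int[mu]_(y in ball x0 r) F y = 0 ->
  (`|F x0|%:E <= davg F x0 r)%E.
Proof.
move=> r0 Fi F0.
have mb : (@measurable _ (measurableTypeR R)) (ball x0 r) by exact: measurable_ball.
have mub : mu (ball x0 r) = (r *+ 2)%:E by rewrite lebesgue_measure_ball ?ltW.
have mubty : (mu (ball x0 r) < +oo)%E by rewrite mub ltry.
have ci : mu.-integrable (ball x0 r) (EFin \o (fun=> F x0)).
  apply: measurable_bounded_integrable => //.
  by exists `|F x0|; split; [exact: num_real|move=> y My x _; exact: ltW].
have di : mu.-integrable (ball x0 r) (EFin \o (fun y => F y - F x0)).
  by have := integrableB mb Fi ci; exact.
rewrite /davg /iavg mub inver mulrn_eq0/= gt_eqF//.
have : `|\int[mu]_(y in ball x0 r) (F y - F x0)|%:E = (r *+ 2 * `|F x0|)%:E.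
  have Ec : \int[mu]_(y in ball x0 r) F x0 = F x0 * (r *+ 2).
    transitivity (F x0 * fine (mu (ball x0 r))); last by rewrite mub.
    exact: Rintegral_cst.
  rewrite RintegralB// F0 sub0r normrN Ec normrM mulrC.
  by rewrite (gtr0_norm (_ : 0 < r *+ 2))// pmulrn_lgt0.
rewrite EFin_normr_Rintegral// => h.
have : ((r *+ 2 * `|F x0|)%:E <= \int[mu]_(y in ball x0 r) `|(center (F x0) \o F) y|%:E)%E.
  rewrite -h; apply: le_trans (le_abse_integral _ _ _) _ => //.
  by case/integrableP: di.
move=> /(@lee_wpmul2l _ (r *+ 2)^-1%:E _); rewrite lee_fin => /(_ _).
rewrite -EFinM mulrA mulVf ?mul1r ?mulrn_eq0 ?gt_eqF//; apply.
by rewrite invr_ge0 mulrn_wge0// ltW.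
Qed.

(** At a Lebesgue point x the averages of |f - f x| over small arcs tend to 0. The integrals of f
    over arcs vanish, so by [davg_ge] these averages are at least |f x|. *)
Lemma orth_ae0 f : orth f -> ae_eq mu torus f (fun=> 0).
Proof.
move=> fo; have [fi _] := fo.
have := lebesgue_differentiation (integrable_locally measurable_torusR fi).
have bd : {ae mu, forall x : R, x != - pi /\ x != pi}.
  exists [set - pi; pi]; split.
  - by apply: measurableU; exact: measurable_set1.
  - by apply: countable_lebesgue_measure0; apply: finite_set_countable; exact: finite_set2.
  move=> x /= /not_andP[] /negP; rewrite negbK => /eqP ->; [by left|by right].
move=> leb; apply: (@filterS2 _ _ (ae_filter_ringOfSetsType mu) _ _ _ _ bd leb) => x [xN xp] Lx tx.
move: (tx); rewrite /torus /= in_itv/= => /andP[tx1 tx2].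
have x1 : - pi < x by rewrite lt_def xN.
have x2 : x < pi by rewrite lt_def eq_sym xp.
set F := f \_ torus in Lx.
have Fx : F x = f x by rewrite /F patchE mem_set.
apply/eqP; rewrite -normr_le0; apply/ler_addgt0Pl => e e0; rewrite addr0.
have := Lx _ (open_nbhs_nbhs (conj (@open_ereal_lt_ereal R e%:E) (_ : (0 < e%:E)%E))).
rewrite lte_fin => /(_ e0) /nbhs_ballP[e2 /= e20 he].
(* A radius below pi - |x| keeps the arc inside ]- pi, pi[; this is why the two endpoints were
   discarded. *)
have [d [K [/andP[d0 dpi] dm K0 cosd]]] : exists d K,
    [/\ 0 < d <= pi, d < Num.min e2 (pi - `|x|), (0 < K)%N & cos d = 1 - 2 / (K%:R : R)].
  apply: small_arc; rewrite lt_min e20 subr_gt0 ltr_norml x2 andbT.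
  by rewrite ltrNl; lra.
move: dm; rewrite lt_min => /andP[de2 dx].
have davge : (davg F x d < e%:E)%E.
  by apply: he => //; rewrite /ball/= sub0r normrN gtr0_norm.
have xb : `|x| < pi by lra.
have bt : ball x d `<=` torus.
  move=> y; rewrite /ball /= => xy; rewrite /torus /= in_itv /= -ler_norml.
  have : `|y| <= `|x| + `|x - y|.
    by rewrite -[y in leLHS](subKr x) (le_trans (ler_normB _ _)).
  by lra.
have mb : (@measurable _ (measurableTypeR R)) (ball x d) by exact: measurable_ball.
have Fb y : ball x d y -> F y = f y by move=> /bt ty; rewrite /F patchE mem_set.
have fib : mu.-integrable (ball x d) (EFin \o f).
  exact: integrableS fi.
have Fi : mu.-integrable (ball x d) (EFin \o F).
  by apply: eq_integrable fib => // y /[!inE] yb /=; rewrite Fb.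
have F0 : \int[mu]_(y in ball x d) F y = 0.
  rewrite -(arc_integral0 x K fo) /tint.
  transitivity (\int[mu]_(y in torus `&` ball x d) f y).
    rewrite setIidr//; apply: eq_Rintegral => y /[!inE]; exact: Fb.
  rewrite Rintegral_mkcondr; apply: eq_Rintegral => y /[!inE] ty.
  have -> : (K%:R * chord x y < 1) = (`|y - x| < d).
    apply: chord_arc => //; first by rewrite d0.
    have : `|y - x| <= `|y| + `|x| by exact: ler_normB.
    have : `|y| <= pi by move: ty; rewrite /torus /= in_itv /= -ler_norml.
    by rewrite mulr2n; lra.
  rewrite patchE distrC; case: ifPn => [/set_mem|yb].
    by rewrite /ball /= => ->; rewrite mulr1.
  by rewrite ifF ?mulr0//; apply/negbTE; apply: contra yb => xy; apply/mem_set.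
have := le_lt_trans (davg_ge d0 Fi F0) davge.
by rewrite Fx lte_fin => /ltW.
Qed.

End FourierInjective.

Section FourierCoefficients.
Context {R : realType}.
Implicit Types (f g : R -> R).
Local Notation mu := (@lebesgue_measure R).

Lemma Re_fourier f k : complex.Re (fourier f k) = (pi *+ 2)^-1 * IC f k%:~R.
Proof. by []. Qed.

Lemma Im_fourier f k : complex.Im (fourier f k) = - ((pi *+ 2)^-1 * IS f k%:~R).
Proof. by []. Qed.

Lemma IC_fourier f k : IC f k%:~R = (pi *+ 2) * complex.Re (fourier f k).
Proof. by rewrite Re_fourier mulrA mulfV ?mul1r// gt_eqF// pi2_gt0. Qed.

Lemma IS_fourier f k : IS f k%:~R = - ((pi *+ 2) * complex.Im (fourier f k)).
Proof. by rewrite Im_fourier mulrN opprK mulrA mulfV ?mul1r// gt_eqF// pi2_gt0. Qed.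

Lemma fourierD f g k : tintegrable f -> tintegrable g ->
  fourier (fun x => f x + g x) k = fourier f k + fourier g k.
Proof.
move=> fi gi; apply: complex_ext; rewrite ?cReD ?cImD !(Re_fourier, Im_fourier) ?ICD ?ISD//.
  by rewrite mulrDr.
by rewrite mulrDr opprD.
Qed.

Lemma fourierZ (c : R) f k : tintegrable f ->
  fourier (fun x => c * f x) k = c%:C%C * fourier f k.
Proof.
move=> fi; apply: complex_ext; rewrite ?cReZ ?cImZ !(Re_fourier, Im_fourier) ?ICZ ?ISZ//.
  by rewrite mulrCA.
by rewrite mulrCA mulrN.
Qed.

Lemma fourierB f g k : tintegrable f -> tintegrable g ->
  fourier (fun x => f x - g x) k = fourier f k - fourier g k.
Proof.
move=> fi gi; have := fourierD k fi (tintegrableZ (-1) gi).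
under [in LHS]eq_fun do rewrite mulN1r.
move=> ->; rewrite fourierZ//; congr (_ + _).
by apply: complex_ext; rewrite ?cReZ ?cImZ ?cReN ?cImN mulN1r.
Qed.

Lemma fourier_opp f k : tintegrable f -> fourier f (- k) = (fourier f k)^*%C.
Proof.
move=> fi; apply: complex_ext.
  by rewrite Re_fourier mulrNz ICN; case: (fourier f k) (Re_fourier f k) => a b /= ->.
rewrite Im_fourier mulrNz ISN// mulrN opprK.
by case: (fourier f k) (Im_fourier f k) => a b /= ->; rewrite opprK.
Qed.

Lemma fourier_injective f g : tintegrable f -> tintegrable g ->
  (forall n : nat, fourier f n = fourier g n) -> eq_torus f g.
Proof.
move=> fi gi fg.
have fgk k : fourier f k = fourier g k.
  by case: (intP k) => [|n|n]; rewrite ?fourier_opp// fg.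
have o : tintegrable (fun x => f x - g x) /\ forall k : int,
    IC (fun x => f x - g x) k%:~R = 0 /\ IS (fun x => f x - g x) k%:~R = 0.
  split; first exact: tintegrableB.
  by move=> k; rewrite IC_fourier IS_fourier fourierB// fgk subrr mulr0 oppr0.
have := orth_ae0 o; apply: filterS => x /= h tx.
by apply/eqP; rewrite -subr_eq0; apply/eqP; exact: h.
Qed.

Lemma fourier_ae f g k : tintegrable f -> measurable_fun torus g -> eq_torus f g ->
  fourier f k = fourier g k.
Proof.
move=> fi mg fg.
have ae h : ae_eq mu torus (fun x => f x * h x) (fun x => g x * h x).
  by apply: filterS fg => x /= H tx; rewrite H.
apply: complex_ext; rewrite !(Re_fourier, Im_fourier);
  [congr (_ * _)|congr (- (_ * _))].
  rewrite /IC; apply: tint_ae_eq => //; first exact: tintegrable_cos.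
  by apply: measurable_funM => //; apply: continuous_measurable_torus; exact: continuous_cosM.
rewrite /IS; apply: tint_ae_eq => //; first exact: tintegrable_sin.
by apply: measurable_funM => //; apply: continuous_measurable_torus; exact: continuous_sinM.
Qed.

End FourierCoefficients.

(** * Trigonometric series *)

Section TrigonometricPolynomials.
Context {R : realType}.
Implicit Types (f g : R -> R) (w : nat -> R[i]).
Local Notation mu := (@lebesgue_measure R).

Lemma sin_natpi n : sin (n%:R * pi : R) = 0.
Proof.
elim: n => [|n IH]; first by rewrite mul0r sin0.
by rewrite -natr1 mulrDl mul1r sinDpi IH oppr0.
Qed.

Lemma sin_intpi (k : int) : sin (k%:~R * pi : R) = 0.
Proof.
by case: (intP k) => [|n|n]; rewrite ?mulrNz ?mulNr ?sinN ?sin_natpi ?oppr0// mul0r sin0.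
Qed.

Lemma tint_deriv (F f : R -> R) : (forall t, has_deriv F t (f t)) -> continuous f ->
  tint f = F pi - F (- pi).
Proof.
move=> dF cf; have pp : - pi < pi :> R by rewrite gtrN// pi_gt0.
have := @continuous_FTC2 R f F (- pi) pi pp.
have cF : continuous F by move=> t; exact: deriv_continuous (dF t).
move=> H; apply: EFin_inj; rewrite -tint_EFin; last exact: tintegrable_continuous.
rewrite /torus H ?EFinB//.
- exact: continuous_subspaceT.
- split.
  + by move=> x _; have := dF x; rewrite /has_deriv => ?; exact: ex_derive.
  + by apply: cvg_at_right_filter; exact: cF.
  + by apply: cvg_at_left_filter; exact: cF.
- by move=> x _; rewrite derive1E; have := dF x; rewrite /has_deriv => ?; exact: derive_val.
Qed.

Lemma IC1 (k : int) : IC (fun=> 1 : R) k%:~R = if k == 0 then pi *+ 2 else 0.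
Proof.
rewrite /IC; under eq_fun do rewrite mul1r.
case: eqVneq => [->|k0].
  under eq_fun do rewrite mul0r cos0.
  by rewrite tint_cst mul1r.
have kR : (k%:~R : R) != 0 by rewrite intr_eq0.
rewrite (@tint_deriv (fun x => k%:~R^-1 * sin (k%:~R * x))).
- by rewrite mulrN sinN sin_intpi oppr0 subrr.
- move=> t; apply: deriv_eq.
    apply: deriv_scale; apply: (deriv_comp (f := sin) (g := fun x => k%:~R * x)).
      exact: deriv_sin.
    exact: (deriv_scale _ (deriv_id t)).
  by rewrite mulr1; field.
- exact: continuous_cosM.
Qed.

Lemma IS1 (k : int) : IS (fun=> 1 : R) k%:~R = 0.
Proof.
rewrite /IS; under eq_fun do rewrite mul1r.
have [->|k0] := eqVneq k 0.
  under eq_fun do rewrite mul0r sin0.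
  by rewrite tint_cst mul0r.
have kR : (k%:~R : R) != 0 by rewrite intr_eq0.
rewrite (@tint_deriv (fun x => - k%:~R^-1 * cos (k%:~R * x))).
- by rewrite mulrN cosN subrr.
- move=> t; apply: deriv_eq.
    apply: deriv_scale; apply: (deriv_comp (f := cos) (g := fun x => k%:~R * x)).
      exact: deriv_cos.
    exact: (deriv_scale _ (deriv_id t)).
  by rewrite mulr1; field.
- exact: continuous_sinM.
Qed.

(** Re (z e^(ikx)). *)
Definition tmode (z : R[i]) (k : nat) (x : R) : R :=
  complex.Re z * cos (k%:R * x) - complex.Im z * sin (k%:R * x).
Definition tpoly (n : nat) w (x : R) : R := \sum_(k < n) tmode (w k) k x.

(** Number of frequencies among k and -k, which a real function carries with conjugate
    coefficients. *)
Definition kap (k : nat) : R := if k == 0%N then 1 else 2.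
(* With this normalisation [f = Re (\sum_k fc f k e^{ikx})], summing over k >= 0. *)
Definition fc f (k : nat) : R[i] := (kap k)%:C%C * fourier f k.

Lemma kap_gt0 k : 0 < kap k.
Proof. by rewrite /kap; case: ifP. Qed.

Lemma kap_le2 k : kap k <= 2.
Proof. by rewrite /kap; case: ifP => // _; lra. Qed.

Lemma tmode_continuous z k : continuous (tmode z k).
Proof.
have -> : tmode z k = fun x => complex.Re z * cos (k%:R * x) +
    (- complex.Im z) * sin (k%:R * x).
  by apply/funext => x; rewrite /tmode mulNr.
apply: continuous_add; apply: continuous_mul; try exact: cst_continuous.
  exact: continuous_cosM.
exact: continuous_sinM.
Qed.

Lemma tmode_periodic z k : periodic (tmode z k) (pi *+ 2).
Proof.
move=> x; rewrite /tmode mulrDr.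
have -> : k%:R * (pi *+ 2) = pi *+ 2 *+ k :> R by rewrite mulr_natl.
by rewrite (periodicn (@cosD2pi R)) (periodicn (@sinD2pi R)).
Qed.

Lemma tpoly_continuous n w : continuous (tpoly n w).
Proof.
by apply: (@continuous_sum _ n (fun k => tmode (w k) k)) => k; exact: tmode_continuous.
Qed.

Lemma tpoly_periodic n w : periodic (tpoly n w) (pi *+ 2).
Proof. by move=> x; apply: eq_bigr => k _; exact: tmode_periodic. Qed.

Lemma tpoly_L2 n w : L2_torus (tpoly n w).
Proof. by apply: L2_continuous; [exact: tpoly_periodic|exact: tpoly_continuous]. Qed.

Lemma tmode_integrable z k : tintegrable (tmode z k).
Proof. by apply: tintegrable_continuous; exact: tmode_continuous. Qed.

Lemma IC_tmode z (j k : nat) : IC (tmode z j) k%:R =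
  if j == k then pi *+ 2 / kap k * complex.Re z else 0.
Proof.
have i1 : tintegrable (fun=> 1 : R) by exact: tintegrable_cst.
have ic := tintegrable_cos j%:R i1; have isn := tintegrable_sin j%:R i1.
have -> : tmode z j = fun x => complex.Re z * (1 * cos (j%:R * x)) +
    - complex.Im z * (1 * sin (j%:R * x)).
  by apply/funext => x; rewrite /tmode !mul1r mulNr.
rewrite ICD; [|exact: tintegrableZ..].
rewrite (ICZ _ k%:R ic) (ICZ _ k%:R isn).
rewrite (IC_cos k%:R j%:R i1) (IC_sin k%:R j%:R i1).
have e1 : (k%:R + j%:R : R) = (k%:Z + j%:Z)%:~R by rewrite rmorphD.
have e2 : (k%:R - j%:R : R) = (k%:Z - j%:Z)%:~R by rewrite rmorphB.
have e3 : (k%:Z + j%:Z == 0) = ((k == 0%N) && (j == 0%N)) by lia.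
have e4 : (k%:Z - j%:Z == 0) = (j == k) by lia.
rewrite e1 e2 !IC1 !IS1 subr0 mul0r mulr0 addr0 e3 e4 /kap.
case: eqVneq => [->|jk].
  by rewrite andbb; case: ifP => _; field.
by rewrite ifF ?addr0 ?mul0r ?mulr0//; apply/negP => /andP[/eqP k0 /eqP j0]; rewrite k0 j0 eqxx in jk.
Qed.

Lemma IS_tmode z (j k : nat) : IS (tmode z j) k%:R =
  if (j == k) && (k != 0)%N then - (pi *+ 2 / kap k * complex.Im z) else 0.
Proof.
have i1 : tintegrable (fun=> 1 : R) by exact: tintegrable_cst.
have ic := tintegrable_cos j%:R i1; have isn := tintegrable_sin j%:R i1.
have -> : tmode z j = fun x => complex.Re z * (1 * cos (j%:R * x)) +
    - complex.Im z * (1 * sin (j%:R * x)).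
  by apply/funext => x; rewrite /tmode !mul1r mulNr.
rewrite ISD; [|exact: tintegrableZ..].
rewrite (ISZ _ k%:R ic) (ISZ _ k%:R isn).
rewrite (IS_cos k%:R j%:R i1) (IS_sin k%:R j%:R i1).
have e1 : (k%:R + j%:R : R) = (k%:Z + j%:Z)%:~R by rewrite rmorphD.
have e2 : (k%:R - j%:R : R) = (k%:Z - j%:Z)%:~R by rewrite rmorphB.
have e3 : (k%:Z + j%:Z == 0) = ((k == 0%N) && (j == 0%N)) by lia.
have e4 : (k%:Z - j%:Z == 0) = (j == k) by lia.
rewrite e1 e2 !IC1 !IS1 addr0 mul0r mulr0 add0r e3 e4 /kap.
case: eqVneq => [->|jk]/=.
  by rewrite andbb; case: ifP => _ /=; [rewrite subrr mul0r mulr0|field].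
by rewrite ifF ?subr0 ?mul0r ?mulr0//; apply/negP => /andP[/eqP k0 /eqP j0]; rewrite k0 j0 eqxx in jk.
Qed.

Lemma Re_fc f k : complex.Re (fc f k) = kap k / (pi *+ 2) * IC f k%:R.
Proof. by rewrite /fc cReZ Re_fourier mulrA. Qed.

Lemma Im_fc f k : complex.Im (fc f k) = - (kap k / (pi *+ 2) * IS f k%:R).
Proof. by rewrite /fc cImZ Im_fourier mulrN mulrA. Qed.

Lemma Im_fc0 f : complex.Im (fc f 0) = 0.
Proof.
rewrite Im_fc /IS (eq_tint (g := fun=> 0)); first by rewrite tint_cst mul0r mulr0 oppr0.
by move=> x _; rewrite mul0r sin0 mulr0.
Qed.

Lemma IC_fc f k : IC f k%:R = pi *+ 2 / kap k * complex.Re (fc f k).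
Proof.
rewrite Re_fc; move: (pi *+ 2) (@pi2_gt0 R) => P P0; field.
by rewrite !gt_eqF// kap_gt0.
Qed.

Lemma IS_fc f k : IS f k%:R = - (pi *+ 2 / kap k * complex.Im (fc f k)).
Proof.
rewrite Im_fc; move: (pi *+ 2) (@pi2_gt0 R) => P P0; field.
by rewrite !gt_eqF// kap_gt0.
Qed.

Lemma fcD f g k : tintegrable f -> tintegrable g ->
  fc (fun x => f x + g x) k = fc f k + fc g k.
Proof. by move=> fi gi; rewrite /fc fourierD// mulrDr. Qed.

Lemma fcB f g k : tintegrable f -> tintegrable g ->
  fc (fun x => f x - g x) k = fc f k - fc g k.
Proof. by move=> fi gi; rewrite /fc fourierB// mulrBr. Qed.

Lemma fcZ (c : R) f k : tintegrable f -> fc (fun x => c * f x) k = c%:C%C * fc f k.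
Proof. by move=> fi; rewrite /fc fourierZ// mulrCA. Qed.

Lemma fc_sum n (F : nat -> R -> R) k : (forall j, tintegrable (F j)) ->
  fc (fun x => \sum_(j < n) F j x) k = \sum_(j < n) fc (F j) k.
Proof.
move=> Fi; elim: n => [|n IH].
  under eq_fun do rewrite big_ord0; rewrite big_ord0 /fc.
  apply: complex_ext; rewrite ?cReZ ?cImZ ?Re_fourier ?Im_fourier /IC /IS.
    by under eq_fun do rewrite mul0r; rewrite tint_cst mul0r !mulr0.
  by under eq_fun do rewrite mul0r; rewrite tint_cst mul0r !(mulr0, oppr0).
under eq_fun do rewrite big_ord_recr /=.
by rewrite fcD ?IH ?big_ord_recr//; exact: tintegrable_sum.
Qed.

Lemma fc_tmode z j k : (j = 0%N -> complex.Im z = 0) ->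
  fc (tmode z j) k = if j == k then z else 0.
Proof.
move=> z0; have K := kap_gt0 k; have P := @pi2_gt0 R.
apply: complex_ext; rewrite ?Re_fc ?Im_fc ?IC_tmode ?IS_tmode;
  move: (pi *+ 2) P => P P0.
  by case: eqVneq => _; [field; rewrite !gt_eqF|rewrite mulr0].
case: eqVneq => [jk|_] /=; last by rewrite mulr0 oppr0.
case: eqVneq => [k0|_]; first by rewrite mulr0 oppr0 z0// jk.
by rewrite mulrN opprK; field; rewrite !gt_eqF.
Qed.

Lemma fc_tpoly n w k : complex.Im (w 0%N) = 0 ->
  fc (tpoly n w) k = if (k < n)%N then w k else 0.
Proof.
move=> w0; rewrite (@fc_sum n (fun j => tmode (w j) j)); last first.
  by move=> j; exact: tmode_integrable.
rewrite (eq_bigr (fun j : 'I_n => if (j == k :> nat) then w j else 0)); last first.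
  by move=> j _; rewrite fc_tmode// => ->.
case: ltnP => kn; last first.
  by apply: big1 => j _; case: eqVneq => // E; rewrite -E leqNgt ltn_ord in kn.
rewrite (bigD1 (Ordinal kn))//= eqxx big1 ?addr0// => j jk.
by rewrite ifF//; apply/negbTE.
Qed.

(** The exact identity has a factor 1 / kap k in each term; it is dropped, which leaves an upper
    bound. *)
Lemma nsq_tpoly_le n w : complex.Im (w 0%N) = 0 ->
  nsq (tpoly n w) <= pi *+ 2 * \sum_(k < n) csq (w k).
Proof.
move=> w0; rewrite /nsq.
have Ti := L2_integrable (tpoly_L2 n w).
have -> : tint (fun x => tpoly n w x ^+ 2) = \sum_(k < n)
   (complex.Re (w k) * IC (tpoly n w) k%:R - complex.Im (w k) * IS (tpoly n w) k%:R).
  transitivity (tint (fun x => \sum_(k < n) tpoly n w x * tmode (w k) k x)).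
    by apply: eq_tint => x _; rewrite expr2 -mulr_sumr.
  rewrite (@tint_sum _ n (fun k x => tpoly n w x * tmode (w k) k x)); last first.
    move=> k; apply: tintegrable_continuous; apply: continuous_mul.
      exact: tpoly_continuous.
    exact: tmode_continuous.
  apply: eq_bigr => k _; rewrite /IC /IS -!tintZ; [|exact: tintegrable_sin|exact: tintegrable_cos].
  rewrite -tintB; [|by apply: tintegrableZ; exact: tintegrable_cos|by apply: tintegrableZ; exact: tintegrable_sin].
  by apply: eq_tint => x _; rewrite /tmode; ring.
rewrite mulr_sumr; apply: ler_sum => k _.
rewrite IC_fc IS_fc fc_tpoly// ltn_ord.
have K := kap_gt0 k; move: (pi *+ 2) (@pi2_gt0 R) => P P0.
have -> : complex.Re (w k) * (P / kap k * complex.Re (w k)) -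
   complex.Im (w k) * - (P / kap k * complex.Im (w k)) =
   (P * csq (w k)) / kap k by rewrite /csq; field; rewrite gt_eqF.
rewrite ler_pdivrMr// ler_peMr ?mulr_ge0 ?csq_ge0 ?(ltW P0)//.
by rewrite /kap; case: ifP => // _; lra.
Qed.

Lemma tmode_le z k x : `|tmode z k x| <= cabs z.
Proof.
have -> : tmode z k x = cdot z (Complex (cos (k%:R * x)) (- sin (k%:R * x))).
  by rewrite /tmode /cdot /= mulrN.
apply: (le_trans (ler_cdot_cabs _ _)).
by rewrite /cabs [X in _ * Num.sqrt X](_ : _ = 1) ?sqrtr1 ?mulr1// /csq /= sqrrN cos2Dsin2.
Qed.

End TrigonometricPolynomials.

Section SeriesTails.
Context {R : realType}.

Lemma tail_small (a : nat -> R) (C : R) : (forall k, 0 <= a k) ->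
  (forall n, \sum_(k < n) a k <= C) ->
  forall e, 0 < e -> exists N, forall n m, (N <= n)%N ->
    \sum_(k < m) a k - \sum_(k < n) a k <= e.
Proof.
move=> a0 aC e e0; pose S := [set \sum_(k < n) a k | n in [set: nat]].
have hS : has_sup S.
  split; first by exists (\sum_(k < 0) a k); exists 0%N.
  by exists C => _ [n _ <-].
have [_ [N _ <-] hN] := sup_adherent e0 hS.
exists N => n m Nn.
have h1 : \sum_(k < m) a k <= sup S by apply: sup_upper_bound => //; exists m.
have h2 := ler_sum_ord_prefix a0 Nn.
lra.
Qed.

End SeriesTails.

(** * Functions with prescribed Fourier coefficients *)

Section RieszFischer.
Context {R : realType}.
Implicit Types (f g : R -> R) (w : nat -> R[i]).
Local Notation mu := (@lebesgue_measure R).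

Lemma ae_imp (P Q : R -> Prop) : (forall x, P x -> Q x) ->
  {ae mu, forall x, P x} -> {ae mu, forall x, Q x}.
Proof. by move=> PQ; apply: (@filterS _ _ (ae_filter_ringOfSetsType mu)). Qed.

Lemma limn_einf_le (u : (\bar R)^nat) (B : \bar R) :
  (forall n, (u n <= B)%E) -> (limn_einf u <= B)%E.
Proof.
move=> uB; rewrite limn_einf_lim; apply: lime_le; first exact: is_cvg_einfs.
apply: nearW => n; apply: le_trans (uB n); apply: ereal_inf_lbound.
by exists n => /=.
Qed.

Lemma nneseries_le (u : nat -> \bar R) (B : \bar R) : (forall n, (0 <= u n)%E) ->
  (forall n, (\sum_(0 <= k < n) u k <= B)%E) -> (\sum_(k <oo) u k <= B)%E.
Proof.
move=> u0 uB; apply: lime_le; last exact: nearW.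
by apply: is_cvg_nneseries => n _ _; exact: u0.
Qed.

Lemma fatou_nsq (f : nat -> R -> R) (F : R -> R) (B : R) :
  (forall m, L2_torus (f m)) -> (forall m, nsq (f m) <= B) ->
  periodic F (pi *+ 2) -> measurable_fun setT F ->
  {ae mu, forall x, torus x -> f m x @[m --> \oo] --> F x} ->
  L2_torus F /\ nsq F <= B.
Proof.
move=> fL fB pF mF fF.
have mFt : measurable_fun torus F by exact: measurable_funS mF.
have mfm m : @measurable_fun _ _ (measurableTypeR R) _ torus
    (fun x => (f m x ^+ 2)%:E : \bar R).
  by apply/measurable_EFinP; apply: measurable_funX; exact: L2_measurable (fL m).
have mF2 : @measurable_fun _ _ (measurableTypeR R) _ torus (fun x => (F x ^+ 2)%:E : \bar R).
  by apply/measurable_EFinP; exact: measurable_funX.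
have H : (\int[mu]_(x in torus) (F x ^+ 2)%:E <= B%:E)%E.
  have -> : (\int[mu]_(x in torus) (F x ^+ 2)%:E =
     \int[mu]_(x in torus) limn_einf (fun m => (f m x ^+ 2)%:E))%E.
    apply: ae_eq_integral => //.
      apply: measurableT_comp => //.
      by apply: measurable_fun_limn_esup => m; exact: measurableT_comp.
    apply: (ae_imp _ fF) => x /= h tx; have {}h := h tx.
    have c : (f m x ^+ 2)%:E @[m --> \oo] --> (F x ^+ 2)%:E.
      apply: cvg_EFin; first exact: nearW.
      by under eq_fun do rewrite /= expr2; rewrite expr2; exact: cvgM.
    by have [-> _] := cvg_limn_einf_sup c.
  apply: le_trans (fatou _ _ _ _) _ => //.
    by move=> n x _; rewrite lee_fin sqr_ge0.
  apply: limn_einf_le => m.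
  rewrite tint_EFin; last exact: L2_sq_integrable.
  by rewrite lee_fin; exact: fB.
have FL : L2_torus F.
  by split => //; apply: le_lt_trans H _; rewrite ltry.
by split => //; rewrite -lee_fin -l2_sqnormE.
Qed.

Definition trunc_below n w k : R[i] := if (k < n)%N then 0 else w k.

Lemma tpoly_sub n m w x : (n <= m)%N ->
  tpoly m w x - tpoly n w x = tpoly m (trunc_below n w) x.
Proof.
move=> nm; rewrite /tpoly (big_ord_widen m (fun k => tmode (w k) k x) nm).
rewrite [in X in _ - X]big_mkcond /= -sumrB; apply: eq_bigr => k _.
rewrite /trunc_below; case: ifP => _; last by rewrite subr0.
by rewrite subrr /tmode /= !mul0r subrr.
Qed.

Lemma sum_trunc_below (a : R[i] -> R) n m w : a 0 = 0 -> (n <= m)%N ->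
  \sum_(k < m) a (trunc_below n w k) =
  \sum_(k < m) a (w k) - \sum_(k < n) a (w k).
Proof.
move=> a0 nm; rewrite (big_ord_widen m (fun k => a (w k)) nm).
rewrite [in X in _ - X]big_mkcond /= -sumrB; apply: eq_bigr => k _.
by rewrite /trunc_below; case: ifP => _; rewrite ?subr0// a0 subrr.
Qed.

Lemma nsq_tpoly_sub n m w : complex.Im (w 0%N) = 0 -> (n <= m)%N ->
  nsq (fun x => tpoly m w x - tpoly n w x) <=
  pi *+ 2 * (\sum_(k < m) csq (w k) - \sum_(k < n) csq (w k)).
Proof.
move=> w0 nm; under eq_fun do rewrite tpoly_sub//.
rewrite -(sum_trunc_below w (@csq0 R) nm); apply: nsq_tpoly_le.
by rewrite /trunc_below; case: ifP.
Qed.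

Lemma tint_abs_le f (r : R) : L2_torus f -> 0 < r ->
  tint (fun x => `|f x|) <= (r^-1 * nsq f + r * (pi *+ 2)) / 2.
Proof.
move=> fL r0; have fi := L2_sq_integrable fL.
have -> : r * (pi *+ 2) = tint (fun=> r) by rewrite tint_cst.
rewrite mulrC /nsq -tintZ// -tintD; [|exact: tintegrableZ|exact: tintegrable_cst].
rewrite -tintZ; last by apply: tintegrableD; [exact: tintegrableZ|exact: tintegrable_cst].
apply: le_tint.
- by apply: tintegrable_normr; exact: L2_integrable.
- by apply: tintegrableZ; apply: tintegrableD; [exact: tintegrableZ|exact: tintegrable_cst].
move=> x _; rewrite -[f x ^+ 2]real_normK ?num_real//; set a := `|f x|.
have := mulr_ge0 (ltW r0) (sqr_ge0 (r^-1 * a - 1)).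
have -> : r * (r^-1 * a - 1) ^+ 2 = r^-1 * a ^+ 2 + r - 2 * a by field; lra.
set X := r^-1; lra.
Qed.

Lemma sum_half_powers n : \sum_(k < n) (2^-1 : R) ^+ k <= 2.
Proof.
suff -> : \sum_(k < n) (2^-1 : R) ^+ k = 2 - 2 * 2^-1 ^+ n.
  by rewrite gerBl mulr_ge0// exprn_ge0// invr_ge0.
elim: n => [|n IH]; first by rewrite big_ord0 expr0; ring.
by rewrite big_ord_recr /= IH exprS; field.
Qed.

Lemma IC_le f (a r : R) : L2_torus f -> 0 < r ->
  `|IC f a| <= (r^-1 * nsq f + r * (pi *+ 2)) / 2.
Proof.
move=> fL r0; apply: le_trans (tint_abs_le fL r0).
have fi := L2_integrable fL.
apply: (le_trans (tint_norm (tintegrable_cos a fi))); apply: le_tint.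
- by apply: tintegrable_normr; exact: tintegrable_cos.
- exact: tintegrable_normr.
- by move=> x _; rewrite normrM ler_piMr// cos_max.
Qed.

Lemma IS_le f (a r : R) : L2_torus f -> 0 < r ->
  `|IS f a| <= (r^-1 * nsq f + r * (pi *+ 2)) / 2.
Proof.
move=> fL r0; apply: le_trans (tint_abs_le fL r0).
have fi := L2_integrable fL.
apply: (le_trans (tint_norm (tintegrable_sin a fi))); apply: le_tint.
- by apply: tintegrable_normr; exact: tintegrable_sin.
- exact: tintegrable_normr.
- by move=> x _; rewrite normrM ler_piMr// sin_max.
Qed.

Lemma fc_nsq_le f k (e : R) : L2_torus f -> 0 < e -> nsq f <= pi *+ 2 * e ^+ 2 ->
  `|complex.Re (fc f k)| <= 2 * e /\ `|complex.Im (fc f k)| <= 2 * e.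
Proof.
move=> fL e0 fe; have K := @kap_gt0 R k; have K2 := @kap_le2 R k.
have P := @pi2_gt0 R.
have B (X : R) : `|X| <= (e^-1 * nsq f + e * (pi *+ 2)) / 2 ->
    `|kap k / (pi *+ 2) * X| <= 2 * e.
  move=> XB; have {}XB : `|X| <= e * (pi *+ 2).
    apply: (le_trans XB); have := ler_wpM2l (_ : 0 <= e^-1) fe.
    rewrite invr_ge0 (ltW e0) => /(_ isT).
    rewrite [leRHS](_ : _ = e * (pi *+ 2)); last first.
      by move: (pi *+ 2) => p; field; lra.
    by set Y := e^-1 * _; lra.
  have q0 : 0 <= kap k / (pi *+ 2) :> R by apply: divr_ge0; exact: ltW.
  rewrite normrM (ger0_norm q0).
  apply: (@le_trans _ _ (kap k / (pi *+ 2) * (e * (pi *+ 2)))).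
    exact: ler_wpM2l.
  have -> : kap k / (pi *+ 2) * (e * (pi *+ 2)) = kap k * e.
    by move: (pi *+ 2) P => p p0; field; lra.
  by rewrite ler_wpM2r// ltW.
by rewrite Re_fc Im_fc normrN; split; apply: B; [exact: IC_le|exact: IS_le].
Qed.

Lemma fc_L2_limit (f : nat -> R -> R) F k (z : R[i]) :
  (forall m, L2_torus (f m)) -> L2_torus F ->
  (forall e, 0 < e -> exists m, nsq (fun x => F x - f m x) <= pi *+ 2 * e ^+ 2 /\
     fc (f m) k = z) ->
  fc F k = z.
Proof.
move=> fL FL H.
have Z (x y : R) : (forall e, 0 < e -> `|x - y| <= 2 * e) -> x = y.
  move=> xy; apply/eqP; rewrite -subr_eq0 -normr_le0; apply/ler_addgt0Pl => e e0.
  have e2 : 0 < e / 2 by rewrite divr_gt0.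
  by have := xy _ e2; lra.
apply: complex_ext; apply: Z => e e0; have [m [He <-]] := H e e0.
  have [h _] := fc_nsq_le k (L2_B FL (fL m)) e0 He.
  by move: h; rewrite fcB ?cReD ?cReN//; exact: L2_integrable.
have [_ h] := fc_nsq_le k (L2_B FL (fL m)) e0 He.
by move: h; rewrite fcB ?cImD ?cImN//; exact: L2_integrable.
Qed.

(** Along a subsequence the L^2 norms of the increments of the partial sums decay geometrically.
    Their absolute values then have an integrable sum, so the subsequence converges almost
    everywhere. Fatou's lemma gives the norm bound and the convergence in L^2, which transfers the
    coefficients. *)
Theorem riesz_fischer w (C : R) : complex.Im (w 0%N) = 0 ->
  (forall n, \sum_(k < n) csq (w k) <= C) ->
  exists F, [/\ L2_torus F, forall k, fc F k = w k & nsq F <= pi *+ 2 * C].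
Proof.
move=> w0 wC; have P := @pi2_gt0 R.
have half0 j : 0 < (2^-1 : R) ^+ j by rewrite exprn_gt0// invr_gt0.
pose r j : R := 2^-1 ^+ j.
have [nn Hnn] := choice (fun j => tail_small (fun k => csq_ge0 (w k)) wC
  (exprn_gt0 2 (half0 j) : 0 < r j ^+ 2)).
(* Summing makes the indices monotone, at least nn j, and larger than j. *)
pose N j := (\sum_(i < j.+1) (nn i).+1)%N.
have Nnn j : (nn j <= N j)%N.
  by rewrite /N big_ord_recr /=; lia.
have Nlt j : (j < N j)%N.
  by elim: j => [|j IH]; rewrite /N big_ord_recr /= -/(N _); [lia|move: IH; rewrite /N; lia].
have Nmono i j : (i <= j)%N -> (N i <= N j)%N.
  move=> /subnK <-; elim: (j - i)%N => // m IH.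
  by apply: (leq_trans IH); rewrite addSn /N [leqRHS]big_ord_recr /= leq_addr.
pose S n := \sum_(k < n) csq (w k).
pose p j := tpoly (N j) w.
have pL j : L2_torus (p j) by exact: tpoly_L2.
have pp i j : (i <= j)%N -> nsq (fun x => p j x - p i x) <= pi *+ 2 * r i ^+ 2.
  move=> ij; apply: (le_trans (nsq_tpoly_sub w0 (Nmono _ _ ij))).
  by rewrite ler_wpM2l ?(ltW P)//; exact: Hnn.
pose d j x := p j.+1 x - p j x.
have dL j : L2_torus (d j) by exact: L2_B.
have dint j : tint (fun x => `|d j x|) <= pi *+ 2 * r j.
  apply: (le_trans (tint_abs_le (dL j) (half0 j))); rewrite -/(r j).
  have rj : 0 < r j by exact: half0.
  have := ler_wpM2l (ltW (_ : 0 < (r j)^-1)) (pp j j.+1 (leqnSn j)).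
  rewrite invr_gt0 => /(_ rj); rewrite [leRHS](_ : _ = r j * (pi *+ 2)); last first.
    by move: (pi *+ 2) => q; field; lra.
  rewrite -/(d j) => h; rewrite mulrDl; set Y := _^-1 * _ in h *.
  by rewrite (mulrC (pi *+ 2)); lra.
pose G x : \bar R := (\sum_(j <oo) (`|d j x|)%:E)%E.
have md j : @measurable_fun _ _ (measurableTypeR R) _ torus (fun x => (`|d j x|)%:E : \bar R).
  apply/measurable_EFinP; apply: measurableT_comp => //; exact: L2_measurable (dL j).
have Gi : mu.-integrable torus G.
  apply/integrableP; split.
    by apply: ge0_emeasurable_sum => // k _; exact: md.
  under eq_integral do rewrite gee0_abs ?nneseries_ge0//.
  rewrite integral_nneseries//.
  apply: le_lt_trans (ltry (pi *+ 2 * 2)); apply: nneseries_le => [n|n].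
    exact: integral_ge0.
  apply: (@le_trans _ _ (\sum_(0 <= k < n) (pi *+ 2 * r k)%:E)%E).
    apply: lee_sum => k _; rewrite tint_EFin ?lee_fin//.
    by apply: tintegrable_normr; exact: L2_integrable.
  rewrite sumEFin lee_fin -mulr_sumr ler_wpM2l ?(ltW P)// big_mkord.
  exact: sum_half_powers.
have pcvg : {ae mu, forall x, torus x -> cvgn (fun j => p j x)}.
  apply: (ae_imp _ (integrable_ae measurable_torusR Gi)) => x /= H tx.
  have {H} := H tx; rewrite ge0_fin_numE ?nneseries_ge0// => Gx.
  have cd : cvgn (series (fun j => d j x)).
    by apply: normed_cvg; apply: nnseries_is_cvg; [move=> i; exact: normr_ge0|exact: Gx].
  have -> : (fun j => p j x) = (fun j => p 0%N x + series (fun j => d j x) j).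
    by apply/funext => j; rewrite /series /= telescope_sumr//; ring.
  by apply: is_cvgD => //; exact: is_cvg_cst.
(* An upper limit is defined at every point, so F is measurable and exactly periodic, although
   convergence holds only almost everywhere. *)
pose F x : R := fine (limn_esup (fun j => (p j x)%:E)).
have pF : periodic F (pi *+ 2).
  by move=> x; rewrite /F; under eq_fun do rewrite /p tpoly_periodic.
have mF : measurable_fun setT F.
  apply: measurableT_comp => //; apply: measurable_fun_limn_esup => j.
  apply/measurable_EFinP; apply: continuous_measurable_fun; exact: tpoly_continuous.
have pF_cvg : {ae mu, forall x, torus x -> p j x @[j --> \oo] --> F x}.
  apply: (ae_imp _ pcvg) => x /= H tx; have {H} c := H tx.
  suff -> : F x = limn (fun j => p j x) by [].
  have c' : (p j x)%:E @[j --> \oo] --> (limn (fun j => p j x))%:E.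
    by apply: cvg_EFin; first exact: nearW.
  by rewrite /F is_cvg_limn_esupE ?(cvg_lim _ c')//; apply: cvgP c'.
have [FL FC] : L2_torus F /\ nsq F <= pi *+ 2 * C.
  apply: (fatou_nsq pL) => // m.
  by apply: (le_trans (nsq_tpoly_le _ w0)); rewrite ler_wpM2l ?(ltW P).
have FJ J : nsq (fun x => F x - p J x) <= pi *+ 2 * r J ^+ 2.
  have [] // := @fatou_nsq (fun m x => p (m + J)%N x - p J x) (fun x => F x - p J x)
    (pi *+ 2 * r J ^+ 2).
  - by move=> m; exact: L2_B.
  - by move=> m; apply: pp; rewrite leq_addl.
  - by move=> x; rewrite pF /p tpoly_periodic.
  - apply: measurable_funB => //; apply: continuous_measurable_fun; exact: tpoly_continuous.
  apply: (ae_imp _ pF_cvg) => x /= H tx; apply: cvgB; last exact: cvg_cst.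
  by rewrite (cvg_shiftn J (fun j => p j x)); exact: H.
exists F; split => // k.
apply: (@fc_L2_limit p) => // e e0.
have [J0 _ HJ0] : \forall J \near \oo, r J < e.
  have : r J @[J --> \oo] --> 0.
    by apply: cvg_expr; rewrite ger0_norm// invf_lt1// ltr1n.
  by move=> /cvgrPdist_lt /(_ e e0); apply: filterS => J; rewrite sub0r normrN => /(le_lt_trans (ler_norm _)).
pose J := maxn J0 k; exists J; split.
  apply: (le_trans (FJ J)); rewrite ler_wpM2l ?(ltW P)//.
  rewrite ler_sqr ?nnegrE ?(ltW e0)// ?(ltW (half0 J))// ltW//.
  by apply: HJ0; rewrite /= leq_maxl.
by rewrite fc_tpoly// ifT// (leq_ltn_trans _ (Nlt J))// leq_maxr.
Qed.

Lemma uniform_series w (C : R) : complex.Im (w 0%N) = 0 ->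
  (forall n, \sum_(k < n) cabs (w k) <= C) ->
  exists F, [/\ continuous F, periodic F (pi *+ 2), forall k, fc F k = w k &
    forall x n (e : R), (forall m, \sum_(k < m) cabs (w k) - \sum_(k < n) cabs (w k) <= e) ->
       `|F x - tpoly n w x| <= e].
Proof.
move=> w0 wC.
have cvgw x : cvgn (fun n => tpoly n w x).
  have -> : (fun n => tpoly n w x) = series (fun k => tmode (w k) k x).
    by apply/funext => n; rewrite /series /= big_mkord.
  apply: normed_cvg; apply: (@series_le_cvg _ _ (fun k => cabs (w k))).
  - by move=> n; exact: normr_ge0.
  - by move=> n; exact: cabs_ge0.
  - by move=> n; exact: tmode_le.
  apply: nondecreasing_is_cvgn.
    by apply: (@nondecreasing_series _ (fun k => cabs (w k)) xpredT) => n _ _; exact: cabs_ge0.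
  by exists C => _ [n _ <-]; rewrite /series /= big_mkord.
pose F x := limn (fun n => tpoly n w x).
have FE x n (e : R) : (forall m, \sum_(k < m) cabs (w k) - \sum_(k < n) cabs (w k) <= e) ->
    `|F x - tpoly n w x| <= e.
  move=> He; have c : `|tpoly m w x - tpoly n w x| @[m --> \oo] --> `|F x - tpoly n w x|.
    by apply: cvg_norm; apply: cvgB; [exact: cvgw|exact: cvg_cst].
  rewrite -(cvg_lim _ c)//; apply: limr_le; first exact: cvgP c.
  exists n => // m /= nm; rewrite tpoly_sub//; apply: le_trans (He m).
  rewrite -(sum_trunc_below w (@cabs0 R) nm); apply: (le_trans (ler_norm_sum _ _ _)).
  by apply: ler_sum => k _; exact: tmode_le.
have tailw := tail_small (fun k => cabs_ge0 (w k)) wC.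
have cF : continuous F.
  move=> x; apply/cvgrPdist_le => e e0.
  have e3 : 0 < e / 3 by rewrite divr_gt0.
  have [n Hn] := tailw _ e3.
  have FEn y : `|F y - tpoly n w y| <= e / 3 by apply: FE => m; exact: Hn.
  have := @tpoly_continuous R n w x; move=> /cvgrPdist_le /(_ _ e3).
  apply: filterS => y hy.
  have -> : F x - F y = (F x - tpoly n w x) + (tpoly n w x - tpoly n w y) - (F y - tpoly n w y) by ring.
  apply: (le_trans (ler_normB _ _)); apply: (le_trans (lerD (ler_normD _ _) (lexx _))).
  by have := FEn x; have := FEn y; lra.
have pF : periodic F (pi *+ 2).
  by move=> x; rewrite /F; under eq_fun do rewrite tpoly_periodic.
have FL : L2_torus F by exact: L2_continuous.
exists F; split => // k.
apply: (@fc_L2_limit (fun n => tpoly n w)) => [m||e e0]; [exact: tpoly_L2|exact: FL|].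
have [n Hn] := tailw e e0.
exists (maxn n k.+1); split; last by rewrite fc_tpoly// leq_maxr.
rewrite mulrC -tint_cst /nsq; apply: le_tint.
- by apply: L2_sq_integrable; apply: L2_B => //; exact: tpoly_L2.
- exact: tintegrable_cst.
move=> x _; rewrite -[leLHS]real_normK ?num_real// ler_sqr ?nnegrE ?(ltW e0)//.
by apply: FE => m; apply: Hn; rewrite leq_maxl.
Qed.

End RieszFischer.

(** * Parseval's inequality, Toeplitz forms and the product u Hu *)

Section FourierConsequences.
Context {R : realType}.
Implicit Types (f g u v : R -> R) (w : nat -> R[i]).
Local Notation mu := (@lebesgue_measure R).

Lemma fc_injective f g : tintegrable f -> tintegrable g ->
  (forall k, fc f k = fc g k) -> eq_torus f g.
Proof.
move=> fi gi fg; apply: fourier_injective => // n; have := fg n.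
have K := @kap_gt0 R n.
move=> /(congr1 (fun z => ((kap n)^-1)%:C%C * z)).
rewrite /fc !mulrA; have -> : ((kap n)^-1)%:C%C * (kap n)%:C%C = 1 :> R[i].
  by apply: complex_ext; rewrite ?cReZ ?cImZ /= ?mulr0// mulVf// gt_eqF.
by rewrite !mul1r.
Qed.

Lemma nsq_ae f g : L2_torus f -> L2_torus g -> eq_torus f g -> nsq f = nsq g.
Proof.
move=> fL gL fg; apply: EFin_inj; rewrite -!l2_sqnormE//.
by apply: l2_sqnorm_ae => //; exact: L2_measurable.
Qed.

(** [riesz_fischer] builds a function with the same coefficients and the desired bound, and
    injectivity identifies it with f. *)
Lemma parseval_le f (C : R) : L2_torus f -> (forall n, \sum_(k < n) csq (fc f k) <= C) ->
  nsq f <= pi *+ 2 * C.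
Proof.
move=> fL fC; have [F [FL Fk FC]] := riesz_fischer (Im_fc0 f) fC.
rewrite (nsq_ae fL FL)//; apply: fc_injective => [||k]; [exact: L2_integrable..|].
by rewrite Fk.
Qed.

Lemma nsq_tail_le f n (e : R) : L2_torus f ->
  (forall m, \sum_(k < m) csq (fc f k) - \sum_(k < n) csq (fc f k) <= e) ->
  nsq (fun x => f x - tpoly n (fc f) x) <= pi *+ 2 * e.
Proof.
move=> fL H; apply: parseval_le => [|m].
  by apply: L2_B => //; exact: tpoly_L2.
rewrite (eq_bigr (fun k : 'I_m => csq (trunc_below n (fc f) k))); last first.
  move=> k _; rewrite fcB ?fc_tpoly ?Im_fc0//; [|exact: L2_integrable|exact/L2_integrable/tpoly_L2].
  by rewrite /trunc_below; case: ifP => _; rewrite ?subrr ?subr0.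
have [nm|mn] := leqP n m; first by rewrite (sum_trunc_below _ (@csq0 R) nm).
rewrite big1 ?(le_trans _ (H n)) ?subrr// => k _.
by rewrite /trunc_below (ltn_trans (ltn_ord k) mn) csq0.
Qed.

(** Off-diagonal terms are counted twice on the triangle, which is exactly the factor [kap] at k -
    j. *)
Lemma sym_sum n (F : nat -> nat -> R) : (forall j k, F j k = F k j) ->
  \sum_(k < n) \sum_(j < n) F k j =
  \sum_(k < n) \sum_(j < k.+1) kap (k - j)%N * F k j.
Proof.
move=> sF; elim: n => [|n IH]; first by rewrite !big_ord0.
rewrite big_ord_recr /= [RHS]big_ord_recr /= -IH.
under eq_bigr => k _ do rewrite big_ord_recr /=.
rewrite big_split /= -addrA; congr (_ + _).
rewrite !big_ord_recr /= subnn (_ : kap 0 = 1)// mul1r addrA; congr (_ + _).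
rewrite -big_split; apply: eq_bigr => j _ /=.
by rewrite /kap subn_eq0 leqNgt ltn_ord /= (sF j n) mulrDl mul1r.
Qed.

(** Expanding |V|^2 gives the full Hermitian Toeplitz form of f; folded onto the triangle, its
    factor [kap] is absorbed by the normalisation of [fc]. *)
Lemma toeplitz_integral f (v : nat -> R[i]) n : tintegrable f ->
  pi *+ 2 * toeplitz (fc f) v n =
  tint (fun x => f x * csq (\sum_(k < n) v k * Complex (cos (k%:R * x)) (sin (k%:R * x)))).
Proof.
move=> fi; pose F k j := cdot (v k) (v j) * IC f (k%:R - j%:R) +
   (complex.Re (v k) * complex.Im (v j) - complex.Im (v k) * complex.Re (v j)) *
   IS f (k%:R - j%:R).
have sF j k : F j k = F k j.
  by rewrite /F cdotC -(opprB (k%:R) (j%:R)) ICN ISN//; ring.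
transitivity (\sum_(k < n) \sum_(j < n) F k j).
  rewrite sym_sum// /toeplitz mulr_sumr; apply: eq_bigr => k _.
  rewrite /cprod cdot_sumr mulr_sumr; apply: eq_bigr => j _.
  rewrite /F -natrB -1?ltnS// IC_fc IS_fc.
  have K := @kap_gt0 R (k - j); move: (pi *+ 2) => P.
  move: (fc f (k - j)) (kap _) K => z K K0.
  rewrite /cdot cReM cImM; field; lra.
pose H k j x : R := cdot (v k) (v j) * (f x * cos ((k%:R - j%:R) * x)) +
   (complex.Re (v k) * complex.Im (v j) - complex.Im (v k) * complex.Re (v j)) *
   (f x * sin ((k%:R - j%:R) * x)).
have Hi k j : tintegrable (H k j).
  by apply: tintegrableD; apply: tintegrableZ; [exact: tintegrable_cos|exact: tintegrable_sin].
transitivity (tint (fun x => \sum_(k < n) \sum_(j < n) H k j x)).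
  rewrite (@tint_sum _ n (fun k x => \sum_(j < n) H k j x)); last first.
    by move=> k; exact: (@tintegrable_sum _ n (H k)).
  apply: eq_bigr => k _; rewrite (@tint_sum _ n (H k))//.
  apply: eq_bigr => j _; rewrite /H tintD ?tintZ//.
  - exact: tintegrable_sin.
  - exact: tintegrable_cos.
  - by apply: tintegrableZ; exact: tintegrable_cos.
  - by apply: tintegrableZ; exact: tintegrable_sin.
apply: eq_tint => x _; rewrite -cdotzz cdot_sumr mulr_sumr exchange_big /=.
apply: eq_bigr => j _; rewrite cdotC cdot_sumr mulr_sumr; apply: eq_bigr => k _.
by rewrite /H mulrBl cosB sinB /cdot !cReM !cImM /=; ring.
Qed.

Lemma toeplitz_ge0 f (v : nat -> R[i]) n : tintegrable f ->
  (forall x, torus x -> 0 <= f x) -> 0 <= toeplitz (fc f) v n.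
Proof.
move=> fi f0; rewrite -(pmulr_rge0 _ (@pi2_gt0 R)) toeplitz_integral//.
by apply: tint_ge0 => x tx; rewrite mulr_ge0 ?csq_ge0 ?f0.
Qed.

Lemma fc_cst (c : R) k : fc (fun=> c) k = if k == 0%N then c%:C%C else 0.
Proof.
have -> : (fun=> c) = (fun x : R => c * 1) by apply/funext => x; rewrite mulr1.
have e1 : IC (fun=> 1 : R) k%:R = _ := IC1 k.
have e2 : IS (fun=> 1 : R) k%:R = _ := IS1 k.
have P := @pi2_gt0 R; rewrite fcZ; last exact: tintegrable_cst.
apply: complex_ext; [rewrite cReZ Re_fc|rewrite cImZ Im_fc].
  rewrite e1 eqz_nat; case: eqP => [->|_]; last by rewrite !mulr0.
  by rewrite /kap /=; move: (pi *+ 2) P => p p0; field; lra.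
by rewrite e2 mulr0 oppr0 mulr0; case: ifP.
Qed.

(** The form of the nonnegative function A u - lam is nonnegative, and the constant lam enters its
    diagonal only. *)
Lemma toeplitz_lower_bound (A lam : R) u (v : nat -> R[i]) n : tintegrable u ->
  (forall x, torus x -> lam <= A * u x) ->
  lam * \sum_(k < n) csq (v k) <= toeplitz (fun k => A%:C%C * fc u k) v n.
Proof.
move=> ui Hu; rewrite -subr_ge0.
have fi : tintegrable (fun x => A * u x - lam).
  by apply: tintegrableB; [exact: tintegrableZ|exact: tintegrable_cst].
have := @toeplitz_ge0 (fun x => A * u x - lam) v n fi.
move=> H; have {}H : 0 <= toeplitz (fc (fun x => A * u x - lam)) v n.
  by apply: H => x tx; rewrite subr_ge0 Hu.
apply: le_trans H _; rewrite le_eqVlt; apply/orP; left; apply/eqP.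
rewrite /toeplitz mulr_sumr -sumrB; apply: eq_bigr => k _.
rewrite /cprod -cdotzz -cdotZr !cdot_sumr.
rewrite (eq_bigr (fun j : 'I_k.+1 => cdot (v k) (A%:C%C * fc u (k - j)%N * v j) -
   (if (j == k :> nat) then cdot (v k) (lam%:C%C * v k) else 0))); last first.
  move=> j _; rewrite fcB ?fcZ ?fc_cst//; [|exact: tintegrableZ|exact: tintegrable_cst].
  have jk : (j <= k)%N by rewrite -ltnS.
  rewrite subn_eq0; have -> : (k <= j)%N = (j == k :> nat) by rewrite eqn_leq jk.
  case: eqVneq => [->|_]; last by rewrite !subr0.
  by rewrite mulrBl cdotDr; congr (_ + _); rewrite /cdot cReN cImN; ring.
rewrite sumrB; congr (_ - _); rewrite (bigD1 ord_max)//= eqxx big1 ?addr0// => j.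
by rewrite -val_eqE /= => /negbTE ->.
Qed.

(* With W = \sum_k w_k e^{ikx} one has u = Re W, Hu = Im W and Re W Im W = Im W^2 / 2. *)
Lemma tpoly_horner n w x : tpoly n w x =
  complex.Re ((\poly_(k < n) w k).[Complex (cos x) (sin x)]).
Proof.
rewrite horner_poly cRe_sum; apply: eq_bigr => k _.
have -> : Complex (cos x) (sin x) ^+ k = Complex (cos (k%:R * x)) (sin (k%:R * x)).
  elim: (k : nat) => [|m IH]; first by rewrite expr0 !mul0r cos0 sin0.
  rewrite exprSr IH -natr1 mulrDl mul1r cosD sinD.
  by apply: complex_ext; rewrite ?cReM ?cImM /=; ring.
by rewrite cReM.
Qed.

Lemma tpoly_product n w x : complex.Im (w 0%N) = 0 ->
  tpoly n w x * tpoly n (fun k => if k == 0%N then 0 else - Complex 0 1 * w k) x =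
  tpoly (n + n) (fun k => if k == 0%N then 0 else
    - Complex 0 2^-1 * (\poly_(j < n) w j * \poly_(j < n) w j)`_k) x.
Proof.
move=> w0; set e := Complex (cos x) (sin x); set P := \poly_(j < n) w j.
have -> : tpoly n (fun k => if k == 0%N then 0 else - Complex 0 1 * w k) x =
   complex.Im P.[e].
  rewrite tpoly_horner -/e !horner_poly cRe_sum cIm_sum; apply: eq_bigr => k _.
  case: eqP => [->|_]; first by rewrite expr0 !mulr1 w0.
  by rewrite !(cReM, cImM, cReN, cImN) /=; ring.
have -> : tpoly (n + n) (fun k => if k == 0%N then 0 else - Complex 0 2^-1 * (P * P)`_k) x =
   complex.Re (- Complex 0 2^-1 * (P * P).[e]).
  have sP : (size (P * P)%R <= n + n)%N.
    apply: (leq_trans (size_polyMleq _ _)); have := size_poly n w; rewrite -/P; lia.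
  rewrite tpoly_horner -/e horner_poly (horner_coef_wide _ sP) mulr_sumr !cRe_sum.
  apply: eq_bigr => k _; case: eqP => [->|_]; last by rewrite mulrA.
  rewrite expr0 !mulr1 coefM big_ord1 subnn coef_poly.
  case: ifP => _; last by rewrite !mulr0.
  by rewrite !(cReM, cImM, cReN, cImN) /= w0; ring.
rewrite tpoly_horner -/e -/P hornerM; case: (P.[e]) => a b.
by rewrite !(cReM, cImM, cReN, cImN) /=; field.
Qed.

(** For truncations at n > k the identity is exact by [tpoly_product], and its right-hand side does
    not depend on n. The limit is taken in L^1 through u v - U V = (u - U) v + U (v - V). *)
Lemma hilbert_product u v (C : R) k : L2_torus u -> L2_torus v ->
  (forall n, \sum_(k < n) csq (fc u k) <= C) ->
  (forall k, fc v k = if k == 0%N then 0 else - Complex 0 1 * fc u k) ->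
  fc (fun x => u x * v x) k =
  if k == 0%N then 0 else - Complex 0 2^-1 * cprod (fc u) (fc u) k.
Proof.
move=> uL vL uC vk; have uvi := L2_integrableM uL vL.
have vu j : csq (fc v j) <= csq (fc u j).
  rewrite vk; case: eqP => _; first by rewrite csq0 csq_ge0.
  by rewrite csqM {1}/csq !(cReN, cImN) /= oppr0 sqrrN !(expr0n, expr1n) /= add0r mul1r.
have vC n : \sum_(j < n) csq (fc v j) <= C.
  by apply: le_trans (uC n); apply: ler_sum => j _.
have P := @pi2_gt0 R.
have zE n : (k < n)%N -> fc (fun x => tpoly n (fc u) x * tpoly n (fc v) x) k =
    if k == 0%N then 0 else - Complex 0 2^-1 * cprod (fc u) (fc u) k.
  move=> kn.
  have -> : (fun x => tpoly n (fc u) x * tpoly n (fc v) x) =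
      tpoly (n + n) (fun k => if k == 0%N then 0 else - Complex 0 2^-1 *
        (\poly_(j < n) fc u j * \poly_(j < n) fc u j)`_k).
    apply/funext => x; rewrite -tpoly_product ?Im_fc0//; congr (_ * _).
    by apply: eq_bigr => j _; rewrite vk.
  rewrite fc_tpoly// (_ : (k < n + n)%N = true); last by lia.
  case: eqP => // _; congr (_ * _); rewrite coefM /cprod; apply: eq_bigr => j _.
  rewrite !coef_poly !ifT//; first by rewrite mulrC.
    by rewrite (leq_ltn_trans (leq_subr _ _)).
  by rewrite (leq_ltn_trans _ kn)// -ltnS.
rewrite -(zE k.+1)//; set z := fc _ k.
suff H e : 0 < e -> exists n, (k < n)%N /\ forall X : (R -> R) -> R -> R,
    X = IC \/ X = IS ->
    `|X (fun x => u x * v x) k%:R - X (fun x => tpoly n (fc u) x * tpoly n (fc v) x) k%:R| <= e.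
  have Z (x y : R) : (forall e, 0 < e -> `|x - y| <= e) -> x = y.
    move=> xy; apply/eqP; rewrite -subr_eq0 -normr_le0; apply/ler_addgt0Pl => e e0.
    by rewrite addr0; exact: xy.
  have eqX (X : (R -> R) -> R -> R) : X = IC \/ X = IS ->
     X (fun x => u x * v x) k%:R = X (fun x => tpoly k.+1 (fc u) x * tpoly k.+1 (fc v) x) k%:R.
    move=> HX; apply: Z => e e0; have [n [kn Hn]] := H e e0.
    have := Hn X HX; congr (`|_ - _| <= _).
    have := zE n kn; rewrite -(zE k.+1)//.
    by case: HX => ->; rewrite !(IC_fc, IS_fc) => ->.
  by apply: complex_ext; rewrite ?Re_fc ?Im_fc eqX//; [left|right].
move=> e0; have C0 : 0 <= C by have := uC 0%N; rewrite big_ord0.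
have PC0 : 0 <= pi *+ 2 * C by rewrite mulr_ge0// ltW.
(* The parameter th of the Cauchy-Schwarz bound makes the factor of size C harmless; de is then the
   size of tail that compensates th^-1. Each of the two products costs e / 2. *)
have [th th0 thC] : exists2 th, 0 < th & th * (pi *+ 2 * C) <= e / 2.
  exists (e / (2 * (pi *+ 2 * C + 1))); first by apply: divr_gt0 => //; lra.
  move: (pi *+ 2 * C) PC0 => Q Q0.
  by rewrite mulrAC ler_pdivrMr; lra.
have [de de0 thd] : exists2 de, 0 < de & th^-1 * (pi *+ 2 * de) = e / 2.
  exists (th * e / (2 * (pi *+ 2))); first by apply: divr_gt0; apply: mulr_gt0.
  by move: (pi *+ 2) P => p p0; field; lra.
have [N1 HN1] := tail_small (fun j => csq_ge0 (fc u j)) uC de0.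
have [N2 HN2] := tail_small (fun j => csq_ge0 (fc v j)) vC de0.
pose n := maxn k.+1 (maxn N1 N2); exists n; split; first by rewrite /n; lia.
have nN1 : (N1 <= n)%N by rewrite /n; lia.
have nN2 : (N2 <= n)%N by rewrite /n; lia.
pose U := tpoly n (fc u); pose V := tpoly n (fc v).
have UL : L2_torus U by exact: tpoly_L2.
have VL : L2_torus V by exact: tpoly_L2.
have duL := L2_B uL UL; have dvL := L2_B vL VL.
have h1 : nsq (fun x => u x - U x) <= pi *+ 2 * de.
  by apply: nsq_tail_le => // m; exact: HN1.
have h2 : nsq (fun x => v x - V x) <= pi *+ 2 * de.
  by apply: nsq_tail_le => // m; exact: HN2.
have h3 : nsq v <= pi *+ 2 * C by exact: parseval_le.
have h4 : nsq U <= pi *+ 2 * C.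
  apply: parseval_le => // m; apply: le_trans (uC m); apply: ler_sum => j _.
  by rewrite fc_tpoly ?Im_fc0//; case: ifP => // _; rewrite csq0 csq_ge0.
have UVi := L2_integrableM UL VL.
have duv := L2_integrableM duL vL; have Udv := L2_integrableM UL dvL.
have bound a b : L2_torus a -> L2_torus b -> nsq a <= pi *+ 2 * de -> nsq b <= pi *+ 2 * C ->
    tint (fun x => `|a x * b x|) <= e / 2.
  move=> aL bL ha hb.
  apply: (le_trans (tint_mul_abs_le aL bL th0)).
  have := ler_wpM2l (_ : 0 <= th^-1) ha; rewrite invr_ge0 (ltW th0) => /(_ isT).
  have := ler_wpM2l (ltW th0) hb; rewrite thd.
  move: thC; move: (th^-1 * nsq a) (th * nsq b) (th * _) => x1 x2 x3.
  by clear; lra.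
have main (h : R -> R) : continuous h -> (forall x, `|h x| <= 1) ->
    `|tint (fun x => u x * v x * h x) - tint (fun x => U x * V x * h x)| <= e.
  move=> ch h1'; have mh : measurable_fun torus h by exact: continuous_measurable_torus.
  have Mi f : tintegrable f -> tintegrable (fun x => f x * h x).
    by move=> fi; apply: (tintegrableM (M := 1)).
  rewrite -tintB; [|exact: Mi..].
  have -> : tint (fun x => u x * v x * h x - U x * V x * h x) =
     tint (fun x => ((u x - U x) * v x + U x * (v x - V x)) * h x).
    by apply: eq_tint => x _; ring.
  have si := tintegrableD duv Udv.
  apply: (le_trans (tint_norm (Mi _ si))).
  apply: (@le_trans _ _ (tint (fun x => `|(u x - U x) * v x| + `|(v x - V x) * U x|))).
    apply: le_tint; first exact/tintegrable_normr/Mi.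
      by apply: tintegrableD; apply: tintegrable_normr => //; exact: L2_integrableM.
    move=> x _; rewrite normrM; apply: (le_trans (ler_piMr _ (h1' x))) => //.
    by rewrite (mulrC (v x - V x)); exact: ler_normD.
  rewrite tintD; [|exact: tintegrable_normr|exact/tintegrable_normr/L2_integrableM].
  have b1 := bound _ _ duL vL h1 h3.
  have b2 := bound _ _ dvL UL h2 h4.
  by move: (lerD b1 b2); rewrite -splitr.
move=> X [->|->]; apply: main.
- exact: continuous_cosM.
- by move=> x; exact: cos_max.
- exact: continuous_sinM.
- by move=> x; exact: sin_max.
Qed.

End FourierConsequences.

(** * Sobolev norms and multipliers *)

Section SobolevSums.
Context {R : realType}.
Implicit Types (f u h : R -> R).
Local Notation mu := (@lebesgue_measure R).

Definition wt (s : R) (k : nat) : R := (1 + k%:R ^+ 2) `^ s.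

Lemma wt_ge0 s k : 0 <= wt s k.
Proof. exact: powR_ge0. Qed.

Lemma wt_half (m k : nat) : (k%:R ^+ 2) `^ (m%:R / 2) = (k%:R ^+ m : R).
Proof.
have k0 : (0 : R) <= k%:R by [].
rewrite -powR_mulrn// -powRrM mulrCA mulfV// mulr1 powR_mulrn//.
Qed.

Lemma wt_ge (m k : nat) : k%:R ^+ m <= wt (m%:R / 2) k.
Proof.
rewrite -wt_half /wt ge0_ler_powR ?nnegrE ?divr_ge0 ?sqr_ge0 ?addr_ge0 ?sqr_ge0//.
by rewrite lerDr.
Qed.

Lemma wt_le (m k : nat) : (0 < k)%N -> wt (m%:R / 2) k <= 2 ^+ m * k%:R ^+ m.
Proof.
move=> k0; have k1 : (1 : R) <= k%:R by rewrite ler1n.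
have -> : (2 ^+ m * k%:R ^+ m : R) = (2 * k)%N%:R ^+ m by rewrite natrM exprMn.
rewrite -wt_half /wt ge0_ler_powR ?nnegrE ?divr_ge0 ?sqr_ge0 ?addr_ge0 ?sqr_ge0//.
by rewrite natrM exprMn; have := sqr_ge0 (k%:R : R); have := exprn_ege1 2 k1; lra.
Qed.

Lemma wt0 s : wt s 0 = 1.
Proof. by rewrite /wt expr0n addr0 powR1. Qed.

Lemma esum_int (a : int -> \bar R) : (forall k, (0 <= a k)%E) ->
  (\esum_(k in [set: int]) a k =
   \sum_(n <oo) a (Posz n) + \sum_(n <oo) a (Negz n))%E.
Proof.
move=> a0; rewrite (esumID (range Posz)) ?setTI//.
  congr (_ + _)%E.
    rewrite esum_image; last by move=> x y _ _ [].
    by rewrite (nneseries_esumT (a := fun n => a (Posz n))).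
  have -> : ~` range Posz = range Negz.
    apply/seteqP; split => [[n|n] h|_ [n _ <-] [m _]//].
      by exfalso; apply: h; exists n.
    by exists n.
  rewrite esum_image; last by move=> x y _ _ [].
  by rewrite (nneseries_esumT (a := fun n => a (Negz n))).
Qed.

Lemma csq_conj (z : R[i]) : csq z^*%C = csq z.
Proof. by case: z => a b; rewrite /csq /= sqrrN. Qed.

Lemma csq_fc f k : csq (fc f k) = kap k ^+ 2 * csq (fourier f k).
Proof. by rewrite /fc csqZ. Qed.

(** Conjugate symmetry folds the negative frequencies; the shift in the second sum is that of
    [Negz n], which is -(n + 1). *)
Lemma sobolev_sqnormE s f : tintegrable f -> sobolev_sqnorm s f =
  (\sum_(n <oo) (wt s n * csq (fourier f n))%:E +
   \sum_(n <oo) (wt s n.+1 * csq (fourier f n.+1))%:E)%E.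
Proof.
move=> fi; rewrite /sobolev_sqnorm esum_int; last first.
  by move=> k; rewrite lee_fin mulr_ge0 ?powR_ge0// csq_ge0.
congr (_ + _)%E; apply: eq_eseriesr => n _.
by rewrite NegzE fourier_opp// -/(csq _) csq_conj mulrNz sqrrN.
Qed.

Lemma sobolev_sqnorm_le s f (B : R) : tintegrable f ->
  (forall n, \sum_(k < n) wt s k * csq (fc f k) <= B) ->
  (sobolev_sqnorm s f <= (2 * B)%:E)%E.
Proof.
move=> fi fB; have le k : wt s k * csq (fourier f k) <= wt s k * csq (fc f k).
  rewrite ler_wpM2l ?wt_ge0// csq_fc ler_peMl ?csq_ge0//.
  by rewrite /kap; case: ifP => _; rewrite ?expr1n//; lra.
have t0 k : 0 <= wt s k * csq (fourier f k) by rewrite mulr_ge0 ?wt_ge0 ?csq_ge0.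
rewrite sobolev_sqnormE// [2 * B]mulrDl !mul1r EFinD; apply: leeD.
  apply: nneseries_le => n; first by rewrite lee_fin.
  rewrite sumEFin lee_fin big_mkord; apply: le_trans (fB n).
  by apply: ler_sum => k _.
apply: nneseries_le => n; first by rewrite lee_fin.
rewrite sumEFin lee_fin big_mkord; apply: le_trans (fB n.+1).
rewrite [leRHS]big_ord_recl; apply: ler_wpDl; first by rewrite mulr_ge0 ?wt_ge0 ?csq_ge0.
by apply: ler_sum => k _.
Qed.

Lemma sobolev_bound s f : sobolev s f ->
  exists B, forall n, \sum_(k < n) wt s k * csq (fc f k) <= B.
Proof.
move=> [fL]; rewrite sobolev_sqnormE; last exact: L2_integrable.
set X := (X in (X + _)%E); set Y := (Y in (_ + Y)%E) => XY.
have t0 k : 0 <= wt s k * csq (fourier f k) by rewrite mulr_ge0 ?wt_ge0 ?csq_ge0.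
have Xfin : (X < +oo)%E.
  apply: le_lt_trans XY; apply: leeDl; apply: nneseries_ge0 => n _ _.
  by rewrite lee_fin.
have X0 : (0 <= X)%E by apply: nneseries_ge0 => n _ _; rewrite lee_fin.
exists (4 * fine X) => n.
apply: (@le_trans _ _ (4 * \sum_(k < n) wt s k * csq (fourier f k))).
  rewrite mulr_sumr; apply: ler_sum => k _; rewrite csq_fc mulrCA ler_wpM2r//.
  by rewrite /kap; case: ifP => _; rewrite ?expr1n; lra.
rewrite ler_wpM2l// -lee_fin fineK ?ge0_fin_numE//.
have := @nneseries_lim_ge R (fun n => (wt s n * csq (fourier f n))%:E) xpredT 0%N n.
by rewrite sumEFin big_mkord; apply => k _ _; rewrite lee_fin.
Qed.

Lemma sobolev_power_bound (m : nat) f : sobolev (m%:R / 2) f ->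
  exists B, forall n, \sum_(k < n) k%:R ^+ m * csq (fc f k) <= B.
Proof.
move=> /sobolev_bound[B HB]; exists B => n; apply: le_trans (HB n).
by apply: ler_sum => k _; rewrite ler_wpM2r ?csq_ge0 ?wt_ge.
Qed.

End SobolevSums.

Section Multipliers.
Context {R : realType}.
Implicit Types (f u h : R -> R).

Lemma L2_fourier_mult (m : int -> R[i]) f : L2_torus (fourier_mult m f).
Proof.
rewrite /fourier_mult; case: xgetP => [F _ []//|_]; exact: L2_cst.
Qed.

(** [fourier_mult] has its intended value as soon as some L^2 function has the prescribed
    coefficients. Square summability provides one by [riesz_fischer], and the conjugate symmetry of
    m together with the real mean lets it be real. *)
Lemma fc_fourier_mult (m : int -> R[i]) f (C : R) : tintegrable f ->
  (forall n : nat, m (- n%:Z) = (m n)^*%C) -> complex.Im (m 0 * fourier f 0) = 0 ->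
  (forall n, \sum_(k < n) csq (m k * fc f k) <= C) ->
  forall n : nat, fc (fourier_mult m f) n = m n * fc f n.
Proof.
move=> fL mN m0 mC.
have [||F [FL FE _]] := @riesz_fischer R (fun k : nat => m k * fc f k) C.
- by rewrite /fc mulrCA cImZ m0 mulr0.
- exact: mC.
have K n : ((kap n)^-1)%:C%C * (kap n)%:C%C = 1 :> R[i].
  by apply: complex_ext; rewrite ?cReZ ?cImZ /= ?mulr0// mulVf// gt_eqF// kap_gt0.
have FE' (n : nat) : fourier F n = m n * fourier f n.
  have := congr1 (fun z => ((kap n)^-1)%:C%C * z) (FE n).
  rewrite /fc mulrA K mul1r => ->; rewrite mulrCA; congr (_ * _).
  by rewrite mulrA K mul1r.
have H : [set F | L2_torus F /\ forall k, fourier F k = m k * fourier f k] F.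
  split => // k; case: (intP k) => [|n|n]; [exact: FE'|exact: FE'|].
  rewrite !fourier_opp ?FE' ?mN ?rmorphM//; exact: L2_integrable FL.
move=> n; have [_ /(_ n) e] := xgetPex (fun=> 0 : R) (ex_intro _ F H).
by rewrite /fc /fourier_mult e mulrCA.
Qed.

Lemma fc_hilbert f (C : R) : tintegrable f -> (forall n, \sum_(k < n) csq (fc f k) <= C) ->
  forall n, fc (hilbert f) n = if n == 0%N then 0 else - Complex 0 1 * fc f n.
Proof.
move=> fL fC n; rewrite (@fc_fourier_mult _ _ C)//.
- case: eqVneq => [->|n0]; first by rewrite sgz0 mulr0 mul0r.
  by rewrite gtr0_sgz ?mulr1//; lia.
- move=> k; rewrite sgzN mulrNz mulrN; case: (sgzP k%:Z) => _;
  by apply: complex_ext; rewrite /= ?(mulr0, mul0r, mulr1, oppr0, addr0, subr0, opprK).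
- by rewrite sgz0 mulr0 mul0r.
move=> m; apply: le_trans (fC m); apply: ler_sum => k _; rewrite csqM ler_piMl ?csq_ge0//.
rewrite csqM /csq /= oppr0 expr0n sqrrN expr1n add0r mul1r.
by case: sgzP => _ /=; rewrite ?(expr0n, expr1n, addr0, sqrrN, oppr0).
Qed.

Lemma fc_Lambda f (C : R) : tintegrable f ->
  (forall n, \sum_(k < n) k%:R ^+ 2 * csq (fc f k) <= C) ->
  forall n, fc (Lambda f) n = n%:R * fc f n.
Proof.
move=> fL fC n; rewrite (@fc_fourier_mult _ _ C)//.
- move=> k; rewrite normrN -[_%:~R]/(k%:R : R[i]) natC.
  by apply: complex_ext; rewrite /= ?oppr0.
- by rewrite normr0 mul0r.
move=> m; apply: le_trans (fC m); apply: ler_sum => k _.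
by rewrite -[_%:~R]/(k%:R : R[i]) natC csqZ.
Qed.

Lemma fc_d_alpha f (C : R) : tintegrable f ->
  (forall n, \sum_(k < n) k%:R ^+ 2 * csq (fc f k) <= C) ->
  forall n, fc (d_alpha f) n = Complex 0 1 * n%:R * fc f n.
Proof.
move=> fL fC n; rewrite (@fc_fourier_mult _ _ C)//.
- move=> k; rewrite mulrNz -[k%:Z%:~R]/(k%:R : R[i]) natC.
  by apply: complex_ext; rewrite /=; ring.
- by rewrite mulr0 mul0r.
move=> m; apply: le_trans (fC m); apply: ler_sum => k _.
rewrite -[(k%:Z)%:~R]/(k%:R : R[i]) natC !csqM /csq /=.
by rewrite !(expr0n, expr1n, addr0, add0r, mul1r).
Qed.

End Multipliers.

Section ConvolutionBounds.
Context {R : realType}.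

Lemma cauchy_sum_le (a b : nat -> R) n : (forall k, 0 <= a k) -> (forall k, 0 <= b k) ->
  \sum_(k < n) cprod a b k <= (\sum_(k < n) a k) * \sum_(k < n) b k.
Proof.
move=> a0 b0; rewrite /cprod (tri_sum (fun k j => a (k - j)%N * b j)) mulr_sumr.
apply: ler_sum => j _; rewrite -mulr_suml ler_wpM2r//.
under eq_bigr => m _ do rewrite addKn.
by apply: ler_sum_ord_prefix => //; rewrite leq_subr.
Qed.

Lemma sum_sqr_le (a : nat -> R) n : (forall k, 0 <= a k) ->
  \sum_(k < n) a k ^+ 2 <= (\sum_(k < n) a k) ^+ 2.
Proof.
move=> a0; rewrite expr2 mulr_suml; apply: ler_sum => k _; rewrite expr2 ler_wpM2l//.
by rewrite (bigD1 k)//= lerDl sumr_ge0.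
Qed.

Lemma cabs_sum_le (a : nat -> R) (B : R) n : (forall k, 0 <= a k) ->
  (forall n, \sum_(k < n) k%:R ^+ 4 * a k ^+ 2 <= B) ->
  \sum_(k < n) k%:R * a k <= 1 + B / 2 /\ \sum_(k < n) a k <= a 0%N + (1 + B / 2).
Proof.
move=> a0 aB; have E k : cabs (a k)%:C%C = a k.
  by rewrite /cabs /csq /= expr0n addr0 sqrtr_sqr ger0_norm.
have h m : \sum_(k < m) k%:R * a k <= 1 + B / 2.
  have := @sum_k_cabs R (fun k => (a k)%:C%C) m B.
  under eq_bigr => k _ do rewrite /csq /= expr0n addr0.
  move=> /(_ (aB m)); apply: le_trans; apply: ler_sum => k _.
  by rewrite E.
split => //; case: n => [|n].
  by rewrite big_ord0 addr_ge0//; apply: le_trans (h 0%N); rewrite big_ord0.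
rewrite big_ord_recl lerD2l; apply: le_trans (h n.+1).
rewrite [leRHS]big_ord_recl mul0r add0r; apply: ler_sum => k _ /=.
by rewrite ler_peMl// ler1n.
Qed.

(** By the Leibniz rule k (a a)_k is twice the coefficient of a Da. The l^1 norms of a and Da
    multiply under convolution, and the l^2 norm is at most the l^1 norm. *)
Lemma derivative_square_bound (a : nat -> R) (B : R) : (forall k, 0 <= a k) ->
  (forall n, \sum_(k < n) k%:R ^+ 4 * a k ^+ 2 <= B) ->
  forall n, \sum_(k < n) (k%:R * cprod a a k) ^+ 2 <=
    (2 * ((a 0%N + (1 + B / 2)) * (1 + B / 2))) ^+ 2.
Proof.
move=> a0 aB n.
have c0 k : 0 <= k%:R * cprod a a k.
  by rewrite mulr_ge0// /cprod sumr_ge0// => j _; rewrite mulr_ge0.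
apply: (le_trans (sum_sqr_le n c0)).
have S0 : 0 <= \sum_(k < n) k%:R * cprod a a k by exact: sumr_ge0.
have d0 j : 0 <= j%:R * a j by rewrite mulr_ge0.
have h : \sum_(k < n) k%:R * cprod a a k <=
    2 * ((a 0%N + (1 + B / 2)) * (1 + B / 2)).
  have E k : k%:R * cprod a a k = 2 * cprod a (fun j => j%:R * a j) k.
    rewrite mulr2n mulrDl !mul1r {1}/cprod mulr_sumr.
    rewrite [X in _ = X + _]cprodC /cprod -big_split; apply: eq_bigr => j _ /=.
    have jk : (j <= k)%N by rewrite -ltnS.
    by rewrite natrB//; ring.
  under eq_bigr => k _ do rewrite E.
  rewrite -mulr_sumr ler_wpM2l//; apply: (le_trans (cauchy_sum_le n a0 d0)).
  have [h1 h2] := cabs_sum_le n a0 aB.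
  by apply: ler_pM => //; exact: sumr_ge0.
by rewrite ler_sqr// nnegrE// (le_trans S0 h).
Qed.

Lemma cabs_cprod_le (w : nat -> R[i]) (a : nat -> R) k : (forall j, cabs (w j) <= a j) ->
  cabs (cprod w w k) <= cprod a a k.
Proof.
move=> wa; rewrite /cprod.
have tri n (F : nat -> R[i]) : cabs (\sum_(j < n) F j) <= \sum_(j < n) cabs (F j).
  elim: n => [|n IH]; first by rewrite !big_ord0 cabs0.
  rewrite !big_ord_recr /=; apply: le_trans (_ : cabs (\sum_(j < n) F j) + cabs (F n) <= _).
    have := ler_cabsB (\sum_(j < n) F j) (- F n); rewrite opprK.
    by rewrite {3}/cabs /csq cReN cImN !sqrrN.
  by rewrite lerD2r.
apply: (le_trans (tri _ (fun j => w (k - j)%N * w j))); apply: ler_sum => j _.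
by rewrite cabsM ler_pM ?cabs_ge0.
Qed.

End ConvolutionBounds.

(** * Fourier coefficients of the right-hand side of the equation *)

Section ModelRightHandSide.
Context {R : realType}.
Implicit Types (h u : R -> R).

Lemma square_sum_of_quartic (w : nat -> R[i]) (B : R) :
  (forall n, \sum_(k < n) k%:R ^+ 4 * csq (w k) <= B) ->
  forall n, \sum_(k < n) csq (w k) <= csq (w 0%N) + B.
Proof.
move=> wB n; apply: (@le_trans _ _ (\sum_(k < n.+1) csq (w k))).
  by apply: (@ler_sum_ord_prefix _ _ _ (fun k => csq (w k))) => // k; exact: csq_ge0.
rewrite big_ord_recl lerD2l; apply: le_trans (wB n.+1).
rewrite [leRHS]big_ord_recl expr0n mul0r add0r; apply: ler_sum => k _ /=.
by rewrite ler_peMl ?csq_ge0// exprn_ege1// ler1n.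
Qed.

Lemma natpow_le (k p q : nat) : (0 < p)%N -> (p <= q)%N -> k%:R ^+ p <= k%:R ^+ q :> R.
Proof.
case: k => [|k] p0 pq; first by rewrite !expr0n !eqn0Ngt p0 (leq_trans p0 pq).
by rewrite ler_weXn2l// ler1n.
Qed.

Lemma power_sum_le (w : nat -> R[i]) (B : R) (p q : nat) : (0 < p)%N -> (p <= q)%N ->
  (forall n, \sum_(k < n) k%:R ^+ q * csq (w k) <= B) ->
  forall n, \sum_(k < n) k%:R ^+ p * csq (w k) <= B.
Proof.
move=> p0 pq wB n; apply: le_trans (wB n); apply: ler_sum => k _.
by rewrite ler_wpM2r ?csq_ge0// natpow_le.
Qed.

(** The link between the equation and the mode system. Every multiplier is evaluated only after a
    summability bound has excluded its default value. *)
Lemma fc_h_model_rhs (sigma rhop rhom g B : R) h u :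
  L2_torus h -> L2_torus u ->
  (forall n, \sum_(k < n) k%:R ^+ 4 * csq (fc u k) <= B) ->
  (forall n, \sum_(k < n) k%:R ^+ 5 * csq (fc h k) <= B) ->
  (sigma != 0 -> forall n, \sum_(k < n) k%:R ^+ 7 * csq (fc h k) <= B) ->
  L2_torus (h_model_rhs sigma rhop rhom g h u) /\
  forall k, fc (h_model_rhs sigma rhop rhom g h u) k =
    mode_rhs (atwood rhop rhom) g (sigma / (rhop + rhom)) (fc u) (fc h) k.
Proof.
move=> hL uL uB hB5 hB7.
set A := atwood _ _; set s := sigma / _.
have L1L : L2_torus (Lambda h) by exact: L2_fourier_mult.
have L2L : L2_torus (Lambda (Lambda h)) by exact: L2_fourier_mult.
have L3L : L2_torus (Lambda (Lambda (Lambda h))) by exact: L2_fourier_mult.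
have HL : L2_torus (hilbert u) by exact: L2_fourier_mult.
pose P y := u y * hilbert u y.
have dL : L2_torus (d_alpha P) by exact: L2_fourier_mult.
have u2 := square_sum_of_quartic uB.
have fP k : fc P k = if k == 0%N then 0 else - Complex 0 2^-1 * cprod (fc u) (fc u) k.
  by apply: (hilbert_product k uL HL u2) => j; exact: (fc_hilbert (L2_integrable uL) u2).
have Pi : tintegrable P by exact: L2_integrableM.
have u4 n : \sum_(k < n) k%:R ^+ 4 * cabs (fc u k) ^+ 2 <= B.
  by under eq_bigr => k _ do rewrite cabs_sq; exact: uB.
have P2 n : \sum_(k < n) k%:R ^+ 2 * csq (fc P k) <=
    (2 * ((cabs (fc u 0%N) + (1 + B / 2)) * (1 + B / 2))) ^+ 2.
  have := derivative_square_bound (fun k => cabs_ge0 (fc u k)) u4 n.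
  apply: le_trans; apply: ler_sum => k _; rewrite exprMn ler_wpM2l ?sqr_ge0//.
  rewrite fP; case: eqP => _; first by rewrite csq0 sqr_ge0.
  rewrite csqM; apply: (@le_trans _ _ (csq (cprod (fc u) (fc u) k))).
    rewrite ler_piMl ?csq_ge0// /csq /= oppr0 expr0n add0r sqrrN.
    by rewrite exprn_ile1// invf_le1// ler1n.
  rewrite -cabs_sq ler_sqr ?nnegrE ?cabs_ge0//; first exact: cabs_cprod_le.
  by rewrite /cprod sumr_ge0// => j _; rewrite mulr_ge0 ?cabs_ge0.
have fd k : fc (d_alpha P) k = Complex 0 1 * k%:R * fc P k by exact: fc_d_alpha Pi P2 k.
have hi := L2_integrable hL.
have fL k : fc (Lambda h) k = k%:R * fc h k.
  exact: (fc_Lambda hi (@power_sum_le _ B 2 5 isT isT hB5) k).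
have fL3 k : s%:C%C * fc (Lambda (Lambda (Lambda h))) k = (s * k%:R ^+ 3)%:C%C * fc h k.
  (* For sigma = 0 the third power of [Lambda] may be a default value, but its coefficient
     vanishes. *)
  have [s0|s0] := eqVneq sigma 0.
    by rewrite /s s0 !mul0r.
  have h7 := hB7 s0.
  have f2 j : fc (Lambda (Lambda h)) j = j%:R * fc (Lambda h) j.
    apply: (@fc_Lambda _ _ B (L2_integrable L1L) _ j) => n.
    under eq_bigr => i _ do rewrite fL natC csqZ mulrA -exprD.
    exact: (@power_sum_le _ B 4 7 isT isT h7).
  have f3 j : fc (Lambda (Lambda (Lambda h))) j = j%:R * fc (Lambda (Lambda h)) j.
    apply: (@fc_Lambda _ _ B (L2_integrable L2L) _ j) => n.
    apply: le_trans (@power_sum_le _ B 6 7 isT isT h7 n); apply: ler_sum => i _.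
    rewrite f2 fL natC 2!csqZ; set X := csq _.
    by rewrite [leLHS](_ : _ = i%:R ^+ 6 * X)//; ring.
  rewrite f3 f2 fL natC; apply: complex_ext; rewrite !(cReZ, cImZ); ring.
have E : h_model_rhs sigma rhop rhom g h u = fun x =>
    A * g * Lambda h x - s * Lambda (Lambda (Lambda h)) x - A * d_alpha P x by [].
rewrite E; have i1 := L2_Z (A * g) L1L; have i2 := L2_Z s L3L; have i3 := L2_Z A dL.
have i12 := L2_B i1 i2; split; first exact: L2_B.
move=> k; rewrite !fcB; try exact: L2_integrable.
rewrite !fcZ; try exact: L2_integrable.
rewrite fL3 fL fd fP /mode_rhs /dispersion natC.
move: (fc h k) (cprod (fc u) (fc u) k) => X Y; case: eqVneq => [->|k0].
  by apply: complex_ext; rewrite !(cReD, cImD, cReN, cImN, cReM, cImM) /=; ring.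
by apply: complex_ext; rewrite !(cReD, cImD, cReN, cImN, cReM, cImM) /=; ring.
Qed.

End ModelRightHandSide.

(** * Evolution spaces *)

Section EvolutionSpaces.
Context {R : realType}.
Local Notation mu := (@lebesgue_measure R).

Lemma time_intervalE (T t : R) : time_interval T%:E t <-> 0 <= t <= T.
Proof. by rewrite /time_interval /= lee_fin; split => [[-> ->]|/andP]. Qed.

Lemma cvg_ereal0 (F : set_system R) (f : R -> \bar R) : Filter F ->
  (forall r, (0 <= f r)%E) ->
  (forall e : R, 0 < e -> \forall r \near F, (f r <= e%:E)%E) ->
  f r @[r --> F] --> 0%E.
Proof.
move=> FF f0 H A [e /= e0 hA]; have e2 : 0 < e / 2 by rewrite divr_gt0.
have := H _ e2; apply: filterS => r fr.
change (A (f r)); move: (f0 r) fr.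
case: (f r) => [y| |] //=; rewrite !lee_fin => y0 ye.
by apply: hA; rewrite /ball_ /= sub0r normrN ger0_norm//; lra.
Qed.

Lemma csqB_le (x y : R[i]) : csq (x - y) <= 2 * csq x + 2 * csq y.
Proof.
case: x y => [a b] [c d]; rewrite /csq /=.
have := sqr_ge0 (a + c); have := sqr_ge0 (b + d); lra.
Qed.

Lemma sum_split_le (a m : nat -> R) (N n : nat) : (forall k, 0 <= a k) ->
  (forall k, a k <= m k) ->
  \sum_(k < n) a k <= \sum_(k < N) a k + (\sum_(k < n) m k - \sum_(k < N) m k) \/
  \sum_(k < n) a k <= \sum_(k < N) a k.
Proof.
move=> a0 am; have [nN|Nn] := leqP n N; [right|left].
  exact: ler_sum_ord_prefix.
rewrite -!(big_mkord xpredT) !(@big_cat_nat _ _ _ N 0 n)//=; try exact: ltnW.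
by rewrite addrAC subrr add0r lerD2l; apply: ler_sum => k _.
Qed.

(** Dominated convergence for series, uniformly in the number of terms: the tail of m costs e / 2,
    and so do the finitely many remaining terms near the limit. *)
Lemma dominated_sums (F : set_system R) (a : R -> nat -> R) (m : nat -> R) (C : R) :
  Filter F -> (forall r k, 0 <= a r k) ->
  (\forall r \near F, forall k, a r k <= m k) -> (forall k, 0 <= m k) ->
  (forall n, \sum_(k < n) m k <= C) ->
  (forall N, \sum_(k < N) a r k @[r --> F] --> 0) ->
  forall e, 0 < e -> \forall r \near F, forall n, \sum_(k < n) a r k <= e.
Proof.
move=> FF a0 am m0 mC aN e e0; have e2 : 0 < e / 2 by rewrite divr_gt0.
have [N HN] := tail_small m0 mC e2.
have := aN N => /cvgrPdist_le /(_ _ e2) h.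
near=> r => n.
have h1 : \sum_(k < N) a r k <= e / 2.
  have : `|0 - \sum_(k < N) a r k| <= e / 2 by near: r.
  by rewrite sub0r normrN ger0_norm// sumr_ge0.
have h2 : forall k, a r k <= m k by near: r.
have := HN N n (leqnn N).
by have [|] := sum_split_le N n (a0 r) h2; lra.
Unshelve. all: by end_near. Qed.

Lemma continuous_csq (f : R -> R[i]) : ccontinuous f -> continuous (fun t => csq (f t)).
Proof.
move=> [f1 f2]; rewrite /csq; under eq_fun do rewrite !expr2.
by apply: continuous_add; exact: continuous_mul.
Qed.

Lemma ccontinuousB (f g : R -> R[i]) : ccontinuous f -> ccontinuous g ->
  ccontinuous (fun t => f t - g t).
Proof.
move=> [f1 f2] [g1 g2]; split.
  under eq_fun do rewrite cReD cReN.
  by move=> t; apply: continuousB; [exact: f1|exact: g1].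
under eq_fun do rewrite cImD cImN.
by move=> t; apply: continuousB; [exact: f2|exact: g2].
Qed.

(** Continuity of each coefficient and a summable majorant independent of time suffice, by
    [dominated_sums]; differences are dominated by 4 m. *)
Lemma continuous_sobolev_intro (T s C : R) (u : R -> R -> R)
    (U : nat -> R -> R[i]) (m : nat -> R) :
  (forall t, 0 <= t <= T -> L2_torus (u t)) ->
  (forall t k, 0 <= t <= T -> fc (u t) k = U k t) ->
  (forall k, ccontinuous (U k)) ->
  (forall t k, 0 <= t <= T -> wt s k * csq (U k t) <= m k) ->
  (forall n, \sum_(k < n) m k <= C) ->
  continuous_sobolev T%:E s u.
Proof.
move=> uL uU cU Um mC t /time_intervalE tT.
have ui r : 0 <= r <= T -> tintegrable (u r) by move=> /uL; exact: L2_integrable.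
split.
  split; first exact: uL.
  apply: le_lt_trans (ltry (2 * C)); apply: sobolev_sqnorm_le; first exact: ui.
  by move=> n; apply: le_trans (mC n); apply: ler_sum => k _; rewrite uU// Um.
have m0 k : 0 <= m k.
  by apply: le_trans (Um t k tT); rewrite mulr_ge0 ?wt_ge0 ?csq_ge0.
have m40 k : 0 <= 4 * m k by rewrite mulr_ge0.
have m4C n : \sum_(k < n) 4 * m k <= 4 * C by rewrite -mulr_sumr ler_wpM2l.
pose a r k := wt s k * csq (U k r - U k t).
have a0 r k : 0 <= a r k by rewrite mulr_ge0 ?wt_ge0 ?csq_ge0.
have key : forall e, 0 < e ->
    \forall r \near within (time_interval T%:E) (nbhs t), forall n, \sum_(k < n) a r k <= e.
  apply: (@dominated_sums _ a _ (4 * C) _ a0 _ m40 m4C).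
    near=> r => k; have rT : 0 <= r <= T.
      by apply/time_intervalE; near: r; exact: near_withinT.
    apply: (@le_trans _ _ (wt s k * (2 * csq (U k r) + 2 * csq (U k t)))).
      by rewrite ler_wpM2l ?wt_ge0// csqB_le.
    have := Um r k rT; have := Um t k tT; lra.
  move=> N; apply: cvg_within_filter.
  have c : continuous (fun r => \sum_(k < N) a r k).
    apply: (@continuous_sum _ N (fun k r => a r k)) => k; apply: continuous_mul.
      exact: cst_continuous.
    apply: continuous_csq; apply: ccontinuousB; first exact: cU.
    exact: ccontinuous_cst.
  have := c t; rewrite /continuous_at [X in _ --> X](_ : _ = 0)//.
  by apply: big1 => k _; rewrite /a subrr csq0 mulr0.
apply: cvg_ereal0 => [r|e e0].
  apply: esum_ge0 => k _; rewrite lee_fin mulr_ge0 ?powR_ge0//.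
  by rewrite addr_ge0 ?sqr_ge0.
have e2 : 0 < e / 2 by rewrite divr_gt0.
near=> r; have rT : 0 <= r <= T.
  by apply/time_intervalE; near: r; exact: near_withinT.
have ar n : \sum_(k < n) a r k <= e / 2 by move: n; near: r; exact: key.
have -> : e = 2 * (e / 2) by field.
apply: sobolev_sqnorm_le => [|n].
  by apply: tintegrableB; exact: ui.
apply: le_trans (ar n); apply: ler_sum => k _.
by rewrite fcB ?uU//; exact: ui.
Unshelve. all: by end_near. Qed.

(** The mean value theorem is applied to the real and the imaginary part separately, at different
    points; hence the factor 2. *)
Lemma csq_mean_value_le (f f' : R -> R[i]) (r t B : R) :
  (forall x, has_cderiv f x (f' x)) ->
  (forall x, Num.min r t <= x <= Num.max r t -> csq (f' x) <= B) ->
  csq (((r - t)^-1)%:C%C * (f r - f t)) <= 2 * B.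
Proof.
move=> df fB.
have real_mv (p p' : R -> R) : (forall x, has_deriv p x (p' x)) ->
    (forall x, Num.min r t <= x <= Num.max r t -> p' x ^+ 2 <= B) ->
    ((r - t)^-1 * (p r - p t)) ^+ 2 <= B.
  move=> dp pB; have B0 : 0 <= B.
    by apply: le_trans (sqr_ge0 _) (pB r _); rewrite ge_min le_max !lexx.
  have mv (a b : R) : a < b -> Num.min a b = Num.min r t -> Num.max a b = Num.max r t ->
     (p b - p a) ^+ 2 <= B * (b - a) ^+ 2.
    move=> ab mn mx.
    have [||c + ->] := @MVT_segment R p p' a b (ltW ab).
    - by move=> x _; exact: dp.
    - apply: continuous_subspaceT => x; exact: deriv_continuous (dp x).
    rewrite in_itv /= => cab; rewrite exprMn ler_wpM2r ?sqr_ge0//; apply: pB.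
    by rewrite -mn -mx min_l ?max_r ?(ltW ab).
  have [rt|tr|->] := ltgtP r t; last by rewrite !subrr mulr0 expr0n.
    rewrite exprMn mulrC exprVn ler_pdivrMr ?exprn_even_gt0//= ?subr_eq0 ?lt_eqF//.
    by have := mv r t rt erefl erefl; rewrite -sqrrN opprB -[in leRHS]sqrrN opprB.
  rewrite exprMn mulrC exprVn ler_pdivrMr ?exprn_even_gt0//= ?subr_eq0 ?gt_eqF//.
  by apply: mv => //; [exact: minC|exact: maxC].
have h1 := real_mv _ _ (fun x => (df x).1).
have h2 := real_mv _ _ (fun x => (df x).2).
rewrite /csq !cReZ !cImZ !cReD !cImD !cReN !cImN mulr2n mulrDl mul1r.
by apply: lerD; [apply: h1|apply: h2] => x xrt; apply: le_trans (fB x xrt);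
  rewrite /csq ?lerDl ?lerDr sqr_ge0.
Qed.

Lemma deriv_quotient (f : R -> R) (t a : R) : has_deriv f t a ->
  (r - t)^-1 * (f r - f t) @[r --> t^'] --> a.
Proof.
move=> /is_derive1_caratheodory[h [fE ch ha]].
apply: cvg_trans (_ : h r @[r --> t^'] `=>` nbhs a).
  apply: near_eq_cvg; near=> r; rewrite fE mulrC mulfK// subr_eq0.
  by near: r; exact: nbhs_dnbhs_neq.
by rewrite -ha; apply: cvg_within_filter; exact: ch.
Unshelve. all: by end_near. Qed.

End EvolutionSpaces.

(** * Time derivatives and integrability in time, read off the coefficients *)

Section TimeRegularity.
Context {R : realType}.
Local Notation mu := (@lebesgue_measure R).

Lemma time_derivative_intro (T C : R) (u v : R -> R -> R)
    (U V : nat -> R -> R[i]) (m : nat -> R) :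
  (forall t, 0 <= t <= T -> L2_torus (u t) /\ L2_torus (v t)) ->
  (forall t k, 0 <= t <= T -> fc (u t) k = U k t /\ fc (v t) k = V k t) ->
  (forall k t, has_cderiv (U k) t (V k t)) ->
  (forall t k, 0 <= t <= T -> csq (V k t) <= m k) ->
  (forall n, \sum_(k < n) m k <= C) ->
  is_time_derivative T%:E u v.
Proof.
move=> uvL uvU dU Vm mC t /time_intervalE tT.
have [uL vL] := uvL t tT; split => //.
pose q r x := (u r x - u t x) / (r - t) - v t x.
pose a r k := csq ((r - t)^-1%:C%C * (U k r - U k t) - V k t).
have qE r : q r = fun x => (r - t)^-1 * (u r x - u t x) - v t x.
  by apply/funext => x; rewrite /q mulrC.
have qL r : 0 <= r <= T -> L2_torus (q r).
  by move=> /uvL[urL _]; rewrite qE; apply: L2_B => //; apply: L2_Z; exact: L2_B.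
have fq r k : 0 <= r <= T -> csq (fc (q r) k) = a r k.
  move=> rT; have [urL _] := uvL r rT.
  rewrite qE fcB; [|by apply/L2_integrable/L2_Z; exact: L2_B|exact: L2_integrable].
  rewrite fcZ; last by apply/L2_integrable; exact: L2_B.
  rewrite fcB; [|exact: L2_integrable..].
  by rewrite (uvU r k rT).1 (uvU t k tT).1 (uvU t k tT).2.
have m0 k : 0 <= m k by apply: le_trans (Vm t k tT); exact: csq_ge0.
(* By the mean value bound the difference quotient has squared modulus at most 2 m; subtracting the
   derivative gives 2 (2 m) + 2 m. *)
have m60 k : 0 <= 6 * m k by rewrite mulr_ge0.
have m6C n : \sum_(k < n) 6 * m k <= 6 * C by rewrite -mulr_sumr ler_wpM2l.
have key : forall e, 0 < e ->
    \forall r \near within (time_interval T%:E) t^', forall n, \sum_(k < n) a r k <= e.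
  apply: (@dominated_sums _ _ a _ (6 * C) _ (fun r k => csq_ge0 _) _ m60 m6C).
    near=> r => k; have rT : 0 <= r <= T.
      by apply/time_intervalE; near: r; exact: near_withinT.
    apply: (le_trans (csqB_le _ _)).
    have h1 : csq ((r - t)^-1%:C%C * (U k r - U k t)) <= 2 * m k.
      apply: (csq_mean_value_le (dU k)) => x /andP[x1 x2]; apply: Vm.
      move: tT rT x1 x2; rewrite ge_min le_max => /andP[t0 tT] /andP[r0 rT].
      by move=> /orP[h1|h1] /orP[h2|h2]; apply/andP; split; lra.
    by have := Vm t k tT; lra.
  move=> N; apply: cvg_within_filter.
  elim: N => [|N IH].
    by under eq_fun do rewrite big_ord0; exact: cvg_cst.
  have [dr di] := dU N t.
  have cr : ((r - t)^-1 * (complex.Re (U N r) - complex.Re (U N t)) - complex.Re (V N t))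
      @[r --> t^'] --> 0.
    by rewrite -(subrr (complex.Re (V N t))); apply: cvgB; [exact: deriv_quotient|exact: cvg_cst].
  have ci : ((r - t)^-1 * (complex.Im (U N r) - complex.Im (U N t)) - complex.Im (V N t))
      @[r --> t^'] --> 0.
    by rewrite -(subrr (complex.Im (V N t))); apply: cvgB; [exact: deriv_quotient|exact: cvg_cst].
  have c := cvgD IH (cvgD (cvgM cr cr) (cvgM ci ci)); rewrite !mul0r !addr0 in c.
  rewrite (_ : (fun r => \sum_(k < N.+1) a r k) = (fun r => \sum_(k < N) a r k +
    (((r - t)^-1 * (complex.Re (U N r) - complex.Re (U N t)) - complex.Re (V N t)) *
     ((r - t)^-1 * (complex.Re (U N r) - complex.Re (U N t)) - complex.Re (V N t)) +
     ((r - t)^-1 * (complex.Im (U N r) - complex.Im (U N t)) - complex.Im (V N t)) *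
     ((r - t)^-1 * (complex.Im (U N r) - complex.Im (U N t)) - complex.Im (V N t))))).
    exact: c.
  apply/funext => r; rewrite big_ord_recr /= /a /csq !cReD !cImD !cReN !cImN !cReZ !cImZ.
  by rewrite !cReD !cImD !cReN !cImN !expr2.
apply: cvg_ereal0 => [r|e e0].
  by apply: integral_ge0 => x _; rewrite lee_fin sqr_ge0.
have P := @pi2_gt0 R; have e2 : 0 < e / (pi *+ 2) by rewrite divr_gt0.
near=> r; have rT : 0 <= r <= T.
  by apply/time_intervalE; near: r; exact: near_withinT.
have ar n : \sum_(k < n) a r k <= e / (pi *+ 2) by move: n; near: r; exact: key.
rewrite -/(q r) l2_sqnormE ?lee_fin; last exact: qL.
have -> : e = pi *+ 2 * (e / (pi *+ 2)).
  by clear - P; move: (pi *+ 2) P => p p0; field; lra.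
apply: parseval_le => [|n]; first exact: qL.
by under eq_bigr => k _ do rewrite fq//; exact: ar.
Unshelve. all: by end_near. Qed.

Lemma time_interval_itv (T : R) : time_interval T%:E = `[0, T]%classic.
Proof.
by apply/seteqP; split => t; rewrite /= in_itv /= => /time_intervalE.
Qed.

Lemma integral_deriv (F f : R -> R) (T : R) : 0 < T ->
  (forall t, has_deriv F t (f t)) -> continuous f ->
  (\int[mu]_(t in `[0%R, T]) (f t)%:E)%E = (F T - F 0)%:E.
Proof.
move=> T0 dF cf; rewrite EFinB; apply: continuous_FTC2 => //.
- exact: continuous_subspaceT.
- have cF : continuous F by move=> t; exact: deriv_continuous (dF t).
  split.
  + by move=> x _; have := dF x; rewrite /has_deriv => ?; exact: ex_derive.
  + by apply: cvg_at_right_filter; exact: cF.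
  + by apply: cvg_at_left_filter; exact: cF.
- by move=> x _; rewrite derive1E; have := dF x; rewrite /has_deriv => ?; exact: derive_val.
Qed.

Lemma fourier_of_fc (f : R -> R) (k : nat) : fourier f k = ((kap k)^-1)%:C%C * fc f k.
Proof.
rewrite /fc mulrA [X in X * _](_ : _ = 1) ?mul1r//.
by apply: complex_ext; rewrite ?cReZ ?cImZ /= ?mulr0// mulVf// gt_eqF// kap_gt0.
Qed.

(** The Sobolev norm is a series of nonnegative continuous functions of time, integrated term by
    term. Each term is compared with the increment of Gam, except the mean, for which k^5 gives
    nothing and c0 is used. *)
Lemma square_integrable_intro (T C c0 : R) (u : R -> R -> R)
    (U : nat -> R -> R[i]) (Gam : nat -> R -> R) : 0 < T ->
  (forall t, 0 <= t <= T -> L2_torus (u t)) ->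
  (forall t k, 0 <= t <= T -> fc (u t) k = U k t) ->
  (forall k, ccontinuous (U k)) ->
  (forall t, 0 <= t <= T -> csq (U 0%N t) <= c0) ->
  (forall k t, has_deriv (Gam k) t (k%:R ^+ 5 * csq (U k t))) ->
  (forall n, \sum_(k < n) (Gam k T - Gam k 0) <= C) ->
  square_integrable_sobolev T%:E (5 / 2) u.
Proof.
move=> T0 uL uU cU U0 dGam GamC.
have ui t : 0 <= t <= T -> tintegrable (u t) by move=> /uL; exact: L2_integrable.
have inI t : `[0, T]%classic t -> 0 <= t <= T by rewrite /= in_itv.
pose y n t := wt (5 / 2) n * (kap n ^- 2 * csq (U n t)).
have y0 n t : 0 <= y n t.
  by rewrite mulr_ge0 ?wt_ge0// mulr_ge0 ?csq_ge0// invr_ge0 sqr_ge0.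
have cy n : continuous (y n).
  apply: continuous_mul; first exact: cst_continuous.
  by apply: continuous_mul; [exact: cst_continuous|exact: continuous_csq].
have fy t n : 0 <= t <= T -> wt (5 / 2) n * csq (fourier (u t) n) = y n t.
  by move=> tT; rewrite fourier_of_fc csqZ uU// exprVn.
pose c n t := y n t + y n.+1 t.
have cc n : continuous (c n) by exact: continuous_add.
have c_ge0 n t : 0 <= c n t by exact: addr_ge0.
pose Q t : \bar R := (\sum_(n <oo) (c n t)%:E)%E.
have sQ t : 0 <= t <= T -> sobolev_sqnorm (5 / 2) (u t) = Q t.
  move=> tT; rewrite sobolev_sqnormE; last exact: ui.
  rewrite -nneseriesD; [|by move=> n _; rewrite lee_fin fy..].
  by apply: eq_eseriesr => n _; rewrite !fy.
have mc n : @measurable_fun _ _ (measurableTypeR R) _ `[0, T]%classic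
    (fun t => (c n t)%:E : \bar R).
  apply/measurable_EFinP; apply: measurable_funS (continuous_measurable_fun (cc n)) => //.
have mI : (@measurable _ (measurableTypeR R)) `[0, T]%classic by exact: measurable_itv.
have mQ : @measurable_fun _ _ (measurableTypeR R) _ `[0, T]%classic Q.
  by apply: ge0_emeasurable_sum => [k t _ _|k _]; [rewrite lee_fin|exact: mc].
have [P HP] := choice (fun n => primitive_exists (cc n)).
(* 32 = 2^5 is the constant of [wt_le]; the factor 2 accounts for the two half-lines of
   frequencies. *)
have sumP n : \sum_(k < n) (P k T - P k 0) <= 2 * (c0 * T + 32 * C).
  have h : \sum_(k < n) P k T - \sum_(k < n) P k 0 <=
    2 * (c0 * T + 32 * \sum_(k < n.+1) Gam k T) - 2 * (c0 * 0 + 32 * \sum_(k < n.+1) Gam k 0).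
    apply: (@deriv_mono R (fun t => \sum_(k < n) P k t)
      (fun t => 2 * (c0 * t + 32 * \sum_(k < n.+1) Gam k t))
      (fun t => \sum_(k < n) c k t)
      (fun t => 2 * (c0 * 1 + 32 * \sum_(k < n.+1) k%:R ^+ 5 * csq (U k t))) 0 T (ltW T0)).
    - by move=> t _; apply: (@deriv_sum R n P (c^~ t)) => k _; exact: (HP k).2.
    - move=> t _; apply: deriv_scale; apply: deriv_add.
        by apply: deriv_scale; exact: deriv_id.
      apply: deriv_scale.
      by apply: (@deriv_sum R n.+1 Gam (fun k => k%:R ^+ 5 * csq (U k t))).
    move=> t tT.
    have h1 : \sum_(k < n) y k t <= \sum_(k < n.+1) y k t.
      by apply: (@ler_sum_ord_prefix R n n.+1 (y^~ t)).
    have h2 : \sum_(k < n) y k.+1 t <= \sum_(k < n.+1) y k t.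
      by rewrite [leRHS]big_ord_recl lerDr.
    have h3 : \sum_(k < n.+1) y k t <= c0 + 32 * \sum_(k < n.+1) k%:R ^+ 5 * csq (U k t).
      rewrite big_ord_recl [in leRHS]big_ord_recl /= expr0n mul0r add0r; apply: lerD.
        by rewrite /y wt0 /kap /= expr1n invr1 !mul1r U0.
      rewrite mulr_sumr; apply: ler_sum => k _; rewrite /y /=.
      apply: (@le_trans _ _ (wt (5 / 2) k.+1 * csq (U k.+1 t))).
        rewrite ler_wpM2l ?wt_ge0// ler_piMl ?csq_ge0// /kap /=.
        by rewrite invf_le1// expr2; lra.
      rewrite mulrA ler_wpM2r ?csq_ge0//.
      by apply: (le_trans (@wt_le R 5 k.+1 isT)); rewrite ler_wpM2r ?exprn_ge0//; lra.
    by rewrite mulr1 big_split /=; lra.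
  by have := GamC n.+1; rewrite sumrB sumrB; lra.
have intQ : (\int[mu]_(t in `[0%R, T]) Q t < +oo)%E.
  rewrite integral_nneseries//; last first.
    by move=> n t _; rewrite lee_fin.
  apply: le_lt_trans (ltry (2 * (c0 * T + 32 * C))); apply: nneseries_le => n.
    by apply: integral_ge0 => t _; rewrite lee_fin.
  under eq_bigr => k _ do rewrite (integral_deriv T0 (HP k).2 (cc k)).
  by rewrite sumEFin lee_fin big_mkord.
rewrite /square_integrable_sobolev time_interval_itv; split.
- have meas (g h : R -> R) : continuous h -> (forall t, 0 <= t <= T -> g t = h t) ->
      measurable_fun `[0, T]%classic g.
    move=> ch gh; apply: (@eq_measurable_fun _ _ _ _ _ h).
      by move=> t /[!inE] /inI tT; rewrite gh.
    by apply: measurable_funS (continuous_measurable_fun ch).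
  have cst_mul (b : R) (h : R -> R) : continuous h -> continuous (fun t => b * h t).
    by move=> ch; apply: continuous_mul; first exact: cst_continuous.
  (* The factor b is -1 for the negative frequencies, whose coefficients are conjugates. *)
  have nat_case (n : nat) b :
     measurable_fun `[0, T]%classic (fun t => complex.Re (fourier (u t) n)) /\
     measurable_fun `[0, T]%classic (fun t => b * complex.Im (fourier (u t) n)).
    have [c1 c2] := cU n; split.
      apply: (meas _ (fun t => (kap n)^-1 * complex.Re (U n t))); first exact: cst_mul.
      by move=> t tT; rewrite fourier_of_fc cReZ uU.
    apply: (meas _ (fun t => b * ((kap n)^-1 * complex.Im (U n t)))).
      by apply: (cst_mul b); exact: cst_mul.
    by move=> t tT; rewrite fourier_of_fc cImZ uU.
  have pos_case (n : nat) :
     measurable_fun `[0, T]%classic (fun t => complex.Re (fourier (u t) n)) /\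
     measurable_fun `[0, T]%classic (fun t => complex.Im (fourier (u t) n)).
    have [h1 _] := nat_case n 1; have [_ h2] := nat_case n 1; split => //.
    have -> : (fun t => complex.Im (fourier (u t) n)) =
        fun t => 1 * complex.Im (fourier (u t) n) by apply/funext => t; rewrite mul1r.
    exact: h2.
  move=> k; case: (intP k) => [|n|n]; [exact: pos_case|exact: pos_case|].
  have [h1 h2] := nat_case n.+1 (-1); split.
    apply: (@eq_measurable_fun _ _ _ _ _ (fun t => complex.Re (fourier (u t) n.+1))) => //.
    move=> t /[!inE] /inI tT; rewrite fourier_opp; last exact: ui.
    by case: (fourier (u t) n.+1).
  apply: (@eq_measurable_fun _ _ _ _ _ (fun t => -1 * complex.Im (fourier (u t) n.+1))) => //.
  move=> t /[!inE] /inI tT; rewrite fourier_opp; last exact: ui.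
  by case: (fourier (u t) n.+1) => a b /=; rewrite mulN1r.
- have Q0 t : (0 <= Q t)%E by apply: nneseries_ge0 => n _ _; rewrite lee_fin.
  have Qi : mu.-integrable `[0, T]%classic Q.
    apply/integrableP; split => //.
    by under eq_integral do rewrite gee0_abs//.
  apply: (ae_imp _ (integrable_ae mI Qi)) => t /= H tT.
  have tT' := inI t tT; split; first exact: uL.
  by rewrite sQ//; move: (H tT); rewrite ge0_fin_numE.
- apply: le_lt_trans intQ; rewrite le_eqVlt; apply/orP; left; apply/eqP.
  by apply: eq_integral => t /[!inE] /inI; exact: sQ.
Qed.

End TimeRegularity.

(** * Uniqueness *)

Section ContinuousRepresentatives.
Context {R : realType}.
Implicit Types (f g : R -> R).
Local Notation mu := (@lebesgue_measure R).

Lemma periodic_shift f (x p : R) (n : int) : periodic f p -> f (x + p *~ n) = f x.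
Proof.
move=> pf; case: (intP n) => [|m|m]; first by rewrite mulr0z addr0.
  exact: (periodicn pf).
by rewrite mulrNz -[LHS](periodicn pf m.+1) subrK.
Qed.

Lemma torus_representative (x : R) : exists n : int, torus (x + (pi *+ 2) *~ n).
Proof.
pose q := (x + pi) / (pi *+ 2); exists (- Num.floor q).
have P := @pi2_gt0 R.
have h1 : (Num.floor q)%:~R <= q by exact: floor_le.
have h2 : q < (Num.floor q + 1)%:~R by exact: floorD1_gt.
move: h1 h2; rewrite ler_pdivlMr// ltr_pdivrMr// rmorphD /= => h1 h2.
rewrite /torus /= in_itv /= mulrNz -mulrzl.
by move: h1 h2; rewrite mulr2n => h1 h2; apply/andP; split; lra.
Qed.

Lemma ae_continuous_eq f g : continuous f -> continuous g ->
  periodic f (pi *+ 2) -> periodic g (pi *+ 2) -> eq_torus f g -> f = g.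
Proof.
move=> cf cg pf pg fg; apply/funext => x.
have [n tn] := torus_representative x.
rewrite -(periodic_shift x n pf) -(periodic_shift x n pg).
move: (x + _) tn => {n}x tx; apply/eqP; apply: contraT => neq.
have dx : 0 < `|f x - g x| by rewrite normr_gt0 subr_eq0.
have cfg : continuous (fun y => `|f y - g y|).
  move=> y; apply: (@continuous_comp _ _ _ (fun y => f y - g y) (fun z : R => `|z|)).
    by apply: continuousB; [exact: cf|exact: cg].
  exact: norm_continuous.
have := cfg x _ (open_nbhs_nbhs (conj (@open_gt R 0) dx)).
move=> /nbhs_ballP[e /= e0 he].
have {}he y : `|x - y| < e -> f y != g y.
  by move=> xy; have := he y xy; rewrite /= normr_gt0 subr_eq0.
move: tx; rewrite /torus /= in_itv /= => /andP[x1 x2].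
have P := @pi_gt0 R.
(* A one-sided interval at x, so that it stays inside the torus when x is an endpoint; its positive
   length contradicts equality almost everywhere. *)
have [a [b [ab aN bP ne]]] : exists a b, [/\ a < b, - pi <= a, b <= pi &
    forall y, a < y < b -> f y != g y].
  have [xp|px] := ltP x pi.
    exists x, (Num.min (x + e) pi); split => //.
    - by rewrite lt_min xp andbT; lra.
    - by rewrite ge_min lexx orbT.
    - move=> y /andP[xy]; rewrite lt_min => /andP[ye _]; apply: he.
      by rewrite distrC ger0_norm; lra.
  exists (Num.max (x - e) (- pi)), x; split => //.
  - by rewrite gt_max; apply/andP; split; lra.
  - by rewrite le_max lexx orbT.
  - move=> y /andP[]; rewrite gt_max => /andP[ye _] xy; apply: he.
    by rewrite ger0_norm; lra.
have [N [mN N0 sN]] := fg.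
have sub : `]a, b[%classic `<=` N.
  move=> y; rewrite /= in_itv /= => yab; apply: sN => /= H.
  have := ne y yab; rewrite H ?eqxx// /torus /= in_itv /=.
  by case/andP: yab => y1 y2; apply/andP; split; lra.
have : (mu `]a, b[%classic <= mu N)%E.
  by apply: le_measure => //; rewrite inE//; exact: measurable_itv.
rewrite [X in (_ <= X)%E -> _]N0 lebesgue_measure_itv /= lte_fin ab -EFinB lee_fin.
by rewrite subr_le0 leNgt ab.
Qed.

End ContinuousRepresentatives.

(** * Uniqueness for the mode system *)

Section ModeUniqueness.
Context {R : realType}.

Lemma within_quotient_continuous (D : set R) (f : R -> R) (t a : R) :
  (r - t)^-1 * (f r - f t) @[r --> within D t^'] --> a ->
  f r @[r --> within D (nbhs t)] --> f t.
Proof.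
move=> /cvgrPdist_le /(_ _ ltr01).
rewrite near_withinE near_withinE => h.
apply/cvgrPdist_le => e e0; rewrite near_withinE.
have d0 : 0 < e / (`|a| + 1) by rewrite divr_gt0// ltr_pwDr.
near=> r => Dr; have [->|rt] := eqVneq r t; first by rewrite subrr normr0 ltW.
have q1 : `|a - (r - t)^-1 * (f r - f t)| <= 1.
  have : r != t -> D r -> `|a - (r - t)^-1 * (f r - f t)| <= 1 by near: r; exact: h.
  exact.
have rd : `|t - r| < e / (`|a| + 1).
  by near: r; exact: (nbhsx_ballx t (PosNum d0)%:num).
have q2 : `|(r - t)^-1 * (f r - f t)| <= `|a| + 1.
  rewrite -[X in `|X|](subKr a); apply: (le_trans (ler_normB _ _)).
  by rewrite lerD2l.
have -> : f t - f r = (t - r) * ((r - t)^-1 * (f r - f t)).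
  by field; rewrite subr_eq0.
rewrite normrM; apply: (@le_trans _ _ (e / (`|a| + 1) * (`|a| + 1))).
  by apply: ler_pM => //; exact: ltW.
by rewrite divfK// gt_eqF// ltr_pwDr.
Unshelve. all: by end_near. Qed.

Lemma interior_quotient_deriv (D : set R) (f : R -> R) (t a : R) :
  (\forall r \near t, D r) ->
  (r - t)^-1 * (f r - f t) @[r --> within D t^'] --> a -> has_deriv f t a.
Proof.
move=> Dt /cvgrPdist_le qa; apply/is_derive1_caratheodory.
exists (fun z => if z == t then a else (z - t)^-1 * (f z - f t)); split.
- move=> z; case: eqVneq => [->|zt]; first by rewrite !subrr mulr0.
  by rewrite mulrAC mulVf ?mul1r// subr_eq0.
- apply/continuous_withinNx; rewrite eqxx.
  apply/cvgrPdist_le => e e0; have := qa e e0.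
  rewrite near_withinE near_withinE => h; rewrite near_withinE.
  near=> r => rt; rewrite (negbTE rt).
  have : r != t -> D r -> `|a - (r - t)^-1 * (f r - f t)| <= e by near: r; exact: h.
  by apply => //; near: r.
- by rewrite eqxx.
Unshelve. all: by end_near. Qed.

Lemma within_mul (D : set R) (f h : R -> R) :
  {within D, continuous f} -> {within D, continuous h} ->
  {within D, continuous (fun x => f x * h x)}.
Proof.
by move=> cf ch x; apply: (@continuousM R (subspace D) f h); [exact: cf|exact: ch].
Qed.

(** Gronwall's argument: (y^2 + z^2) e^(-Kt) does not increase for K = |1 + c| + 2 |b|, since the
    derivative of y^2 + z^2 is 2 (1 + c) y z + 2 b z^2. *)
Lemma linear_system_zero (y z : R -> R) (b c T : R) :
  {within `[0, T], continuous y} -> {within `[0, T], continuous z} ->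
  (forall t, 0 < t < T -> has_deriv y t (z t)) ->
  (forall t, 0 < t < T -> has_deriv z t (b * z t + c * y t)) ->
  y 0 = 0 -> z 0 = 0 ->
  forall t, 0 <= t <= T -> y t = 0 /\ z t = 0.
Proof.
move=> cy cz dy dz y0 z0 t /andP[]; rewrite le_eqVlt => /predU1P[<- //|t0 tT].
pose K := `|1 + c| + 2 * `|b|.
pose E x := (y x * y x + z x * z x) * expR (- K * x).
have cE : {within `[0, t], continuous E}.
  have sub : `[0, t]%classic `<=` `[0, T]%classic.
    by move=> x; rewrite /= !in_itv /= => /andP[-> xt]; rewrite (le_trans xt).
  have cy' := continuous_subspaceW sub cy; have cz' := continuous_subspaceW sub cz.
  have ce : {within `[0, t], continuous (fun x : R => expR (- K * x))}.
    apply: continuous_subspaceT => x; apply: (@continuous_comp _ _ _ (fun x => - K * x) expR).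
      exact: continuous_scale.
    exact: continuous_expR.
  apply: within_mul => //.
  have hD (f h : R -> R) : {within `[0, t], continuous f} -> {within `[0, t], continuous h} ->
      {within `[0, t], continuous (fun x => f x + h x)}.
    by move=> cf ch x; apply: (@continuousD R R (subspace `[0, t]) f h); [exact: cf|exact: ch].
  by apply: hD; exact: within_mul.
have dE x : 0 < x < T -> has_deriv E x
    ((2 * (y x * z x) + 2 * (z x * (b * z x + c * y x)) - K * (y x * y x + z x * z x)) *
     expR (- K * x)).
  move=> xT; apply: deriv_eq.
    apply: deriv_mul.
      apply: deriv_add; apply: deriv_mul; [exact: dy|exact: dy|exact: dz|exact: dz].
    apply: (deriv_comp (f := expR) (g := fun x => - K * x)); first exact: deriv_expR.
    exact: (deriv_scale _ (deriv_id x)).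
  by rewrite mulr1; ring.
have [||x + Ex] := @MVT R E (fun x =>
    (2 * (y x * z x) + 2 * (z x * (b * z x + c * y x)) - K * (y x * y x + z x * z x)) *
     expR (- K * x)) 0 t t0.
- move=> x; rewrite in_itv /= => /andP[x0 xt]; apply: dE; rewrite x0/=.
  exact: lt_le_trans tT.
- exact: cE.
move=> _; have : E t <= 0.
  have : E t - E 0 <= 0.
    rewrite Ex subr0; apply: mulr_le0_ge0; last exact: ltW.
    apply: mulr_le0_ge0; last exact: expR_ge0.
    set Y := y x; set Z := z x.
    have h1 : 2 * (1 + c) * (Y * Z) <= `|1 + c| * (Y * Y + Z * Z).
      apply: le_trans (ler_norm _) _; rewrite !normrM (ger0_norm (_ : 0 <= 2))//.
      have := sqr_ge0 (`|Y| - `|Z|); rewrite sqrrB !real_normK ?num_real// => h.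
      have := ler_wpM2l (normr_ge0 (1 + c)) h.
      by rewrite mulr0 !expr2; lra.
    have h2 : 2 * b * (Z * Z) <= 2 * `|b| * (Y * Y + Z * Z).
      have YY : 0 <= Y * Y by rewrite -expr2 sqr_ge0.
      have ZZ : 0 <= Z * Z by rewrite -expr2 sqr_ge0.
      have hb : b <= `|b| by exact: ler_norm.
      have := ler_wpM2r ZZ hb; have := mulr_ge0 (normr_ge0 b) YY; lra.
    by rewrite /K; lra.
  by rewrite {2}/E y0 z0 !mul0r addr0 mul0r subr0.
rewrite /E pmulr_lle0 ?expR_gt0// => h.
have YY : 0 <= y t * y t by rewrite -expr2 sqr_ge0.
have ZZ : 0 <= z t * z t by rewrite -expr2 sqr_ge0.
have y2 : y t * y t = 0 by lra.
have z2 : z t * z t = 0 by lra.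
by split; apply/eqP; [move/eqP: y2|move/eqP: z2]; rewrite mulf_eq0 orbb.
Qed.

Lemma within_constant (z : R -> R) (T : R) :
  {within `[0, T], continuous z} -> (forall t, 0 < t < T -> has_deriv z t 0) ->
  forall t, 0 <= t <= T -> z t = z 0.
Proof.
move=> cz dz t /andP[]; rewrite le_eqVlt => /predU1P[<- //|t0 tT].
have [||x _] := @MVT R z (fun=> 0) 0 t t0.
- move=> x; rewrite in_itv /= => /andP[x0 xt]; apply: dz; rewrite x0/=.
  exact: lt_le_trans tT.
- apply: continuous_subspaceW cz => x; rewrite /= !in_itv /= => /andP[-> xt].
  by rewrite (le_trans xt).
by rewrite mul0r => /eqP; rewrite subr_eq0 => /eqP.
Qed.

Definition within_ccontinuous (T : R) (f : R -> R[i]) : Prop :=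
  {within `[0, T], continuous (fun t => complex.Re (f t))} /\
  {within `[0, T], continuous (fun t => complex.Im (f t))}.

(** [has_deriv] is two-sided while time derivatives are one-sided at 0 and T, so the equations are
    imposed in the interior and the endpoints are reached by continuity. *)
Definition mode_solution (A g s T : R) (w eta : nat -> R -> R[i]) : Prop :=
  [/\ forall t, 0 <= t <= T -> complex.Im (w 0%N t) = 0,
      forall k, within_ccontinuous T (w k) /\ within_ccontinuous T (eta k) &
      forall k t, 0 < t < T -> has_cderiv (eta k) t (w k t) /\
        has_cderiv (w k) t (mode_rhs A g s (w^~ t) (eta^~ t) k)].

(** Induction on k: the modes below k agree, so their forcing cancels, and the difference at k
    solves a homogeneous linear system. Its coefficients are constant because the mean w_0 is. *)
Lemma mode_solution_unique (A g s T : R) (w eta w' eta' : nat -> R -> R[i]) :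
  0 <= T -> mode_solution A g s T w eta -> mode_solution A g s T w' eta' ->
  (forall k, w k 0 = w' k 0) -> (forall k, eta k 0 = eta' k 0) ->
  forall k t, 0 <= t <= T -> w k t = w' k t /\ eta k t = eta' k t.
Proof.
move=> T0 sol sol' w0 eta0.
have const (v xi : nat -> R -> R[i]) : mode_solution A g s T v xi ->
    forall t, 0 <= t <= T -> v 0%N t = v 0%N 0.
  move=> [im c d] t tT; have [[c1 c2] _] := c 0%N.
  have z x : mode_rhs A g s (v^~ x) (xi^~ x) 0 = 0.
    by rewrite /mode_rhs /dispersion expr0n !(mulr0, mul0r, oppr0, subrr, real_complex0, addr0).
  have dz x : 0 < x < T -> has_cderiv (v 0%N) x 0.
    by move=> xT; have [_] := d 0%N x xT; rewrite z.
  apply: complex_ext.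
    by apply: (@within_constant (fun x => complex.Re (v 0%N x)) T c1 _ t tT) => x /dz[].
  by apply: (@within_constant (fun x => complex.Im (v 0%N x)) T c2 _ t tT) => x /dz[].
have c1 := const _ _ sol; have c2 := const _ _ sol'.
case: (sol) => im cw dw; case: (sol') => _ cw' dw'.
have T00 : 0 <= (0 : R) <= T by rewrite lexx T0.
pose b k : R := - (A * k%:R * complex.Re (w 0%N 0)).
pose c k : R := dispersion A g s k.
have rhs k t : 0 <= t <= T -> (forall j, (j < k)%N -> w j t = w' j t) ->
    mode_rhs A g s (w^~ t) (eta^~ t) k - mode_rhs A g s (w'^~ t) (eta'^~ t) k =
    (b k)%:C%C * (w k t - w' k t) + (c k)%:C%C * (eta k t - eta' k t).
  move=> tT H; rewrite /mode_rhs -/(c k); case: (posnP k) => [k0|k0].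
    rewrite /b k0 !(mulr0, mul0r, oppr0, real_complex0, add0r).
    by rewrite mulrBr.
  rewrite !cprod_ends// (c1 t tT) (c2 t tT) -(w0 0%N).
  have -> : \sum_(j < k.+1 | (0 < j < k)%N) w' (k - j)%N t * w' j t =
     \sum_(j < k.+1 | (0 < j < k)%N) w (k - j)%N t * w j t.
    by apply: eq_bigr => j /andP[j0 jk]; rewrite !H//; lia.
  have imw := im 0 T00.
  move: (\sum_(_ < _ | _) _) (w k t) (w' k t) (eta k t) (eta' k t) (w 0%N 0) imw @b => S x x' e e' [p q] /= ->.
  by apply: complex_ext; rewrite !(cReD, cImD, cReN, cImN, cReM, cImM) /=; field.
move=> k; elim/ltn_ind: k => k IH t tT.
have cB (f h : R -> R) : {within `[0, T], continuous f} -> {within `[0, T], continuous h} ->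
    {within `[0, T], continuous (fun x => f x - h x)}.
  by move=> cf ch x; apply: (@continuousB R R (subspace `[0, T]) f h); [exact: cf|exact: ch].
have [[cw1 cw2] [ce1 ce2]] := cw k; have [[cw1' cw2'] [ce1' ce2']] := cw' k.
have ld t1 : 0 < t1 < T -> 0 <= t1 <= T by move=> /andP[? ?]; rewrite !ltW.
have re := @linear_system_zero
  (fun x => complex.Re (eta k x) - complex.Re (eta' k x))
  (fun x => complex.Re (w k x) - complex.Re (w' k x)) (b k) (c k) T (cB _ _ ce1 ce1') (cB _ _ cw1 cw1').
have im' := @linear_system_zero
  (fun x => complex.Im (eta k x) - complex.Im (eta' k x))
  (fun x => complex.Im (w k x) - complex.Im (w' k x)) (b k) (c k) T (cB _ _ ce2 ce2') (cB _ _ cw2 cw2').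
have [r1 r2] : complex.Re (eta k t) - complex.Re (eta' k t) = 0 /\
    complex.Re (w k t) - complex.Re (w' k t) = 0.
  apply: re => //; last 2 first.
  - by rewrite eta0 subrr.
  - by rewrite w0 subrr.
  - move=> x xT; have [[h _] _] := dw k x xT; have [[h' _] _] := dw' k x xT.
    exact: deriv_sub h h'.
  move=> x xT; have [_ [h _]] := dw k x xT; have [_ [h' _]] := dw' k x xT.
  apply: deriv_eq; first exact: deriv_sub h h'.
  have := congr1 (@complex.Re R) (rhs k x (ld _ xT) (fun j jk => (IH j jk x (ld _ xT)).1)).
  by rewrite !(cReD, cReN, cReZ).
have [i1 i2] : complex.Im (eta k t) - complex.Im (eta' k t) = 0 /\
    complex.Im (w k t) - complex.Im (w' k t) = 0.
  apply: im' => //; last 2 first.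
  - by rewrite eta0 subrr.
  - by rewrite w0 subrr.
  - move=> x xT; have [[_ h] _] := dw k x xT; have [[_ h'] _] := dw' k x xT.
    exact: deriv_sub h h'.
  move=> x xT; have [_ [_ h]] := dw k x xT; have [_ [_ h']] := dw' k x xT.
  apply: deriv_eq; first exact: deriv_sub h h'.
  have := congr1 (@complex.Im R) (rhs k x (ld _ xT) (fun j jk => (IH j jk x (ld _ xT)).1)).
  by rewrite !(cImD, cImN, cImZ).
by split; apply: complex_ext; apply/eqP; rewrite -subr_eq0; apply/eqP.
Qed.

(** A Fourier coefficient is a continuous functional on L^2, so it commutes with the strong time
    derivative. *)
Lemma time_derivative_quotient (T : R) (u v : R -> R -> R) t k :
  is_time_derivative T%:E u v -> 0 <= t <= T ->
  (r - t)^-1 * (complex.Re (fc (u r) k) - complex.Re (fc (u t) k))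
    @[r --> within (time_interval T%:E) t^'] --> complex.Re (fc (v t) k) /\
  (r - t)^-1 * (complex.Im (fc (u r) k) - complex.Im (fc (u t) k))
    @[r --> within (time_interval T%:E) t^'] --> complex.Im (fc (v t) k).
Proof.
move=> duv tT; have tI : time_interval T%:E t by apply/time_intervalE.
have [uL vL q0] := duv t tI; have P := @pi2_gt0 R.
have key (e : R) : 0 < e -> \forall r \near within (time_interval T%:E) t^',
    `|complex.Re (fc (v t) k) -
      (r - t)^-1 * (complex.Re (fc (u r) k) - complex.Re (fc (u t) k))| <= e /\
    `|complex.Im (fc (v t) k) -
      (r - t)^-1 * (complex.Im (fc (u r) k) - complex.Im (fc (u t) k))| <= e.
  move=> e0; have e2 : 0 < e / 2 by rewrite divr_gt0.
  have b0 : 0 < pi *+ 2 * (e / 2) ^+ 2 by rewrite mulr_gt0// exprn_gt0.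
  have h := q0 _ (open_nbhs_nbhs (conj (@open_ereal_lt_ereal R (pi *+ 2 * (e / 2) ^+ 2)%:E)
    (_ : (0 < (pi *+ 2 * (e / 2) ^+ 2)%:E)%E))).
  have {}h : \forall r \near within (time_interval T%:E) t^',
      (l2_sqnorm (fun x => ((u r x - u t x) / (r - t) - v t x)%R) < (pi *+ 2 * (e / 2) ^+ 2)%:E)%E.
    by apply: h; rewrite lte_fin.
  near=> r; have rI : time_interval T%:E r by near: r; exact: near_withinT.
  have [urL _ _] := duv r rI.
  have E : (fun x => (u r x - u t x) / (r - t) - v t x) =
      fun x => (r - t)^-1 * (u r x - u t x) - v t x.
    by apply/funext => x; rewrite mulrC.
  have dL := L2_B urL uL; have zL := L2_Z (r - t)^-1 dL; have qL := L2_B zL vL.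
  have : (l2_sqnorm (fun x => ((u r x - u t x) / (r - t) - v t x)%R) < (pi *+ 2 * (e / 2) ^+ 2)%:E)%E.
    by near: r; exact: h.
  rewrite E l2_sqnormE// lte_fin => /ltW /(fc_nsq_le k qL e2).
  have -> : 2 * (e / 2) = e by field.
  rewrite fcB; [|exact: L2_integrable..]; rewrite fcZ; last exact: L2_integrable.
  rewrite fcB; [|exact: L2_integrable..].
  rewrite cReD cReN cReZ cReD cReN cImD cImN cImZ cImD cImN.
  by rewrite distrC (distrC (complex.Im (fc (v t) k))).
split; apply/cvgrPdist_le => e e0; have := key e e0;
  by apply: filterS => r [].
Unshelve. all: by end_near. Qed.

End ModeUniqueness.

(** * From a solution to its modes *)

Section SolutionModes.
Context {R : realType}.
Implicit Types (sigma rhop rhom g T : R) (h u : R -> R).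

Lemma sobolev_h_bound sigma h : 0 <= sigma -> sobolev (5 / 2 + Num.sg sigma) h ->
  exists B, (forall n, \sum_(k < n) k%:R ^+ 5 * csq (fc h k) <= B) /\
    (sigma != 0 -> forall n, \sum_(k < n) k%:R ^+ 7 * csq (fc h k) <= B).
Proof.
rewrite le_eqVlt => /predU1P[<-|s0].
  rewrite sgr0 addr0 => /(@sobolev_power_bound R 5)[B HB].
  by exists B; split => //; rewrite eqxx.
rewrite gtr0_sg// [X in sobolev X](_ : _ = 7%:R / 2); last by field.
move=> /(@sobolev_power_bound R 7)[B HB]; exists B; split => //.
exact: (@power_sum_le _ _ B 5 7).
Qed.

Lemma sobolev2_bound u : sobolev 2 u ->
  exists B, forall n, \sum_(k < n) k%:R ^+ 4 * csq (fc u k) <= B.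
Proof.
rewrite [X in sobolev X](_ : _ = 4%:R / 2); last by field.
exact: sobolev_power_bound.
Qed.

Lemma fc_ae (f f' : R -> R) k : tintegrable f -> measurable_fun torus f' -> eq_torus f f' ->
  fc f k = fc f' k.
Proof. by move=> fi mf ff; rewrite /fc (fourier_ae _ fi mf ff). Qed.

(** The time derivatives pass to the coefficients, and the equation, valid almost everywhere in
    space, turns those of h_tt into [mode_rhs]. The Sobolev bounds needed for this are taken at each
    time separately. *)
Lemma solution_modes sigma rhop rhom g T h0 h1 (h : R -> R -> R) : 0 <= sigma -> 0 < T ->
  h_model_solution sigma rhop rhom g h0 h1 T%:E h ->
  exists ht : R -> R -> R,
    [/\ mode_solution (atwood rhop rhom) g (sigma / (rhop + rhom)) T
          (fun k t => fc (ht t) k) (fun k t => fc (h t) k),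
        h 0 = h0 /\ ht 0 = h1 &
        forall t, 0 <= t <= T -> continuous (h t) /\ L2_torus (h t)].
Proof.
move=> sg0 T0 [ht [htt [[dh dht] cont eqn init [sh sht _]]]].
have I t : 0 <= t <= T -> time_interval T%:E t by move=> ?; apply/time_intervalE.
have oI t : 0 < t < T -> 0 <= t <= T by move=> /andP[? ?]; rewrite !ltW.
exists ht; split; [|exact: init|]; last first.
  by move=> t /I tI; split; [have [] := cont t tI|have [] := dh t tI].
have wcont (u v : R -> R -> R) k : is_time_derivative T%:E u v ->
    within_ccontinuous T (fun t => fc (u t) k).
  move=> duv; split; rewrite -time_interval_itv; apply/subspace_continuousP => t tI;
  have tT : 0 <= t <= T by [apply/time_intervalE];
  have [q1 q2] := time_derivative_quotient k duv tT.
    exact: within_quotient_continuous q1.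
  exact: within_quotient_continuous q2.
have near_I t : 0 < t < T -> \forall r \near t, time_interval T%:E r.
  move=> tT; have : \forall r \near t, r \in `]0, T[ by apply: near_in_itvoo; rewrite in_itv.
  by apply: filterS => r; rewrite in_itv /= => /oI; exact: I.
have wderiv (u v : R -> R -> R) k t : is_time_derivative T%:E u v -> 0 < t < T ->
    has_cderiv (fun t => fc (u t) k) t (fc (v t) k).
  move=> duv tT; have [q1 q2] := time_derivative_quotient k duv (oI _ tT).
  by split; [exact: interior_quotient_deriv (near_I t tT) q1|
             exact: interior_quotient_deriv (near_I t tT) q2].
split.
- by move=> t _; exact: Im_fc0.
- by move=> k; split; [exact: wcont dht|exact: wcont dh].
- move=> k t tT; split; first exact: wderiv.
  have tI := I _ (oI _ tT).
  have [B1 [hB5 hB7]] := sobolev_h_bound sg0 (sh t tI).1.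
  have [B2 uB] := sobolev2_bound (sht t tI).1.
  have [_ httL _] := dht t tI; have [hL htL _] := dh t tI.
  pose B := Num.max B1 B2.
  have b1 : B1 <= B by rewrite le_max lexx.
  have b2 : B2 <= B by rewrite le_max lexx orbT.
  have [rL rE] := @fc_h_model_rhs R sigma rhop rhom g B (h t) (ht t) hL htL
    (fun n => le_trans (uB n) b2) (fun n => le_trans (hB5 n) b1)
    (fun s n => le_trans (hB7 s n) b1).
  rewrite /= -rE -(@fc_ae (htt t)); first exact: wderiv.
  + exact: L2_integrable.
  + exact: L2_measurable.
  + exact: eqn.
Qed.

Lemma solution_unique sigma rhop rhom g T h0 h1 (h h' : R -> R -> R) : 0 <= sigma -> 0 < T ->
  h_model_solution sigma rhop rhom g h0 h1 T%:E h ->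
  h_model_solution sigma rhop rhom g h0 h1 T%:E h' ->
  forall t, time_interval T%:E t -> h' t = h t.
Proof.
move=> sg0 T0 /(solution_modes sg0 T0)[u [mu_ [hi ui] hc]].
move=> /(solution_modes sg0 T0)[u' [mu_' [hi' ui'] hc']] t /time_intervalE tT.
have [c1 L1] := hc t tT; have [c2 L2] := hc' t tT.
have fch k : fc (h' t) k = fc (h t) k.
  have [] := mode_solution_unique (ltW T0) mu_' mu_ _ _ k tT => //.
  - by move=> j; rewrite ui ui'.
  - by move=> j; rewrite hi hi'.
case: (L1) => p1 _ _; case: (L2) => p2 _ _.
by apply: ae_continuous_eq => //; apply: fc_injective => //; exact: L2_integrable.
Qed.

End SolutionModes.

(** * Existence *)

Section ExistenceFromModes.
Context {R : realType}.
Implicit Types (w eta : nat -> R[i]).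

(** The energy weights vanish at k = 0, so a bound c for the mean is added to the majorant
    separately. *)
Definition first_mode (c : R) (k : nat) : R := if k == 0%N then c else 0.

Lemma sum_first_mode_le (c C : R) (m : nat -> R) n : 0 <= c ->
  (forall n, \sum_(k < n) m k <= C) -> \sum_(k < n) (first_mode c k + m k) <= c + C.
Proof.
move=> c0 mC; rewrite big_split /=; apply: lerD; last exact: mC.
case: n => [|n]; first by rewrite big_ord0.
by rewrite big_ord_recl big1 // addr0 /first_mode /= lexx.
Qed.

Lemma energy_parts s w eta k (e : R) : 0 <= s -> energy s w eta k <= e ->
  [/\ k%:R ^+ 4 * csq (w k) <= e, k%:R ^+ 5 * csq (eta k) <= e &
      s * k%:R ^+ 7 * csq (eta k) <= e].
Proof.
move=> s0; rewrite /energy mulrDl => h.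
have h1 : 0 <= k%:R ^+ 4 * csq (w k) by rewrite mulr_ge0 ?csq_ge0 ?exprn_ge0.
have h2 : 0 <= k%:R ^+ 5 * csq (eta k) by rewrite mulr_ge0 ?csq_ge0 ?exprn_ge0.
have h3 : 0 <= s * k%:R ^+ 7 * csq (eta k).
  by rewrite !mulr_ge0 ?csq_ge0 ?exprn_ge0.
by split; lra.
Qed.

(** The surface tension term fits into the energy because s^2 k^6 <= s (s k^7); the gravity term
    uses k^2 <= k^5. *)
Lemma csq_mode_rhs_le A g s w eta k (a : nat -> R) (e : R) : 0 <= s ->
  (forall j, cabs (w j) <= a j) -> energy s w eta k <= e ->
  csq (mode_rhs A g s w eta k) <=
    2 * (A / 2) ^+ 2 * (k%:R * cprod a a k) ^+ 2 + (4 * (A * g) ^+ 2 + 4 * s) * e.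
Proof.
move=> s0 wa /(energy_parts s0)[_ h5 h7].
have E : mode_rhs A g s w eta k =
    (- (A / 2 * k%:R))%:C%C * cprod w w k - (- dispersion A g s k)%:C%C * eta k.
  by rewrite /mode_rhs; apply: complex_ext; rewrite !(cReD, cImD, cReN, cImN, cReZ, cImZ); ring.
rewrite {}E; apply: (le_trans (csqB_le _ _)); rewrite !csqZ; apply: lerD.
  move: (A / 2) => b; rewrite -[leRHS]mulrA ler_wpM2l// sqrrN exprMn -[leLHS]mulrA.
  rewrite ler_wpM2l ?sqr_ge0// exprMn ler_wpM2l ?sqr_ge0// -cabs_sq ler_sqr ?nnegrE ?cabs_ge0//.
    exact: cabs_cprod_le.
  by rewrite sumr_ge0// => j _; rewrite mulr_ge0// (le_trans (cabs_ge0 _) (wa _)).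
rewrite sqrrN /dispersion; set E := csq _ in h5 h7 *.
have E0 : 0 <= E by exact: csq_ge0.
have k2 := ler_wpM2r E0 (@natpow_le R k 2 5 isT isT).
have k6 := ler_wpM2r E0 (@natpow_le R k 6 7 isT isT).
have a2 := ler_wpM2l (sqr_ge0 (A * g)) (le_trans k2 h5).
have a6 := ler_wpM2l s0 (le_trans (ler_wpM2l s0 k6) (_ : s * (k%:R ^+ 7 * E) <= e)).
have {}a6 : s * (s * (k%:R ^+ 6 * E)) <= s * e by apply: a6; rewrite mulrA.
have sq := mulr_ge0 E0 (sqr_ge0 (A * g * k%:R + s * k%:R ^+ 3)).
clear - a2 a6 sq; move: (k%:R : R) a2 a6 sq => x; rewrite !expr2.
rewrite (_ : x ^+ 6 = x ^+ 3 * x ^+ 3); last by rewrite -exprD.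
move: (x ^+ 3) => y; move=> *; lra.
Qed.

(** For k > 0 the solution a of k^4 a^2 = m k: a bound for |w_k| that does not depend on time. *)
Definition velocity_majorant (c : R) (m : nat -> R) k : R :=
  if k == 0%N then c else Num.sqrt (m k) / k%:R ^+ 2.

Lemma velocity_majorant_ge0 (c : R) m k : 0 <= c -> 0 <= velocity_majorant c m k.
Proof. by rewrite /velocity_majorant; case: eqP => // _ _; rewrite divr_ge0// sqrtr_ge0. Qed.

Lemma velocity_majorant_sum (c C : R) (m : nat -> R) : (forall k, 0 <= m k) ->
  (forall n, \sum_(k < n) m k <= C) ->
  forall n, \sum_(k < n) k%:R ^+ 4 * velocity_majorant c m k ^+ 2 <= C.
Proof.
move=> m0 mC n; apply: le_trans (mC n); apply: ler_sum => k _.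
rewrite /velocity_majorant; case: eqP => [->|/eqP k0]; first by rewrite expr0n mul0r.
rewrite exprMn exprVn -exprM sqr_sqrtr// mulrCA mulfV ?mulr1//.
by rewrite expf_neq0// pnatr_eq0.
Qed.

Lemma le_velocity_majorant (c : R) (m : nat -> R) w k : 0 <= m k -> cabs (w 0%N) <= c ->
  k%:R ^+ 4 * csq (w k) <= m k -> cabs (w k) <= velocity_majorant c m k.
Proof.
move=> m0 wc h; rewrite /velocity_majorant; case: eqP => [->//|/eqP k0].
have kp : 0 < (k%:R : R) by rewrite ltr0n lt0n.
rewrite ler_pdivlMr ?exprn_gt0// -ler_sqr ?nnegrE ?sqrtr_ge0//; last first.
  by rewrite mulr_ge0 ?cabs_ge0 ?exprn_ge0// ltW.
by rewrite sqr_sqrtr// exprMn cabs_sq -exprM mulrC.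
Qed.

Lemma choose_on (T : R) (P : R -> (R -> R) -> Prop) :
  (forall t, 0 <= t <= T -> exists f, P t f) ->
  exists F, forall t, 0 <= t <= T -> P t (F t).
Proof.
move=> H.
have H' (t : R) : exists f : R -> R, 0 <= t <= T -> P t f.
  have [tT|tT] := pselect (0 <= t <= T); last by exists id.
  by have [f Pf] := H t tT; exists f.
by have [F HF] := choice H'; exists F.
Qed.

End ExistenceFromModes.

(** * From the modes to a solution *)

Section SolutionFromModes.
Context {R : realType}.
Context (sigma rhop rhom g T C : R) (h0 h1 : R -> R).
Context (w eta : nat -> R -> R[i]) (m : nat -> R).
Let s := sigma / (rhop + rhom).
Let A := atwood rhop rhom.
Context (sigma0 : 0 <= sigma) (rho0 : 0 < rhop + rhom) (T0 : 0 < T).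
Context (L0 : L2_torus h0) (L1 : L2_torus h1).
Context (w0E : forall k, w k 0 = fc h1 k) (eta0E : forall k, eta k 0 = fc h0 k).
Context (w_mean : forall t, w 0%N t = fc h1 0).
Context (deta : forall k t, has_cderiv (eta k) t (w k t)).
Context (dw : forall k t, has_cderiv (w k) t (mode_rhs A g s (w^~ t) (eta^~ t) k)).
Context (mC : forall n, \sum_(k < n) m k <= C).
Context (em : forall k t, 0 <= t <= T -> energy s (w^~ t) (eta^~ t) k <= m k).

Let s0 : 0 <= s. Proof. by rewrite divr_ge0// ltW. Qed.

Let m0 k : 0 <= m k.
Proof. by apply: le_trans (em k (_ : 0 <= 0 <= T)); rewrite ?energy_ge0// lexx ltW. Qed.

Lemma eta_mean_real t : complex.Im (eta 0%N t) = 0.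
Proof.
apply: (@deriv_unique_cst R (fun t => complex.Im (eta 0%N t))); last first.
  by rewrite eta0E Im_fc0.
by move=> r; have [_] := deta 0%N r; rewrite w_mean Im_fc0.
Qed.

Lemma mode_bounds t k : 0 <= t <= T ->
  [/\ k%:R ^+ 4 * csq (w k t) <= m k, k%:R ^+ 5 * csq (eta k t) <= m k &
      s * k%:R ^+ 7 * csq (eta k t) <= m k].
Proof. by move=> tT; have := energy_parts s0 (em k tT). Qed.

(** The weight k^4 makes the coefficients absolutely summable, so the series converges uniformly to
    a continuous representative. *)
Lemma synthesize (z : nat -> R[i]) : complex.Im (z 0%N) = 0 ->
  (forall k, k%:R ^+ 4 * csq (z k) <= m k) ->
  exists f, [/\ continuous f, periodic f (pi *+ 2) & forall k, fc f k = z k].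
Proof.
move=> z0 zm; have zC n : \sum_(k < n) k%:R ^+ 4 * cabs (z k) ^+ 2 <= C.
  by apply: le_trans (mC n); apply: ler_sum => k _; rewrite cabs_sq.
have [f [cf pf fE _]] := uniform_series z0
  (fun n => (cabs_sum_le n (fun k => cabs_ge0 (z k)) zC).2).
by exists f.
Qed.

(** h and h_t are synthesised at each time separately, and h_tt is defined as the right-hand side.
    The equation then holds by construction; what remains is that these functions are successive
    time derivatives with the stated regularity, which is read off the coefficients. *)
Lemma solution_from_modes (Gam : nat -> R -> R) (CG : R) :
  continuous h0 -> continuous h1 ->
  (forall k t, has_deriv (Gam k) t (k%:R ^+ 5 * csq (w k t))) ->
  (forall n, \sum_(k < n) (Gam k T - Gam k 0) <= CG) ->
  exists h, h_model_solution sigma rhop rhom g h0 h1 T%:E h.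
Proof.
move=> ch0 ch1 dGam GamC.
have tT0 : 0 <= (0 : R) <= T by rewrite lexx ltW.
have [ht Hht] := @choose_on R T (fun t f => [/\ continuous f, periodic f (pi *+ 2) &
    forall k, fc f k = w k t]) (fun t tT =>
    synthesize (etrans (congr1 (@complex.Im R) (w_mean t)) (Im_fc0 h1))
      (fun k => let: And3 p _ _ := mode_bounds k tT in p)).
have eta4 t k : 0 <= t <= T -> k%:R ^+ 4 * csq (eta k t) <= m k.
  move=> tT; have [_ h5 _] := mode_bounds k tT; apply: le_trans h5.
  by rewrite ler_wpM2r ?csq_ge0 ?natpow_le.
have [h Hh] := @choose_on R T (fun t f => [/\ continuous f, periodic f (pi *+ 2) &
    forall k, fc f k = eta k t]) (fun t tT =>
    synthesize (eta_mean_real t) (fun k => eta4 t k tT)).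
have htL t : 0 <= t <= T -> L2_torus (ht t) by move=> /Hht[? ? _]; exact: L2_continuous.
have hL t : 0 <= t <= T -> L2_torus (h t) by move=> /Hh[? ? _]; exact: L2_continuous.
have fht t k : 0 <= t <= T -> fc (ht t) k = w k t by move=> /Hht[].
have fh t k : 0 <= t <= T -> fc (h t) k = eta k t by move=> /Hh[].
have C0 : 0 <= C by have := mC 0; rewrite big_ord0.
(* C / s is for the weight k^7, which the energy carries with the factor s; for s = 0 it is 0 and
   that bound is not requested. *)
pose B := C + C / s.
have CB : C <= B by rewrite lerDl divr_ge0.
pose htt t := h_model_rhs sigma rhop rhom g (h t) (ht t).
have rhs t : 0 <= t <= T -> L2_torus (htt t) /\
    forall k, fc (htt t) k = mode_rhs A g s (w^~ t) (eta^~ t) k.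
  move=> tT.
  have [| | |rL rE] := @fc_h_model_rhs R sigma rhop rhom g B (h t) (ht t) (hL t tT) (htL t tT).
  - move=> n; apply: le_trans CB; apply: le_trans (mC n); apply: ler_sum => k _.
    by rewrite fht//; have [] := mode_bounds k tT.
  - move=> n; apply: le_trans CB; apply: le_trans (mC n); apply: ler_sum => k _.
    by rewrite fh//; have [] := mode_bounds k tT.
  - move=> sn n; have sp : 0 < s by rewrite divr_gt0// lt_def sn.
    apply: (@le_trans _ _ (C / s)); last by rewrite lerDr.
    rewrite ler_pdivlMr// mulr_suml; apply: le_trans (mC n); apply: ler_sum => k _.
    by rewrite mulrC mulrA fh//; have [] := mode_bounds k tT.
  split => // k; rewrite rE.
  have -> : fc (ht t) = w^~ t by apply/funext => j; exact: fht.
  by have -> : fc (h t) = eta^~ t by apply/funext => j; exact: fh.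
have cw k : ccontinuous (w k) by exact: cderiv_ccontinuous (dw k).
have ceta k : ccontinuous (eta k) by exact: cderiv_ccontinuous (deta k).
pose c1 := csq (fc h1 0); have c10 : 0 <= c1 by exact: csq_ge0.
have wm t k : 0 <= t <= T -> csq (w k t) <= first_mode c1 k + m k.
  move=> tT; rewrite /first_mode; case: (posnP k) => [->|k0].
    by rewrite w_mean lerDl.
  rewrite add0r; have [p _ _] := mode_bounds k tT; apply: le_trans p.
  by rewrite ler_peMl ?csq_ge0// exprn_ege1// ler1n.
(* The mean of h is affine in time, hence bounded on [0, T], but the energy does not see it. *)
have [c0 c00 Hc0] : exists2 c0, 0 <= c0 & forall t, 0 <= t <= T -> csq (eta 0%N t) <= c0.
  have := @EVT_max R (fun t => csq (eta 0%N t)) 0 T (ltW T0)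
    (continuous_subspaceT (continuous_csq (ceta 0%N))).
  move=> [c _ H]; exists (csq (eta 0%N c)); first exact: csq_ge0.
  by move=> t tT; apply: H; rewrite in_itv.
exists h, ht, htt; split.
- split.
  + apply: (@time_derivative_intro R T (c1 + C) h ht eta w (fun k => first_mode c1 k + m k)).
    * by move=> t tT; split; [exact: hL|exact: htL].
    * by move=> t k tT; split; [exact: fh|exact: fht].
    * exact: deta.
    * by move=> t k; exact: wm.
    * by move=> n; exact: sum_first_mode_le.
  + pose a := velocity_majorant (cabs (fc h1 0)) m.
    have a0 k : 0 <= a k by apply: velocity_majorant_ge0; exact: cabs_ge0.
    have aC : forall n, \sum_(k < n) k%:R ^+ 4 * a k ^+ 2 <= C by exact: velocity_majorant_sum.
    pose b := 2 * (A / 2) ^+ 2; pose d := 4 * (A * g) ^+ 2 + 4 * s.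
    have b0 : 0 <= b by apply: mulr_ge0 => //; exact: sqr_ge0.
    have d0 : 0 <= d by apply: addr_ge0; apply: mulr_ge0 => //; exact: sqr_ge0.
    apply: (@time_derivative_intro R T
      (b * (2 * ((a 0%N + (1 + C / 2)) * (1 + C / 2))) ^+ 2 + d * C) ht htt w
      (fun k t => mode_rhs A g s (w^~ t) (eta^~ t) k)
      (fun k => b * (k%:R * cprod a a k) ^+ 2 + d * m k)).
    * by move=> t tT; split; [exact: htL|have [] := rhs t tT].
    * by move=> t k tT; split; [exact: fht|have [_ ->] := rhs t tT].
    * exact: dw.
    * move=> t k tT; apply: (csq_mode_rhs_le (w := w^~ t) A g s0 _ (em k tT)) => j.
      apply: (le_velocity_majorant (w := w^~ t)) => //; first by rewrite w_mean.
      by have [] := mode_bounds j tT.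
    * move=> n; rewrite big_split /= -!mulr_sumr; apply: lerD; apply: ler_wpM2l => //.
        by apply: derivative_square_bound.
      exact: mC.
- move=> t /time_intervalE tT; split; first by have [] := Hh t tT.
  by have [] := Hht t tT.
- by move=> t _; exact: ae_eq_refl.
(* The synthesised functions at time 0 share their coefficients with the data; as both are
   continuous, they are equal everywhere. *)
- have init (f f0 : R -> R) : continuous f -> continuous f0 -> L2_torus f -> L2_torus f0 ->
      (forall k, fc f k = fc f0 k) -> f = f0.
    move=> cf cf0 fL f0L E; case: (fL) => pf _ _; case: (f0L) => pf0 _ _.
    by apply: ae_continuous_eq => //; apply: fc_injective => //; exact: L2_integrable.
  have [ch _ _] := Hh 0 tT0; have [cht _ _] := Hht 0 tT0; split.
    by apply: init => // [|k]; [exact: hL|rewrite fh].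
  by apply: init => // [|k]; [exact: htL|rewrite fht].
- split.
  (* The Sobolev exponent is 5/2 or 7/2 according to the sign of sigma, and the weight is controlled
     by k^5 or by s k^7; in the second case K contains 1 / s. *)
  + have [K K0 wK] : exists2 K, 0 <= K & forall t k, 0 <= t <= T -> (0 < k)%N ->
        wt (5 / 2 + Num.sg sigma) k * csq (eta k t) <= K * m k.
      have [sz|sn] := eqVneq sigma 0.
        exists (2 ^+ 5); first by rewrite exprn_ge0.
        move=> t k tT k0; rewrite sz sgr0 addr0.
        have [_ h5 _] := mode_bounds k tT.
        apply: le_trans (ler_wpM2r (csq_ge0 _) (@wt_le R 5 k k0)) _.
        by rewrite -mulrA ler_wpM2l ?exprn_ge0.
      have sp : 0 < s by rewrite divr_gt0// lt_def sn.
      exists (2 ^+ 7 / s); first by rewrite divr_ge0 ?exprn_ge0.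
      move=> t k tT k0; rewrite gtr0_sg ?lt_def ?sn//.
      rewrite [X in wt X](_ : _ = 7%:R / 2); last by field.
      have [_ _ h7] := mode_bounds k tT.
      apply: le_trans (ler_wpM2r (csq_ge0 _) (@wt_le R 7 k k0)) _.
      rewrite -[leLHS]mulrA -[leRHS]mulrA ler_wpM2l ?exprn_ge0// ler_pdivlMl//.
      by rewrite mulrA.
    apply: (@continuous_sobolev_intro R T _ (c0 + K * C) h eta
      (fun k => first_mode c0 k + K * m k)) => //.
    * move=> t k tT; rewrite /first_mode; case: (posnP k) => [->|k0].
        by rewrite wt0 mul1r; have := Hc0 t tT; have := mulr_ge0 K0 (m0 0%N); lra.
      by rewrite add0r wK.
    * move=> n; apply: (@sum_first_mode_le R c0 (K * C) (fun k => K * m k)) => // n'.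
      by rewrite -mulr_sumr ler_wpM2l// mC.
  + apply: (@continuous_sobolev_intro R T _ (c1 + 2 ^+ 4 * C) ht w
      (fun k => first_mode c1 k + 2 ^+ 4 * m k)) => //.
    * move=> t k tT; rewrite /first_mode; case: (posnP k) => [->|k0].
        by rewrite wt0 mul1r w_mean lerDl mulr_ge0 ?exprn_ge0.
      rewrite add0r [X in wt X](_ : _ = 4%:R / 2); last by field.
      have [h4 _ _] := mode_bounds k tT.
      apply: le_trans (ler_wpM2r (csq_ge0 _) (@wt_le R 4 k k0)) _.
      by rewrite -mulrA ler_wpM2l ?exprn_ge0.
    * move=> n; apply: (@sum_first_mode_le R c1 (2 ^+ 4 * C) (fun k => 2 ^+ 4 * m k)) => // n'.
      by rewrite -mulr_sumr ler_wpM2l ?exprn_ge0 ?mC.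
  + apply: (@square_integrable_intro R T CG c1 ht w Gam) => //.
    by move=> t _; rewrite w_mean.
Qed.

End SolutionFromModes.

Theorem theorem1 (R : realType) (sigma rhop rhom g : R) (h0 h1 : R -> R)
    (lambda : R) :
  0 <= sigma -> 0 < rhop -> 0 < rhom -> g != 0 ->
  sobolev (5 / 2 + Num.sg sigma) h0 -> sobolev 2 h1 ->
  (* continuous representatives of the initial data *)
  continuous h0 -> continuous h1 ->
  is_minimum torus (fun alpha => atwood rhop rhom * h1 alpha) lambda ->
  0 < lambda ->
  exists2 Tstar : \bar R, (0 < Tstar)%E &
    exists h : R -> R -> R,
      h_model_solution sigma rhop rhom g h0 h1 Tstar h /\
      (forall h' : R -> R -> R,
         h_model_solution sigma rhop rhom g h0 h1 Tstar h' ->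
         forall t, time_interval Tstar t -> h' t = h t).
Proof.
move=> sg0 rp rm _ sh0 sh1 ch0 ch1 [_ lmin] lam0.
have rho0 : 0 < rhop + rhom by rewrite addr_gt0.
have L0 := sh0.1; have L1 := sh1.1.
pose s := sigma / (rhop + rhom); have s0 : 0 <= s by rewrite divr_ge0// ltW.
have [B1 [B5 B7]] := sobolev_h_bound sg0 sh0; have [B2 B4] := sobolev2_bound sh1.
have EB n : \sum_(k < n) energy s (fc h1) (fc h0) k <= B2 + (s * B1 + B1).
  rewrite /energy big_split; apply: lerD; first exact: B4.
  under eq_bigr do rewrite mulrDl -mulrA.
  rewrite big_split -mulr_sumr; apply: lerD; last exact: B5.
  have [z|/B7 B7n] := eqVneq sigma 0; first by rewrite /s z !mul0r.
  exact: ler_wpM2l.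
have [T [w [eta [T0 [[w0E eta0E] wm dwe [m [[C mC] em]] [Gam [dGam [CG GamC]]]]]]]] :=
  modes_local_existence g s0 lam0 (Im_fc0 h1)
    (fun n v => toeplitz_lower_bound v n (L2_integrable L1) lmin) EB.
have [h hsol] := solution_from_modes sg0 rho0 T0 L0 L1 w0E eta0E wm
  (fun k t => (dwe k t).1) (fun k t => (dwe k t).2) mC em ch0 ch1 dGam GamC.
exists T%:E; first by rewrite lte_fin.
by exists h; split => // h'; exact: solution_unique.
Qed.
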